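(* Let $k\in\mathbb{N}$ with $k>1$. Then $\mathcal{L}(2k)\geq k^2+2k+1$ and $\mathcal{L}(2k+1)\geq k^2+2k+3$, where $\mathcal{L}(n)$ denotes the maximum number of limit cycles that planar piecewise linear vector fields with two zones separated by a branch of an algebraic curve of degree $n$ can have.
   Context: A planar piecewise linear vector field with two zones separated by a curve $\Sigma\subset\mathbb{R}^2$ is a vector field $Z$ equal to an affine vector field $X(x,y)=A^{+}(x,y)^T+b^{+}$ on one side of $\Sigma$ and to an affine vector field $Y(x,y)=A^{-}(x,y)^T+b^{-}$ on the other side (''linear'' allows constant terms). Trajectories are understood according to Filippov's convention for discontinuous differential systems: at points of $\Sigma$ where $X$ and $Y$ are both transversal to $\Sigma$ and point to the same side, trajectories cross $\Sigma$ by concatenation. An algebraic curve of degree $n$ is the zero set in $\mathbb{R}^2$ of a real polynomial in two variables of degree $n$; a branch of it is a connected component of this zero set, here one that separates the plane into two zones. A limit cycle is a periodic orbit that is isolated in the set of periodic orbits of the system. For $n\in\mathbb{N}$, $\mathcal{L}(n)$ is the maximum (supremum, possibly $+\infty$) of the number of limit cycles over all planar piecewise linear vector fields with two zones separated by a branch of an algebraic curve of degree $n$. Thus $\mathcal{L}(n)\ge N$ means that there are such systems having at least $N$ limit cycles. *)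

(* Defs.v *)
From HB Require Import structures.
From mathcomp Require Import all_boot all_order all_algebra.
From mathcomp Require Import all_classical all_reals all_analysis.
(* The notations of mpoly clash with those of mathcomp-analysis. *)
From mathcomp Require Import -(notations) mpoly.
Import Order.TTheory GRing.Theory Num.Theory.
Import numFieldNormedType.Exports.
Set Implicit Arguments.
Unset Strict Implicit.
Unset Printing Implicit Defensive.
Local Open Scope classical_set_scope.
Local Open Scope ring_scope.

Definition zero_set (R : realType) (p : mpoly 2 R) : set 'cV[R]_2 :=
  [set z | meval (fun i => z i ord0) p = 0].

Definition is_component (T : topologicalType) (A C : set T) : Prop :=
  exists2 x, A x & C = connected_component A x.

(* The field is [matX *m z + vecX] on [zoneX] and [matY *m z + vecY] on
   [zoneY]; the zones are exactly the connected components of the complement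
   of [branch].  [mmeasure mdeg] is the size of a polynomial, that is, its
   total degree plus one. *)
Record pwl_system (R : realType) (n : nat) := PwlSystem {
  curve : mpoly 2 R ;
  branch : set 'cV[R]_2 ;
  zoneX : set 'cV[R]_2 ;
  zoneY : set 'cV[R]_2 ;
  matX : 'M[R]_2 ;
  vecX : 'cV[R]_2 ;
  matY : 'M[R]_2 ;
  vecY : 'cV[R]_2 ;
  size_curve : mmeasure mdeg curve = n.+1 ;
  branchP : is_component (zero_set curve) branch ;
  zoneXP : is_component (~` branch) zoneX ;
  zoneYP : is_component (~` branch) zoneY ;
  zones_neq : zoneX <> zoneY ;
  zones_cover : zoneX `|` zoneY = ~` branch
}.

Section Dynamics.
Context (R : realType) (n : nat) (Z : pwl_system R n).

Definition fieldX (z : 'cV[R]_2) : 'cV[R]_2 := matX Z *m z + vecX Z.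
Definition fieldY (z : 'cV[R]_2) : 'cV[R]_2 := matY Z *m z + vecY Z.

(* Filippov's set-valued field: the convex hull of the limits at [z] of the
   values of the field in the two zones.  It is the value of the field when
   [z] lies in a zone (zones are open), and the segment [fieldX z, fieldY z]
   when [z] is on the common boundary of the zones. *)
Definition filippov (z : 'cV[R]_2) : set 'cV[R]_2 :=
  [set v | exists l : R,
    [/\ 0 <= l <= 1,
        ~ closure (zoneX Z) z -> l = 0,
        ~ closure (zoneY Z) z -> l = 1 &
        v = l *: fieldX z + (1 - l) *: fieldY z]].

(* Absolute continuity on every compact interval; the [s i, t i] are
   non-overlapping when their interiors are pairwise disjoint. *)
Definition locally_abs_continuous (g : R -> 'cV[R]_2) : Prop :=
  forall a b e : R, 0 < e ->
  exists2 d : R, 0 < d &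
    forall (m : nat) (s t : 'I_m -> R),
      (forall i, a <= s i /\ s i <= t i /\ t i <= b) ->
      trivIset [set: 'I_m] (fun i => `]s i, t i[%classic) ->
      \sum_(i < m) (t i - s i) < d ->
      \sum_(i < m) `|g (t i) - g (s i)| < e.

(* Trajectories in the sense of Filippov: absolutely continuous solutions of
   the differential inclusion z' \in filippov z.  At a point of the branch
   where both fields are transversal to it and point to the same side, this
   forces crossing by concatenation. *)
Definition trajectory (g : R -> 'cV[R]_2) : Prop :=
  locally_abs_continuous g /\
  {ae (@lebesgue_measure R), forall t,
     exists2 v, filippov (g t) v & is_derive t (1 : R) g v}.

(* Filippov trajectories need not be determined by their initial point, so
   that a closed trajectory is run through once is made explicit by
   injectivity on a period (this also excludes equilibria). *)
Definition periodic_orbit (O : set 'cV[R]_2) : Prop :=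
  exists (g : R -> 'cV[R]_2) (T : R),
    [/\ trajectory g, 0 < T, (forall t, g (t + T) = g t),
        {in `[0, T[ &, injective g} & O = range g].

Definition limit_cycle (O : set 'cV[R]_2) : Prop :=
  periodic_orbit O /\
  exists U : set 'cV[R]_2,
    [/\ open U, O `<=` U &
        forall O', periodic_orbit O' -> O' `<=` U -> O' = O].

End Dynamics.

(* The supremum, in the extended reals, of the number of limit cycles (+oo for
   infinitely many) of the systems separated by a branch of a curve of
   degree n. *)
Definition calL (R : realType) (n : nat) : \bar R :=
  ereal_sup [set counting (@limit_cycle R n Z) | Z in [set: pwl_system R n]].

(* Main.v *)
(* Above the branch take the field X = (-1, x), with first integral x^2 + 2y, and
   below it a weak focus Y = (mu x - (y+1), x + mu (y+1)) at (0,-1).  Let the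
   branch be, near the origin, a flat graph y = f(x).  A parabola x^2 + 2y = l
   meets it at two points, of heights u on the right and v on the left, and the
   orbit through them closes up iff mu times the angle swept around the focus is
   the logarithm of the ratio of their distances to (0,-1).  The squares of these
   distances are l + 1 + u^2 and l + 1 + v^2, so closed orbits are the solutions
   of level(l) = mu, where level(l) has the sign of u^2 - v^2.

   The branch is the oval around (0, 32 s), s = 1 or -1, of
     s (y - d tau(x^2) - kap x Q(y)) = y^2 / 64,
   with tau(X) = T_k(2 - X) - w0 and Q(y) = d q(y/d + w0), where w0 is a root of
   the Chebyshev polynomial T_n(w) = (w - w0) q(w).  It is star-shaped, hence
   separates the plane.  As u and v are close to d tau(x^2), u^2 - v^2 is close to
   4 kap d^2 x tau(x^2) q(tau(x^2) + w0) = 4 kap d^2 x T_n(T_k(2 - x^2)), which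
   alternates in sign at the k n + 1 extremal points of T_(k n); together with one
   more sign change inside, this gives k n + 1 closed orbits for every small
   mu > 0.  The curve has degree n for 2 k <= n, and n = 2k, 2k + 1 give at least
   the required numbers.

   The level function is Lipschitz, so almost all its level sets on a compact
   interval are finite; for such mu the closed orbits are isolated. *)
Require Import Defs.
From mathcomp Require Import all_boot all_order all_algebra.
From mathcomp Require Import finmap.
From mathcomp Require Import all_classical all_reals all_analysis.
From mathcomp Require Import measurable_realfun.
From mathcomp Require Import -(notations) mpoly.
From mathcomp Require Import zify ring lra.
Import Order.TTheory GRing.Theory Num.Theory.
Import numFieldNormedType.Exports.
Set Implicit Arguments.
Unset Strict Implicit.
Unset Printing Implicit Defensive.
Local Open Scope classical_set_scope.
Local Open Scope ring_scope.

(** * Trajectories of piecewise linear systems *)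

(** A limit cycle must be isolated among all Filippov periodic orbits, and these solve a set-valued
    inclusion without uniqueness. Near [x = 0] both fields are almost tangent to the flat branch,
    and crossings cannot be controlled there. So orbits are classified only in an open region from
    which the part of the branch with labels outside a window is removed; there every crossing is
    transversal and the return map is explicit. The focus sits at depth 1 because [x^2 + (u + 1)^2]
    with [x^2 = l - 2 u] then loses its linear term in [u]: only squares of heights compete. In
    [u^2 - v^2 = (u + v) (u - v)] the first factor comes from the even part of the curve, the second
    from its single odd term [kap x Q(y)]. Nothing about the curve depends on [mu], so [mu] is
    chosen last. The sign [s] is [(-1)^k]: then [s T_k(2 - X) = T_k(X - 2)] grows for large [X] and
    closes the oval. The additional sign change is gained at a small abscissa [x0], where the factor
    [x] keeps the level below its high values whatever the sign of [T_n]. *)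

Lemma real_induction (R : realType) (P : R -> Prop) (a b : R) : a <= b -> P a ->
  (forall t, a <= t <= b -> exists2 r, 0 < r & forall s s',
     a <= s <= t -> t <= s' <= b -> t - r < s -> s' < t + r -> P s -> P s') ->
  P b.
Proof.
move=> leab Pa step.
pose S := [set t | a <= t <= b /\ P t].
have Sa : S a by split=> //; rewrite lexx.
have hS : has_sup S by split; [exists a | exists b => t -[/andP[]]].
have at0 : a <= sup S by apply: ub_le_sup => //; case: hS.
have t0b : sup S <= b by apply: ge_sup; [exists a | move=> t -[/andP[]]].
(* Applied at the supremum, the step reaches it from a nearby good point and then passes it, which
   is absurd unless [b] lies within [r / 2]. *)
have [|r r0 Hr] := step (sup S); first by rewrite at0 t0b.
have [s [/andP[as_ sb] Ps] ltss] := sup_adherent r0 hS.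
have s_sup : s <= sup S by apply: ub_le_sup; [case: hS | split=> //; rewrite as_ sb].
pose s' := Num.min b (sup S + r / 2).
have s'1 : s' <= b by rewrite ge_min lexx.
have s'2 : s' <= sup S + r / 2 by rewrite ge_min lexx orbT.
have s'3 : sup S <= s' by rewrite le_min t0b/=; lra.
have Ps' : P s'.
  by apply: (Hr s s') => //; rewrite ?as_ ?s'3 ?s'1// ; lra.
have [bs|bs] := leP b (sup S + r / 2).
  by move: Ps'; rewrite /s' (min_idPl bs).
have : s' <= sup S.
  apply: ub_le_sup; first by case: hS.
  by split => //; rewrite s'1 (le_trans at0).
by rewrite /s' (min_idPr (ltW bs)); lra.
Qed.

Definition abs_cont (R : realType) (h : R -> R) (a b : R) :=
  forall e : R, 0 < e ->
  exists2 d : R, 0 < d &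
    forall (m : nat) (s t : 'I_m -> R),
      (forall i, a <= s i /\ s i <= t i /\ t i <= b) ->
      trivIset [set: 'I_m] (fun i => `]s i, t i[%classic) ->
      \sum_(i < m) (t i - s i) < d ->
      \sum_(i < m) `|h (t i) - h (s i)| < e.

Lemma sum_disjoint_itv_le (R : realType) (G : set R) (m : nat) (s t : 'I_m -> R) (d : R) :
  measurable G -> (lebesgue_measure G < d%:E)%E ->
  (forall i, s i <= t i) ->
  trivIset [set: 'I_m] (fun i => `]s i, t i[%classic) ->
  (forall i, `]s i, t i[%classic `<=` G) ->
  \sum_(i < m) (t i - s i) < d.
Proof.
move=> mG Gd st tr sG.
rewrite -lte_fin; apply: le_lt_trans Gd.
have mI i : measurable (`]s i, t i[%classic : set R) by exact: measurable_itv.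
have -> : (\sum_(i < m) (t i - s i))%:E =
    lebesgue_measure (\big[setU/set0]_(i < m) (`]s i, t i[%classic : set R)).
  rewrite (measure_bigsetU_ord _ xpredT)//.
  rewrite -sumEFin; apply: eq_bigr => i _.
  transitivity (if ((s i)%:E < (t i)%:E)%E then ((t i)%:E - (s i)%:E)%E else 0%E); last first.
    exact/esym/(lebesgue_measure_itv `]s i, t i[).
  rewrite lte_fin.
  case: ltP => // ts; have -> : s i = t i by apply/eqP; rewrite eq_le st ts.
  by rewrite subrr.
apply: le_measure; rewrite ?inE//; first exact: bigsetU_measurable.
by apply: (big_ind (fun A => A `<=` G)) => //; move=> A B; rewrite subUset.
Qed.

Lemma is_derive_approx (R : realType) (h : R -> R) (t v e : R) : is_derive t (1 : R) h v ->
  0 < e -> exists2 r, 0 < r &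
    forall w, `|w - t| < r -> `|h w - h t - v * (w - t)| <= e * `|w - t|.
Proof.
move=> [dh <-] e0.
have := dh; rewrite /derivable => /(cvgrPdist_le) /(_ e e0).
rewrite -/('D_1 h t).
rewrite near_withinE => /nbhs_ballP[r /= r0 Hr]; exists r => // w wr.
have [->|wt] := eqVneq w t; first by rewrite !subrr mulr0 subr0 normr0 mulr0.
have wt0 : w - t != 0 by rewrite subr_eq0.
have := Hr (w - t); rewrite /ball /= sub0r normrN => /(_ wr wt0).
rewrite [_%:A]mulr1 subrK -[_ *: _]/(_ * _).
set D := 'D_1 h t => H.
have -> : h w - h t - D * (w - t) = - (D - (w - t)^-1 * (h w - h t)) * (w - t).
  by rewrite mulrC; field.
by rewrite normrM normrN ler_wpM2r.
Qed.

(** A covering argument replaces integration of the derivative. The exceptional null set lies in an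
    open set of measure less than the [d] of absolute continuity, so what [h] loses there is less
    than [e]; at the other points the derivative is nonnegative and the loss is at most [e] per unit
    of time. *)
Lemma abs_cont_nondecreasing (R : realType) (h : R -> R) (a b : R) : a <= b ->
  abs_cont h a b ->
  {ae (@lebesgue_measure R), forall t, a <= t <= b ->
      exists2 v, 0 <= v & is_derive t (1 : R) h v} ->
  h a <= h b.
Proof.
move=> ab ach [N [mN N0 subN]].
suff Hs e : 0 < e -> - (e * (b - a)) - e <= h b - h a.
  rewrite -subr_ge0 -oppr_le0; apply/ler_addgt0Pl => e e0; rewrite addr0.
  have d0 : 0 < b - a + 1 by lra.
  have := Hs (e / (b - a + 1)) (divr_gt0 e0 d0).
  have -> : - (e / (b - a + 1) * (b - a)) - e / (b - a + 1) = - e by field; lra.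
  lra.
move=> e0; have [d d0 Hd] := ach e e0.
have [G [oG NG Gd]] : exists G : set R, [/\ open G, N `<=` G & (lebesgue_measure G < d%:E)%E].
  have [|G [oG NG Gd]] := lebesgue_regularity_outer mN _ d0; first by rewrite [X in (X < _)%E]N0 ltry.
  exists G; split => //; apply: le_lt_trans Gd.
  have GE : N `|` (G `\` N) = G by rewrite setDUK.
  rewrite -{1}GE; apply: le_trans (_ : _ <= lebesgue_measure N + lebesgue_measure (G `\` N))%E _.
    by apply: measureU2 => //; apply: measurableD => //; exact: measurable_realfun.open_measurable.
  by rewrite [X in (X + _)%E]N0 add0e.
have mG : measurable G by exact: measurable_realfun.open_measurable.
(* [P t] bounds the loss up to [t] by a linear part and the variation over finitely many disjoint
   intervals inside [G]. They all end at or before [t], so that an interval added at the end is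
   disjoint from them. *)
pose P t := exists (m : nat) (s u : 'I_m -> R),
  [/\ forall i, a <= s i /\ s i <= u i /\ u i <= t,
      trivIset [set: 'I_m] (fun i => `]s i, u i[%classic),
      forall i, `]s i, u i[%classic `<=` G &
      - (e * (t - a)) - \sum_(i < m) `|h (u i) - h (s i)| <= h t - h a].
have [m [s [u [asu tr sG Hh]]]] : P b.
  apply: (real_induction ab).
    exists 0%N, (fun=> 0), (fun=> 0); split; [by case | by move=> [] | by case |].
    by rewrite big_ord0; lra.
  move=> t /andP[at_ tb].
  (* Around a point of the null set the whole piece from [s] to [s'] lies in [G] and becomes one
     more interval; around any other point the derivative at [t] lets the linear part absorb it. *)
  have [Nt|nNt] := pselect (N t).
    have /nbhs_ballP[r /= r0 Hr] : nbhs t G by apply: open_nbhs_nbhs; split => //; exact: NG.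
    exists r => // s s' /andP[as_ st] /andP[ts' s'b] rs s'r [m [p [q [H1 H2 H3 H4]]]].
    pose p' (i : 'I_m.+1) := if unlift ord_max i is Some j then p j else s.
    pose q' (i : 'I_m.+1) := if unlift ord_max i is Some j then q j else s'.
    exists m.+1, p', q'; split.
    - move=> i; rewrite /p' /q'; case: unliftP => [j _|_]; last by lra.
      by have := H1 j; lra.
    - move=> i j _ _; rewrite /p' /q'.
      case: unliftP => [i' ->|->]; case: unliftP => [j' ->|->] //.
      + by move=> H; congr lift; apply: H2.
      + move=> [x []] /=; rewrite !in_itv/= => /andP[_ x1] /andP[x2 _].
        by exfalso; have [_ [_]] := H1 i'; lra.
      + move=> [x []] /=; rewrite !in_itv/= => /andP[x2 _] /andP[_ x1].
        by exfalso; have [_ [_]] := H1 j'; lra.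
    - move=> i; rewrite /p' /q'; case: unliftP => [j _|_]; first exact: H3.
      move=> x /=; rewrite in_itv/= => /andP[x1 x2]; apply: Hr.
      by rewrite /ball/= ltr_norml; apply/andP; split; lra.
    - rewrite big_ord_recr /=.
      under eq_bigr do rewrite /p' /q'.
      rewrite /p' /q' unlift_none.
      under eq_bigr => i _.
        have -> : widen_ord (leqnSn m) i = lift ord_max i.
          by apply: val_inj; rewrite /= /bump leqNgt ltn_ord.
        rewrite liftK; over.
      have : `|h s' - h s| >= - (h s' - h s) by rewrite -normrN ler_norm.
      have : e * (s' - s) >= 0 by apply: mulr_ge0; lra.
      lra.
  have [v v0 /is_derive_approx/(_ e0)[r r0 Hr]] : exists2 v, 0 <= v & is_derive t (1 : R) h v.
    apply: contrapT => H; apply: nNt; apply: subN => /= K; apply: H; apply: K.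
    by rewrite at_.
  exists r => // s s' /andP[as_ st] /andP[ts' s'b] rs s'r [m [p [q [H1 H2 H3 H4]]]].
  exists m, p, q; split => //.
    by move=> i; have := H1 i; lra.
  have := Hr s; rewrite distrC ger0_norm; last lra.
  move=> /(_ _)/[!ler_norml] K1.
  have := Hr s'; rewrite [ `|s' - t|]ger0_norm; last lra.
  move=> /(_ _)/[!ler_norml] K2.
  have /andP[_ {}K1] := K1 ltac:(lra).
  have /andP[{}K2 _] := K2 ltac:(lra).
  have : v * (t - s) >= 0 by apply: mulr_ge0; lra.
  have : v * (s' - t) >= 0 by apply: mulr_ge0; lra.
  nra.
have := Hd m s u asu tr.
have := sum_disjoint_itv_le mG Gd (fun i => (asu i).2.1) tr sG.
move=> /[swap] /[apply]; lra.
Qed.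

Section Plane.
Context {R : realType}.
Implicit Types z v : 'cV[R]_2.

Definition xc z : R := z ord0 ord0.
Definition yc z : R := z ord_max ord0.
Definition vec2 (x y : R) : 'cV[R]_2 := \col_i (if i == ord0 then x else y).

Lemma xc_vec2 x y : xc (vec2 x y) = x. Proof. by rewrite /xc mxE. Qed.
Lemma yc_vec2 x y : yc (vec2 x y) = y. Proof. by rewrite /yc mxE. Qed.

Lemma vec2P z z' : xc z = xc z' -> yc z = yc z' -> z = z'.
Proof.
move=> h0 h1; apply/matrixP => i j; rewrite ord1.
by case: i => [[|[|//]] i2]; [rewrite (_ : Ordinal _ = ord0) | rewrite (_ : Ordinal _ = ord_max)];
  rewrite //; apply: val_inj.
Qed.

Lemma xcD z z' : xc (z + z') = xc z + xc z'. Proof. by rewrite /xc mxE. Qed.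
Lemma ycD z z' : yc (z + z') = yc z + yc z'. Proof. by rewrite /yc mxE. Qed.
Lemma xcN z : xc (- z) = - xc z. Proof. by rewrite /xc mxE. Qed.
Lemma ycN z : yc (- z) = - yc z. Proof. by rewrite /yc mxE. Qed.
Lemma xcZ a z : xc (a *: z) = a * xc z. Proof. by rewrite /xc mxE. Qed.
Lemma ycZ a z : yc (a *: z) = a * yc z. Proof. by rewrite /yc mxE. Qed.

Lemma xc_continuous : continuous xc. Proof. exact: coord_continuous. Qed.
Lemma yc_continuous : continuous yc. Proof. exact: coord_continuous. Qed.

Lemma xc_norm z : `|xc z| <= `|z|.
Proof.
rewrite [leRHS]/Num.Def.normr/= mx_normrE.
exact: (le_bigmax _ (fun i => `|z i.1 i.2|) (ord0, ord0)).
Qed.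

Lemma yc_norm z : `|yc z| <= `|z|.
Proof.
rewrite [leRHS]/Num.Def.normr/= mx_normrE.
exact: (le_bigmax _ (fun i => `|z i.1 i.2|) (ord_max, ord0)).
Qed.

Lemma norm_vec2 z : `|z| <= `|xc z| + `|yc z|.
Proof.
rewrite [leLHS]/Num.Def.normr/= mx_normrE; apply/bigmax_leP; split; first exact: addr_ge0.
move=> [i j] _ /=; rewrite ord1.
have [->|->] : i = ord0 \/ i = ord_max.
  by case: i => [[|[|//]] i2]; [left|right]; apply: val_inj.
  by rewrite lerDl.
by rewrite lerDr.
Qed.

Lemma vec2_continuous (T : topologicalType) (u v : T -> R) (t : T) :
  {for t, continuous u} -> {for t, continuous v} ->
  {for t, continuous (fun s => vec2 (u s) (v s))}.
Proof.
move=> cu cv; apply/cvgrPdist_lt => /= e e0.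
have e20 : 0 < e / 2 by rewrite divr_gt0.
move/cvgrPdist_lt : cu => /(_ _ e20) cu; move/cvgrPdist_lt : cv => /(_ _ e20) cv.
near=> s; apply: le_lt_trans (norm_vec2 _) _.
rewrite xcD ycD xcN ycN !xc_vec2 !yc_vec2 (splitr e) ltrD//.
  by near: s; exact: cu.
by near: s; exact: cv.
Unshelve. all: by end_near. Qed.

Lemma is_derive_vec2 (g : R -> 'cV[R]_2) (t : R) v :
  is_derive t (1 : R) g v <->
  is_derive t (1 : R) (xc \o g) (xc v) /\ is_derive t (1 : R) (yc \o g) (yc v).
Proof.
split=> [[dg <-]|[[dx ex] [dy ey]]].
  move/derivable_mxP : (dg) => dij.
  split; split; [exact: (dij ord0 ord0)|by rewrite derive_mx// /xc mxE
                |exact: (dij ord_max ord0)|by rewrite derive_mx// /yc mxE].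
have dg : derivable g t 1.
  apply/derivable_mxP => i j; rewrite ord1.
  have [->|->] : i = ord0 \/ i = ord_max; [|exact: dx|exact: dy].
  by case: i => [[|[|m]] hm] //; [left|right]; exact: val_inj.
by split => //; rewrite derive_mx//; apply: vec2P; rewrite /xc/yc !mxE.
Qed.

End Plane.

Lemma derive0_eq (R : realType) (h : R -> R) (a b : R) : a <= b -> continuous h ->
  (forall t, a < t < b -> is_derive t (1 : R) h 0) -> h a = h b.
Proof.
rewrite le_eqVlt => /predU1P[->//|ab] ch dh.
have H1 x : x \in `]a, b[ -> is_derive x 1 h ((fun=> 0) x).
  by rewrite in_itv /=; exact: dh.
have [c _] := MVT ab H1 (continuous_subspaceT ch).
by rewrite mul0r => /subr0_eq ->.
Qed.

Section Trajectories.
Context {R : realType} {n : nat} (Z : pwl_system R n).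
Implicit Types (g : R -> 'cV[R]_2) (z v : 'cV[R]_2).

(** The bridge from an inclusion valid almost everywhere to increments, by monotonicity of the
    absolutely continuous function [p x + q y - c t]. What is later known about the velocity of a
    given trajectory passes through it. *)
Lemma trajectory_le g (p q c a b : R) : trajectory Z g -> a <= b ->
  (forall t, a <= t <= b -> forall v, filippov Z (g t) v -> c <= p * xc v + q * yc v) ->
  c * (b - a) <= (p * xc (g b) + q * yc (g b)) - (p * xc (g a) + q * yc (g a)).
Proof.
move=> [acg aeg] ab Hc.
pose h t := p * xc (g t) + q * yc (g t) - c * t.
suff : h a <= h b by rewrite /h; lra.
apply: abs_cont_nondecreasing => // [e e0|].
  pose K := `|p| + `|q| + 1; have K0 : 0 < K by rewrite /K ltr_wpDl// addr_ge0.
  have e2K : 0 < e / 2 / K by rewrite !divr_gt0.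
  have c1 : 0 < `|c| + 1 by rewrite ltr_wpDl.
  have [d d0 Hd] := acg a b _ e2K.
  exists (Num.min d (e / 2 / (`|c| + 1))); first by rewrite lt_min d0 !divr_gt0.
  move=> m s t st tr; rewrite lt_min => /andP[sd sc].
  have := Hd m s t st tr sd.
  rewrite ltr_pdivlMr// => sg.
  have {}sc : \sum_(i < m) (t i - s i) * (`|c| + 1) < e / 2.
    by rewrite -mulr_suml -ltr_pdivlMr.
  rewrite (splitr e); apply: le_lt_trans (ltrD sg sc).
  rewrite mulr_suml -big_split /=; apply: ler_sum => i _.
  have [_ [sti _]] := st i.
  have -> : h (t i) - h (s i) = p * xc (g (t i) - g (s i)) + q * yc (g (t i) - g (s i))
     - c * (t i - s i) by rewrite /h xcD ycD xcN ycN; ring.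
  apply: le_trans (ler_normB _ _) _; apply: lerD.
    apply: le_trans (ler_normD _ _) _; rewrite !normrM.
    have := xc_norm (g (t i) - g (s i)); have := yc_norm (g (t i) - g (s i)).
    have := normr_ge0 p; have := normr_ge0 q; rewrite /K.
    have := normr_ge0 (xc (g (t i) - g (s i))); have := normr_ge0 (yc (g (t i) - g (s i))).
    by nra.
  rewrite normrM [X in _ * X <= _]ger0_norm ?subr_ge0// mulrC.
  by rewrite ler_wpM2l ?subr_ge0// lerDl.
case: aeg => N [mN N0 sN]; exists N; split => // t /= nt; apply: sN => /= -[v fv dv].
apply: nt => atb.
exists (p * xc v + q * yc v - c); first by rewrite subr_ge0; apply: (Hc t atb).
have /is_derive_vec2[dx dy] := dv.
have := @is_deriveB _ _ _ _ _ t 1 _ _ (@is_deriveD _ _ _ _ _ t 1 _ _ (@is_deriveZ _ _ _ _ p t 1 _ dx)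
   (@is_deriveZ _ _ _ _ q t 1 _ dy)) (@is_deriveZ _ _ _ _ c t 1 _ (@is_derive_id _ _ t 1)).
by rewrite [_ *: 1]mulr1.
Qed.

Lemma trajectory_continuous g : trajectory Z g -> continuous g.
Proof.
move=> [acg _] t; apply/cvgrPdist_lt => /= e e0.
have [d d0 Hd] := acg (t - 1) (t + 1) e e0.
near=> s.
have st1 : `|t - s| < Num.min 1 d.
  by near: s; apply: (@cvgr_dist_lt _ _ _ _ _ _ t); [exact: cvg_id | rewrite lt_min ltr01].
move: st1; rewrite lt_min => /andP[st1 std].
have [ts|st] := leP t s.
  have := Hd 1%N (fun=> t) (fun=> s); rewrite !big_ord1 distrC; apply.
  - by move=> _; move: st1; rewrite distrC ger0_norm; lra.
  - by move=> i j _ _ _; rewrite !ord1.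
  - by move: std; rewrite distrC ger0_norm//; lra.
have := Hd 1%N (fun=> s) (fun=> t); rewrite !big_ord1; apply.
- by move=> _; move: st1; rewrite ger0_norm; lra.
- by move=> i j _ _ _; rewrite !ord1.
- by move: std; rewrite ger0_norm//; lra.
Unshelve. all: by end_near. Qed.

End Trajectories.

Section Zones.
Context {R : realType} {n : nat} (Z : pwl_system R n).
Context (oX : open (zoneX Z)) (oY : open (zoneY Z)).
Context (dXY : forall z, zoneX Z z -> zoneY Z z -> False).
Implicit Types (g : R -> 'cV[R]_2) (z v : 'cV[R]_2).

Lemma filippov_zoneX z v : zoneX Z z -> filippov Z z v -> v = fieldX Z z.
Proof.
move=> Xz [l [_ _ H ->]]; rewrite H ?scale1r ?subrr ?scale0r ?addr0//.
move=> /(_ _ (open_nbhs_nbhs (conj oX Xz)))[w [Yw Xw]]; exact: dXY Xw Yw.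
Qed.

Lemma filippov_zoneY z v : zoneY Z z -> filippov Z z v -> v = fieldY Z z.
Proof.
move=> Yz [l [_ H _ ->]]; rewrite H ?scale1r ?subr0 ?scale0r ?add0r ?scale1r//.
move=> /(_ _ (open_nbhs_nbhs (conj oY Yz)))[w [Xw Yw]]; exact: dXY Xw Yw.
Qed.

(** Increments that agree with [k t * (s - r)] up to the oscillation of the continuous function [k]
    force differentiability at [t]. In this way almost everywhere information becomes a derivative
    at every point. *)
Lemma is_derive_of_le (h k : R -> R) (a b t : R) : a < t < b ->
  {for t, continuous k} ->
  (forall r s e, a < r -> r <= s -> s < b ->
     (forall u, r <= u <= s -> `|k u - k t| <= e) ->
     `|h s - h r - k t * (s - r)| <= e * (s - r)) ->
  is_derive t (1 : R) h (k t).
Proof.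
move=> /andP[at_ tb] ck Hh.
suff H : (fun u => u^-1 *: (h (u *: (1 : R) + t) - h t)) @ 0^' --> k t.
  by split; [apply: cvgP H | exact: cvg_lim H].
apply/cvgrPdist_le => /= e e0.
move/cvgrPdist_le : ck => /(_ _ e0) /nbhs_ballP[r /= r0 Hr].
rewrite near_withinE; apply/nbhs_ballP.
exists (Num.min r (Num.min (t - a) (b - t))) => /=.
  by rewrite !lt_min r0 !subr_gt0 at_.
move=> u; rewrite /ball/= sub0r normrN !lt_min => /and3P[ur ua ub] u0.
rewrite [_%:A]mulr1 -[_ *: _]/(_ * _).
have K s1 s2 w : s1 <= s2 -> `|s1 - t| <= `|u| -> `|s2 - t| <= `|u| ->
    s1 <= w <= s2 -> `|k w - k t| <= e.
  move=> s12 H1 H2 /andP[w1 w2]; rewrite distrC; apply: Hr; rewrite /ball/= distrC.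
  apply: le_lt_trans ur; rewrite ler_norml; apply/andP; split.
    by move: H1; rewrite ler_norml; lra.
  by move: H2; rewrite ler_norml; lra.
have -> : k t - u^-1 * (h (u + t) - h t) = - (h (u + t) - h t - k t * u) / u by field.
rewrite normrM normfV ler_pdivrMr ?normr_gt0// normrN.
have [u1|u1] := leP 0 u.
  have tu : t <= u + t by lra.
  have -> : k t * u = k t * (u + t - t) by ring.
  rewrite [X in _ <= _ * X](_ : _ = u + t - t); last by rewrite ger0_norm//; ring.
  apply: Hh => //; first by move: ub; rewrite ger0_norm//; lra.
  by move=> w; apply: K => //; rewrite ?subrr ?normr0// addrK.
have tu : u + t <= t by lra.
have -> : h (u + t) - h t - k t * u = - (h t - h (u + t) - k t * (t - (u + t))) by ring.
rewrite normrN [X in _ <= _ * X](_ : _ = t - (u + t)); last by rewrite ltr0_norm//; ring.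
apply: Hh => //; first by move: ua; rewrite ltr0_norm//; lra.
by move=> w; apply: K => //; rewrite ?subrr ?normr0// addrK.
Qed.

(** Where the Filippov set reduces to the value of one continuous field, an absolutely continuous
    solution is a classical one: the inequality for linear functionals is used with both signs of
    each coordinate. *)
Lemma trajectory_derive g (F : 'cV[R]_2 -> 'cV[R]_2) (a b t : R) :
  trajectory Z g -> a < t < b -> continuous F ->
  (forall u, a < u < b -> forall v, filippov Z (g u) v -> v = F (g u)) ->
  is_derive t (1 : R) (xc \o g) (xc (F (g t))) /\
  is_derive t (1 : R) (yc \o g) (yc (F (g t))).
Proof.
move=> tg atb cF HF.
have cg := trajectory_continuous tg.
have H (p q : R) r s e : a < r -> r <= s -> s < b ->
   let k u := p * xc (F (g u)) + q * yc (F (g u)) in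
   (forall u, r <= u <= s -> `|k u - k t| <= e) ->
   `|(p * xc (g s) + q * yc (g s)) - (p * xc (g r) + q * yc (g r)) - k t * (s - r)| <= e * (s - r).
  move=> ar rs sb k Hk; rewrite ler_norml; apply/andP; split.
    suff: (k t - e) * (s - r) <= (p * xc (g s) + q * yc (g s)) - (p * xc (g r) + q * yc (g r)) by lra.
    apply: (trajectory_le tg) => // w rws v fv; rewrite (HF w _ v fv); last by lra.
    by have := Hk w rws; rewrite ler_norml -/(k w); lra.
  suff: (- k t - e) * (s - r) <= ((-p) * xc (g s) + (-q) * yc (g s)) - ((-p) * xc (g r) + (-q) * yc (g r)) by lra.
  apply: (trajectory_le tg) => // w rws v fv; rewrite (HF w _ v fv); last by lra.
  by have := Hk w rws; rewrite ler_norml /k; lra.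
have cFx : continuous (fun u => xc (F (g u))).
  by move=> u; apply: continuous_comp; [apply: continuous_comp; [exact: cg|exact: cF]|exact: xc_continuous].
have cFy : continuous (fun u => yc (F (g u))).
  by move=> u; apply: continuous_comp; [apply: continuous_comp; [exact: cg|exact: cF]|exact: yc_continuous].
split.
  apply: (is_derive_of_le atb (cFx t)) => r s e ar rs sb Hk.
  have := H 1 0 r s e ar rs sb; rewrite /= !mul1r !mul0r !addr0; apply=> u /Hk.
  by rewrite !mul1r !mul0r !addr0.
apply: (is_derive_of_le atb (cFy t)) => r s e ar rs sb Hk.
have := H 0 1 r s e ar rs sb; rewrite /= !mul1r !mul0r !add0r; apply=> u /Hk.
by rewrite !mul1r !mul0r !add0r.
Qed.

End Zones.

(** * The two flows and their crossings with a flat graph *)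

Definition label {R : realType} (z : 'cV[R]_2) : R := xc z ^+ 2 + 2 * yc z.

Section Flows.
Context {R : realType} {n : nat} (Z : pwl_system R n).
Context (oX : open (zoneX Z)) (oY : open (zoneY Z)).
Context (dXY : forall z, zoneX Z z -> zoneY Z z -> False).
Context (mu : R).
Context (HfX : forall z, fieldX Z z = vec2 (-1) (xc z)).
Context (HfY : forall z, fieldY Z z = vec2 (mu * xc z - (yc z + 1)) (xc z + mu * (yc z + 1))).
Implicit Types (g : R -> 'cV[R]_2) (z v : 'cV[R]_2).

Let cfX : continuous (fieldX Z).
Proof.
rewrite (_ : fieldX Z = fun z => vec2 (-1) (xc z)); last exact/funext.
by move=> z; apply: (vec2_continuous (u := fun=> -1) (v := xc)); [exact: cst_continuous | exact: xc_continuous].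
Qed.

Let cfY : continuous (fieldY Z).
Proof.
rewrite (_ : fieldY Z = fun z => vec2 (mu * xc z - (yc z + 1)) (xc z + mu * (yc z + 1))); last exact/funext.
have cx := @xc_continuous R; have cy := @yc_continuous R.
have cy1 z : {for z, continuous (fun z => yc z + 1)} by apply: continuousD; [exact: cy | exact: cst_continuous].
move=> z; apply: (vec2_continuous (u := fun z => mu * xc z - (yc z + 1))
  (v := fun z => xc z + mu * (yc z + 1))).
  apply: continuousB; last exact: cy1.
  by apply: continuousM; [exact: cst_continuous | exact: cx].
apply: continuousD; first exact: cx.
by apply: continuousM; [exact: cst_continuous | exact: cy1].
Qed.

Lemma flowX g a b : trajectory Z g -> a <= b ->
  (forall t, a < t < b -> zoneX Z (g t)) ->
  xc (g b) = xc (g a) - (b - a) /\ label (g b) = label (g a).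
Proof.
move=> tg ab Xg.
have cg := trajectory_continuous tg.
have cx : continuous (xc \o g).
  by move=> u; apply: continuous_comp; [exact: cg|exact: xc_continuous].
have cy : continuous (yc \o g).
  by move=> u; apply: continuous_comp; [exact: cg|exact: yc_continuous].
have D t : a < t < b -> is_derive t (1 : R) (xc \o g) (-1) /\
    is_derive t (1 : R) (yc \o g) (xc (g t)).
  move=> atb; have := trajectory_derive tg atb cfX.
  rewrite HfX xc_vec2 yc_vec2; apply=> u /Xg Xu v; exact: (filippov_zoneX oX dXY).
split.
  have : (xc \o g + id) a = (xc \o g + id) b.
    apply: (derive0_eq ab).
      by move=> u; apply: continuousD; [exact: cx | exact: cvg_id].
    move=> t /D[Dx _]; have := @is_deriveD _ _ _ _ _ t 1 _ _ Dx (@is_derive_id _ _ t 1).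
    by rewrite addNr.
  by rewrite /=  => H; have : xc (g a) + a = xc (g b) + b by []; lra.
have : ((xc \o g) * (xc \o g) + 2 \*: (yc \o g)) a = ((xc \o g) * (xc \o g) + 2 \*: (yc \o g)) b.
  apply: (derive0_eq ab).
    move=> u; apply: continuousD; first by apply: continuousM; exact: cx.
    by apply: continuousZl_tmp; exact: cy.
  move=> t /D[Dx Dy].
  have := @is_deriveD _ _ _ _ _ t 1 _ _ (@is_deriveM _ _ _ _ t 1 _ _ Dx Dx) (@is_deriveZ _ _ _ _ 2 t 1 _ Dy).
  move/is_derive_eq; apply; rewrite /GRing.scale/=; ring.
move=> H; rewrite /label !expr2.
have : xc (g a) * xc (g a) + 2 * yc (g a) = xc (g b) * xc (g b) + 2 * yc (g b) by exact: H.
by move=> ->.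
Qed.

(** The position relative to the focus, turned back by the elapsed angle and rescaled by
    [exp (- mu (t - a))], has zero derivative. Its two constant coordinates are [h1] and [h2]; they
    are then solved for the endpoint. *)
Lemma flowY g a b : trajectory Z g -> a <= b ->
  (forall t, a < t < b -> zoneY Z (g t)) ->
  xc (g b) = expR (mu * (b - a)) * (cos (b - a) * xc (g a) - sin (b - a) * (yc (g a) + 1)) /\
  yc (g b) + 1 = expR (mu * (b - a)) * (sin (b - a) * xc (g a) + cos (b - a) * (yc (g a) + 1)).
Proof.
move=> tg ab Yg.
have cg := trajectory_continuous tg.
have cx : continuous (xc \o g).
  by move=> u; apply: continuous_comp; [exact: cg|exact: xc_continuous].
have cy : continuous (yc \o g).
  by move=> u; apply: continuous_comp; [exact: cg|exact: yc_continuous].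
have D t : a < t < b -> is_derive t (1 : R) (xc \o g) (mu * xc (g t) - (yc (g t) + 1)) /\
    is_derive t (1 : R) (yc \o g) (xc (g t) + mu * (yc (g t) + 1)).
  move=> atb; have := trajectory_derive tg atb cfY.
  rewrite HfY xc_vec2 yc_vec2; apply=> u /Yg Yu v; exact: (filippov_zoneY oY dXY).
pose tau := (id - cst a : R -> R).
have Dtau t : is_derive t (1 : R) tau 1.
  by have := @is_deriveB _ _ _ _ _ t 1 _ _ (@is_derive_id _ _ t 1) (is_derive_cst a t 1); rewrite subr0.
pose E := expR \o ((- mu) \*: tau).
have DE t : is_derive t (1 : R) E (- mu * E t).
  have := @is_derive1_comp _ _ _ t _ _ (is_derive_expR ((- mu) * tau t)) (@is_deriveZ _ _ _ _ (- mu) t 1 _ (Dtau t)).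
  move/is_derive_eq; apply; rewrite /E /GRing.scale /=; ring.
have DC t : is_derive t (1 : R) (cos \o tau) (- sin (tau t)).
  have := @is_derive1_comp _ _ _ t _ _ (is_derive_cos (tau t)) (Dtau t).
  by rewrite mulr1.
have DS t : is_derive t (1 : R) (sin \o tau) (cos (tau t)).
  have := @is_derive1_comp _ _ _ t _ _ (is_derive_sin (tau t)) (Dtau t).
  by rewrite mulr1.
have ct t : is_derive t (1 : R) tau 1 -> {for t, continuous tau}.
  by move=> [d _]; apply/differentiable_continuous/derivable1_diffP.
have cE : continuous E.
  by move=> t; have [d _] := DE t; apply/differentiable_continuous/derivable1_diffP.
have cC : continuous (cos \o tau).
  by move=> t; have [d _] := DC t; apply/differentiable_continuous/derivable1_diffP.
have cS : continuous (sin \o tau).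
  by move=> t; have [d _] := DS t; apply/differentiable_continuous/derivable1_diffP.
pose y1 := yc \o g + cst 1.
have cy1 : continuous y1 by move=> t; apply: continuousD; [exact: cy | exact: cst_continuous].
pose h1 : R -> R := E * ((cos \o tau) * (xc \o g) + (sin \o tau) * y1).
have H1 : h1 a = h1 b.
  apply: (derive0_eq ab).
    move=> t; apply: continuousM; first exact: cE.
    by apply: continuousD; apply: continuousM; [exact: cC | exact: cx | exact: cS | exact: cy1].
  move=> t /D[Dx Dy].
  have Dy1 := @is_deriveD _ _ _ _ _ t 1 _ _ Dy (is_derive_cst (1 : R) t 1).
  have := @is_deriveM _ _ _ _ t 1 _ _ (DE t) (@is_deriveD _ _ _ _ _ t 1 _ _
     (@is_deriveM _ _ _ _ t 1 _ _ (DC t) Dx) (@is_deriveM _ _ _ _ t 1 _ _ (DS t) Dy1)).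
  move/is_derive_eq; apply; rewrite /GRing.scale /= /y1 !fctE /=; ring.
pose h2 : R -> R := E * ((cos \o tau) * y1 - (sin \o tau) * (xc \o g)).
have H2 : h2 a = h2 b.
  apply: (derive0_eq ab).
    move=> t; apply: continuousM; first exact: cE.
    by apply: continuousB; apply: continuousM; [exact: cC | exact: cy1 | exact: cS | exact: cx].
  move=> t /D[Dx Dy].
  have Dy1 := @is_deriveD _ _ _ _ _ t 1 _ _ Dy (is_derive_cst (1 : R) t 1).
  have := @is_deriveM _ _ _ _ t 1 _ _ (DE t) (@is_deriveB _ _ _ _ _ t 1 _ _
     (@is_deriveM _ _ _ _ t 1 _ _ (DC t) Dy1) (@is_deriveM _ _ _ _ t 1 _ _ (DS t) Dx)).
  move/is_derive_eq; apply; rewrite /GRing.scale /= /y1 !fctE /=; ring.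
move: H1 H2; rewrite /h1 /h2 /E /y1 !fctE /= /tau !fctE /= subrr -![_ *: _]/(_ * _) mulr0 expR0 cos0 sin0.
rewrite !mul1r !mul0r addr0 subr0.
set s := b - a; set xa := xc (g a); set xb := xc (g b); set ya := yc (g a); set yb := yc (g b).
move=> -> ->.
have EE : expR (mu * s) * expR (- mu * s) = 1.
  by rewrite -expRD mulNr subrr expR0.
have CS := cos2Dsin2 s.
split.
  transitivity ((expR (mu * s) * expR (- mu * s)) * (cos s ^+ 2 + sin s ^+ 2) * xb); last by ring.
  by rewrite EE CS !mul1r.
transitivity ((expR (mu * s) * expR (- mu * s)) * (cos s ^+ 2 + sin s ^+ 2) * (yb + 1)); last by ring.
by rewrite EE CS !mul1r.
Qed.
End Flows.

(* [M] is the size of the box in which the branch is the graph of [f]; the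
   fields are tangent to it near [x = 0], so crossings are only controlled for
   [c < `|x|]. *)
Record graph_system (R : realType) (n : nat) (Z : pwl_system R n)
    (f : R -> R) (mu c M eps : R) : Prop := GraphSystem {
  gs_oX : open (zoneX Z) ;
  gs_oY : open (zoneY Z) ;
  gs_dXY : forall z, zoneX Z z -> zoneY Z z -> False ;
  gs_fX : forall z, fieldX Z z = vec2 (-1) (xc z) ;
  gs_fY : forall z, fieldY Z z = vec2 (mu * xc z - (yc z + 1)) (xc z + mu * (yc z + 1)) ;
  gs_X : forall z, `|xc z| < M -> `|yc z| < M -> (zoneX Z z <-> f (xc z) < yc z) ;
  gs_Y : forall z, `|xc z| < M -> `|yc z| < M -> (zoneY Z z <-> yc z < f (xc z)) ;
  gs_lip : forall x x', `|x| < M -> `|x'| < M -> `|f x - f x'| <= eps * `|x - x'| ;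
  gs_le : forall x, `|x| < M -> `|f x| <= eps ;
  gs_M : 4 <= M ;
  gs_c : 0 < c ;
  gs_c1 : c <= 1 ;
  gs_eps0 : 0 <= eps ;
  gs_eps : 32 * eps <= c ;
  gs_mu0 : 0 < mu ;
  gs_mu : 4 * mu <= c ;
  gs_muM : mu * M <= 1
}.

Section Crossings.
Context {R : realType} {n : nat} {Z : pwl_system R n} {f : R -> R} {mu c M eps : R}.
Context (GS : graph_system Z f mu c M eps).
Implicit Types (g : R -> 'cV[R]_2) (z v : 'cV[R]_2).

(** Every Filippov velocity near such a point, including the convex combinations on the branch,
    increases both [sg * y + eps * x] and [sg * y - eps * x]. As the graph is [eps]-Lipschitz, the
    trajectory leaves it at once, upwards on the right and downwards on the left; sliding along the
    branch is thereby excluded. *)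
Lemma crossing g t0 (sg : R) : trajectory Z g -> sg = 1 \/ sg = -1 ->
  `|xc (g t0)| < M -> yc (g t0) = f (xc (g t0)) -> c < sg * xc (g t0) ->
  exists2 r, 0 < r & forall t, `|t - t0| < r ->
    (0 < sg * (t - t0) -> zoneX Z (g t)) /\ (sg * (t - t0) < 0 -> zoneY Z (g t)).
Proof.
case: GS => oX oY dXY HfX HfY HX HY flip fle M4 c0 c1 e0 ec mu0 muc muM.
move=> tg sgE xM yf cx.
have cg := trajectory_continuous tg.
have cxg : continuous (xc \o g).
  by move=> u; apply: continuous_comp; [exact: cg|exact: xc_continuous].
have cyg : continuous (yc \o g).
  by move=> u; apply: continuous_comp; [exact: cg|exact: yc_continuous].
have y1 : `|yc (g t0)| < 1 by rewrite yf; apply: le_lt_trans (fle _ xM) _; lra.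
have : \forall t \near t0, [/\ `|xc (g t)| < M, `|yc (g t)| < 1 & c < sg * xc (g t)].
  near=> t; split.
  - near: t; have : {for t0, continuous (fun t => `|xc (g t)|)}.
      by apply: continuous_comp; [exact: cxg | exact: norm_continuous].
    by move=> /cvgr_lt; apply.
  - near: t; have : {for t0, continuous (fun t => `|yc (g t)|)}.
      by apply: continuous_comp; [exact: cyg | exact: norm_continuous].
    by move=> /cvgr_lt; apply.
  - near: t; have : {for t0, continuous (fun t => sg * xc (g t))}.
      by apply: continuousM; [exact: cst_continuous | exact: cxg].
    by move=> /cvgr_gt; apply.
move=> /nbhs_ballP[r /= r0 Hr]; exists r => // t tr.
have {}Hr w : `|w - t0| <= `|t - t0| -> [/\ `|xc (g w)| < M, `|yc (g w)| < 1 & c < sg * xc (g w)].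
  by move=> wt; apply: Hr; rewrite /ball/= distrC; apply: le_lt_trans tr.
(* The vertical speed times [sg] is [sg * x > c] up to the term in [mu], which costs at most
   [c / 2]; the tilt by [eps] costs at most [4 * eps <= c / 8]. *)
have vel w v (th : R) : th = 1 \/ th = -1 -> `|w - t0| <= `|t - t0| -> filippov Z (g w) v ->
    c / 8 <= th * eps * xc v + sg * yc v.
  move=> thE /Hr[xw yw cw] [l [/andP[l0 l1] _ _ ->]].
  rewrite xcD ycD !xcZ !ycZ HfX HfY !xc_vec2 !yc_vec2.
  move: xw yw cw; rewrite !ltr_norml.
  set x := xc (g w); set y := yc (g w) => /andP[x1 x2] /andP[yy1 yy2] cw.
  have A1 : - 1 <= mu * x by nra.
  have A2 : mu * x <= 1 by nra.
  have A3 : 0 <= (1 - l) * (mu * (y + 1)) <= c / 2.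
    have : 0 <= mu * (y + 1) <= c / 2 by nra.
    by nra.
  have A4 : - 4 <= l * -1 + (1 - l) * (mu * x - (y + 1)) <= 4 by nra.
  have A5 : - (4 * eps) <= th * eps * (l * -1 + (1 - l) * (mu * x - (y + 1))).
    by case: thE => ->; nra.
  have -> : l * x + (1 - l) * (x + mu * (y + 1)) = x + (1 - l) * (mu * (y + 1)) by ring.
  by case: sgE cw => ->; lra.
have [xt yt ct] := Hr t (lexx _).
(* The two tilts [th = 1] and [th = -1] together produce the absolute value of the horizontal
   displacement, ready for comparison with the Lipschitz bound of the graph. *)
have K : 0 < `|t - t0| -> c / 8 * `|t - t0| <=
    sg * Num.sg (t - t0) * (yc (g t) - yc (g t0)) - eps * `|xc (g t) - xc (g t0)|.
  move=> tt.
  have Kth (th : R) : th = 1 \/ th = -1 -> c / 8 * `|t - t0| <=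
    Num.sg (t - t0) * (th * eps * (xc (g t) - xc (g t0)) + sg * (yc (g t) - yc (g t0))).
    move=> thE; case: (ltgtP t t0) => [tt0|tt0|->]; last by rewrite subrr normr0 sgr0 mulr0 mul0r.
      rewrite ltr0_sg ?subr_lt0// ltr0_norm ?subr_lt0//.
      have Hv w : t <= w <= t0 -> forall v, filippov Z (g w) v -> c / 8 <= th * eps * xc v + sg * yc v.
        move=> wtt v; apply: vel => //; rewrite (ltr0_norm (_ : t - t0 < 0)) ?ler0_norm; lra.
      by have := trajectory_le tg (ltW tt0) Hv; lra.
    rewrite gtr0_sg ?subr_gt0// gtr0_norm ?subr_gt0//.
    have Hv w : t0 <= w <= t -> forall v, filippov Z (g w) v -> c / 8 <= th * eps * xc v + sg * yc v.
      move=> wtt v; apply: vel => //; rewrite (gtr0_norm (_ : 0 < t - t0)) ?ger0_norm; lra.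
    by have := trajectory_le tg (ltW tt0) Hv; lra.
  move: (Kth 1 (or_introl erefl)) (Kth (-1) (or_intror erefl)).
  case: (ltgtP t t0) tt => [tt0|tt0|->] tt; last by rewrite subrr normr0 ltxx in tt.
    by rewrite ltr0_sg ?subr_lt0//; have [_|_] := ger0P (xc (g t) - xc (g t0)); lra.
  by rewrite gtr0_sg ?subr_gt0//; have [_|_] := ger0P (xc (g t) - xc (g t0)); lra.
have := flip _ _ xt xM; rewrite -yf.
set df := `|_ - yc (g t0)| => Hdf.
have df1 : - df <= f (xc (g t)) - yc (g t0) <= df by rewrite -ler_norml.
have M1 : `|yc (g t)| < M by apply: lt_trans yt _; lra.
split=> H.
  have t0' : 0 < `|t - t0|.
    by rewrite normr_gt0; apply: contraTneq H => ->; rewrite mulr0 ltxx.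
  apply/(HX _ xt M1).
  have : 0 < c / 8 * `|t - t0| by rewrite mulr_gt0// divr_gt0.
  have := K t0'; suff -> : sg * Num.sg (t - t0) = 1 by lra.
  by case: sgE H => ->; rewrite ?mul1r ?mulN1r ?oppr_gt0 => H; rewrite ?(gtr0_sg H) ?(ltr0_sg H) ?opprK.
have t0' : 0 < `|t - t0|.
  by rewrite normr_gt0; apply: contraTneq H => ->; rewrite mulr0 ltxx.
apply/(HY _ xt M1).
have : 0 < c / 8 * `|t - t0| by rewrite mulr_gt0// divr_gt0.
have := K t0'; suff -> : sg * Num.sg (t - t0) = -1 by lra.
by case: sgE H => ->; rewrite ?mul1r ?mulN1r ?oppr_lt0 => H; rewrite ?(gtr0_sg H) ?(ltr0_sg H) ?opprK.
Unshelve. all: by end_near. Qed.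

End Crossings.

(** * Successive returns of a trajectory to the graph *)

Lemma exit_time (R : realType) (T : topologicalType) (g : R -> T) (A : set T) (t0 : R) :
  continuous g -> open A ->
  (exists2 r, 0 < r & forall t, t0 < t -> t < t0 + r -> A (g t)) ->
  (exists2 t, t0 < t & ~ A (g t)) ->
  exists t1, [/\ t0 < t1, forall t, t0 < t -> t < t1 -> A (g t) & ~ A (g t1)].
Proof.
move=> cg oA [r r0 Hr] [te te0 nA].
pose S := [set t | t0 < t /\ ~ A (g t)].
have Ste : S te by [].
have hS : has_inf S by split; [exists te | exists t0 => t -[/ltW]].
have rS : t0 + r <= inf S.
  apply: lb_le_inf; first by exists te.
  by move=> t [tt0 nAt]; rewrite leNgt; apply/negP => tr; apply: nAt; exact: Hr.
have t01 : t0 < inf S by lra.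
exists (inf S); split => //.
  move=> t tt0 tS; apply: contrapT => nAt.
  have : inf S <= t by apply: ge_inf; [case: hS | split].
  by rewrite leNgt tS.
move=> AS.
have /nbhs_ballP[d /= d0 Hd] : nbhs (inf S) (g @^-1` A).
  by apply: cg; apply: open_nbhs_nbhs.
have [t [tt0 nAt] tS] := inf_adherent d0 hS.
apply: (nAt); apply: Hd; rewrite /ball/= ltr0_norm; last first.
  rewrite subr_lt0 lt_neqAle; apply/andP; split.
    by apply/eqP => E; apply: nAt; rewrite -E.
  by apply: ge_inf; [case: hS | split].
by lra.
Qed.

(** Squared distance to the focus [(0, -1)] of the lower field. *)
Definition rho2 {R : realType} (z : 'cV[R]_2) : R := xc z ^+ 2 + (yc z + 1) ^+ 2.

Section Hitting.
Context {R : realType} {n : nat} {Z : pwl_system R n} {f : R -> R} {mu c M eps : R}.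
Context (GS : graph_system Z f mu c M eps) (la lb : R).
Implicit Types (g : R -> 'cV[R]_2) (z v : 'cV[R]_2).

(** The strip [|y| <= eps] contains the graph over the box; removing its points with label outside
    the window leaves only branch points whose label lies between [la] and [lb], away from the
    tangency at [x = 0]. *)
Definition work_region z := [/\ `|xc z| < M, `|yc z| < M &
  ~ (`|yc z| <= eps /\ (label z <= la \/ lb <= label z))].

Definition right_pt z := yc z = f (xc z) /\ c < xc z.
Definition left_pt z := yc z = f (xc z) /\ xc z < - c.

Context (Hla : c ^+ 2 <= la - 2 * eps).

Lemma branch_label z : work_region z -> yc z = f (xc z) -> la < label z < lb.
Proof.
move=> [xM yM nz] yf.
have fe := gs_le GS xM; rewrite -yf in fe.
by apply/andP; split; rewrite ltNge; apply/negP => H; apply: nz; split => //; [left|right].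
Qed.

(** On the graph [x^2] is the label minus [2 y], hence exceeds [la - 2 * eps >= c ^+ 2]: inside the
    region the branch is met only where crossings are controlled. *)
Lemma branch_side z : work_region z -> yc z = f (xc z) -> right_pt z \/ left_pt z.
Proof.
move=> Wz yf; have /andP[l1 l2] := branch_label Wz yf.
case: Wz => xM yM _; have := gs_le GS xM; rewrite -yf ler_norml => /andP[y1 y2].
have c0 := gs_c GS.
have : c ^+ 2 < xc z ^+ 2 by move: l1 Hla; rewrite /label => l1 Hla1; lra.
move=> H; have [xp|xn] := leP 0 (xc z); [left|right]; split => //.
  by rewrite ltNge; apply/negP => H'; nra.
by rewrite ltNge; apply/negP => H'; nra.
Qed.

(** The exit point is not in the zone being left. Nor is it in the other one, which is open and
    would contain earlier points, against disjointness. *)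
Lemma graph_of_border g t0 t1 : continuous g -> t0 < t1 -> work_region (g t1) ->
  ((forall t, t0 < t -> t < t1 -> zoneX Z (g t)) /\ ~ zoneX Z (g t1)) \/
  ((forall t, t0 < t -> t < t1 -> zoneY Z (g t)) /\ ~ zoneY Z (g t1)) ->
  yc (g t1) = f (xc (g t1)).
Proof.
move=> cg t01 [xM yM _] H.
have near_left (A : set _) : open A -> A (g t1) -> exists2 t, t0 < t < t1 & A (g t).
  move=> oA At1; have /nbhs_ballP[d /= d0 Hd] : nbhs t1 (g @^-1` A).
    by apply: cg; apply: open_nbhs_nbhs.
  exists (Num.max (t1 - d / 2) ((t0 + t1) / 2)).
    by rewrite lt_max gt_max; apply/andP; split; [apply/orP; right|apply/andP; split]; lra.
  apply: Hd; rewrite /ball/= gtr0_norm ?subr_gt0 ?gt_max; last by apply/andP; split; lra.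
  by rewrite ltrBlDl -ltrBlDr lt_max; apply/orP; left; lra.
case: H => -[H nA].
  have /negP := fun h => nA ((gs_X GS xM yM).2 h); rewrite -leNgt le_eqVlt => /predU1P[//|].
  move/(gs_Y GS xM yM)/(near_left _ (gs_oY GS)) => [t /andP[tt0 tt1] Yt].
  by case: (gs_dXY GS (H t tt0 tt1) Yt).
have /negP := fun h => nA ((gs_Y GS xM yM).2 h); rewrite -leNgt le_eqVlt => /predU1P[//|].
move/(gs_X GS xM yM)/(near_left _ (gs_oX GS)) => [t /andP[tt0 tt1] Yt].
by case: (gs_dXY GS Yt (H t tt0 tt1)).
Qed.

(** Under the upper field [x] decreases at unit speed, so remaining in the zone for a time [2 M + 1]
    would mean leaving the box. The exit cannot be on the right, where trajectories arrive from the
    lower zone. *)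
Lemma hit_left g t0 : trajectory Z g -> (forall t, work_region (g t)) ->
  (exists2 r, 0 < r & forall t, t0 < t -> t < t0 + r -> zoneX Z (g t)) ->
  exists t1, [/\ t0 < t1, forall t, t0 < t -> t < t1 -> zoneX Z (g t) & left_pt (g t1)].
Proof.
move=> tg Wg Hr; have cg := trajectory_continuous tg.
have M4 := gs_M GS; have c0 := gs_c GS.
have [|t1 [t01 H1 nX]] := exit_time cg (gs_oX GS) Hr.
  have t0M : t0 < t0 + 2 * M + 1 by lra.
  apply: contrapT => nex.
  have HX t : t0 < t < t0 + 2 * M + 1 -> zoneX Z (g t).
    by move=> /andP[tt0 _]; apply: contrapT => nX; apply: nex; exists t.
  have [Hx _] := flowX (gs_oX GS) (gs_dXY GS) (gs_fX GS) tg (ltW t0M) HX.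
  have [+ _ _] := Wg t0; have [+ _ _] := Wg (t0 + 2 * M + 1).
  by rewrite Hx !ltr_norml; lra.
exists t1; split => //.
have gr := graph_of_border cg t01 (Wg t1) (or_introl (conj H1 nX)).
have [[_ cx]|//] := branch_side (Wg t1) gr.
have [xM _ _] := Wg t1.
have [|r r0 Hc] := crossing GS tg (or_introl erefl) xM gr; first by rewrite mul1r.
pose t := Num.max (t1 - r / 2) ((t0 + t1) / 2).
have [tt0 tt1 tr] : [/\ t0 < t, t < t1 & t1 - r < t].
  by rewrite /t !lt_max !gt_max; split; [apply/orP; right|apply/andP; split|apply/orP; left]; lra.
case: (gs_dXY GS (H1 t tt0 tt1)); apply: (Hc t _).2; last by rewrite mul1r; lra.
by rewrite ltr0_norm; lra.
Qed.

Lemma rho2_flowY g a b : trajectory Z g -> a <= b ->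
  (forall t, a < t < b -> zoneY Z (g t)) ->
  rho2 (g b) = expR (2 * (mu * (b - a))) * rho2 (g a).
Proof.
move=> tg ab H.
have [Hx Hy] := flowY (gs_oY GS) (gs_dXY GS) (gs_fY GS) tg ab H.
rewrite /rho2 Hx Hy mulr2n mulrDl !mul1r expRD.
have CS := cos2Dsin2 (b - a).
transitivity (expR (mu * (b - a)) * expR (mu * (b - a)) * ((cos (b - a) ^+ 2 + sin (b - a) ^+ 2) *
  (xc (g a) ^+ 2 + (yc (g a) + 1) ^+ 2))); first by ring.
by rewrite CS mul1r.
Qed.

(** The distance to the focus grows exponentially, so a trajectory off the focus cannot stay below
    forever inside the box. The exit is on the right because at left points trajectories arrive from
    the upper zone. *)
Lemma hit_right g t0 : trajectory Z g -> (forall t, work_region (g t)) ->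
  0 < rho2 (g t0) ->
  (exists2 r, 0 < r & forall t, t0 < t -> t < t0 + r -> zoneY Z (g t)) ->
  exists t1, [/\ t0 < t1, forall t, t0 < t -> t < t1 -> zoneY Z (g t) & right_pt (g t1)].
Proof.
move=> tg Wg rho0 Hr; have cg := trajectory_continuous tg.
have M4 := gs_M GS; have c0 := gs_c GS; have mu0 := gs_mu0 GS.
have [|t1 [t01 H1 nY]] := exit_time cg (gs_oY GS) Hr.
  (* After this time [(1 + 2 * mu * s)] times the initial squared distance exceeds [6 * M ^+ 2],
     which bounds [M^2 + (M + 1)^2] for [M >= 4]. *)
  pose s := 6 * M ^+ 2 / (2 * mu * rho2 (g t0)).
  have s0 : 0 < s by rewrite divr_gt0 ?mulr_gt0 ?exprn_gt0//; lra.
  have t0s : t0 < t0 + s by lra.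
  apply: contrapT => nex.
  have HY t : t0 < t < t0 + s -> zoneY Z (g t).
    by move=> /andP[tt0 _]; apply: contrapT => nY; apply: nex; exists t.
  have := rho2_flowY tg (ltW t0s) HY.
  have -> : t0 + s - t0 = s by ring.
  have [+ + _] := Wg (t0 + s); rewrite !ltr_norml => /andP[x1 x2] /andP[y1 y2] E.
  have B : rho2 (g (t0 + s)) <= 6 * M ^+ 2 by rewrite /rho2; nra.
  have := expR_ge1Dx (2 * (mu * s)) => /(ler_wpM2r (ltW rho0)); rewrite -E => H.
  have : 2 * (mu * s) * rho2 (g t0) = 6 * M ^+ 2.
    by rewrite /s; field; rewrite !gt_eqF.
  by lra.
exists t1; split => //.
have gr := graph_of_border cg t01 (Wg t1) (or_intror (conj H1 nY)).
have [//|[_ cx]] := branch_side (Wg t1) gr.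
have [xM _ _] := Wg t1.
have [|r r0 Hc] := crossing GS tg (or_intror erefl) xM gr; first by rewrite mulN1r; lra.
pose t := Num.max (t1 - r / 2) ((t0 + t1) / 2).
have [tt0 tt1 tr] : [/\ t0 < t, t < t1 & t1 - r < t].
  by rewrite /t !lt_max !gt_max; split; [apply/orP; right|apply/andP; split|apply/orP; left]; lra.
case: (gs_dXY GS _ (H1 t tt0 tt1)); apply: (Hc t _).1; last by rewrite mulN1r; lra.
by rewrite ltr0_norm; lra.
Qed.

Lemma leave_right g t0 : trajectory Z g -> work_region (g t0) -> right_pt (g t0) ->
  exists2 r, 0 < r & forall t, t0 < t -> t < t0 + r -> zoneX Z (g t).
Proof.
move=> tg [xM _ _] [gr cx].
have [|r r0 Hc] := crossing GS tg (or_introl erefl) xM gr; first by rewrite mul1r.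
exists r => // t tt0 tr; apply: (Hc t _).1; last by rewrite mul1r; lra.
by rewrite gtr0_norm; lra.
Qed.

Lemma leave_left g t0 : trajectory Z g -> work_region (g t0) -> left_pt (g t0) ->
  exists2 r, 0 < r & forall t, t0 < t -> t < t0 + r -> zoneY Z (g t).
Proof.
move=> tg [xM _ _] [gr cx].
have [|r r0 Hc] := crossing GS tg (or_intror erefl) xM gr; first by rewrite mulN1r; lra.
exists r => // t tt0 tr; apply: (Hc t _).2; last by rewrite mulN1r; lra.
by rewrite gtr0_norm; lra.
Qed.

End Hitting.

(** * Flat graphs and their intersections with parabolas *)

(** The hypotheses on the graph alone, free of [mu] and of the system: the level function has to be
    studied before [mu] is chosen. *)
Record flat_graph (R : realType) (f : R -> R) (c M eps la lb : R) : Prop := FlatGraph {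
  fg_lip : forall x x', `|x| < M -> `|x'| < M -> `|f x - f x'| <= eps * `|x - x'| ;
  fg_le : forall x, `|x| < M -> `|f x| <= eps ;
  fg_M : 4 <= M ;
  fg_c : 0 < c ;
  fg_c1 : c <= 1 ;
  fg_eps0 : 0 <= eps ;
  fg_eps : 32 * eps <= c ;
  fg_la : c ^+ 2 <= la - 2 * eps ;
  fg_lb : la <= lb ;
  fg_lbM : lb + 4 <= M
}.

Lemma lip_within_continuous (R : realType) (h : R -> R) (K a b : R) :
  (forall x y, a <= x <= b -> a <= y <= b -> `|h x - h y| <= K * `|x - y|) ->
  {within `[a, b], continuous h}.
Proof.
move=> Hh; apply/subspace_continuousP => x /=; rewrite in_itv/= => xab.
apply/cvgrPdist_lt => e e0.
have K1 : 0 < `|K| + 1 by rewrite ltr_wpDl.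
have eK : 0 < e / (`|K| + 1) by rewrite divr_gt0.
rewrite near_withinE; near=> y => /=; rewrite in_itv/= => yab.
apply: le_lt_trans (Hh _ _ xab yab) _.
have xy : `|x - y| < e / (`|K| + 1).
  by near: y; apply: (@cvgr_dist_lt _ _ _ _ _ _ x); [exact: cvg_id | ].
apply: le_lt_trans (_ : _ <= (`|K| + 1) * `|x - y|) _; last first.
  by rewrite mulrC -ltr_pdivlMr.
by rewrite ler_wpM2r//; have := ler_norm K; lra.
Unshelve. all: by end_near. Qed.

Lemma sqrt_lip (R : realType) (c a b : R) : 0 < c -> c ^+ 2 <= a -> c ^+ 2 <= b ->
  `|Num.sqrt a - Num.sqrt b| <= `|a - b| / (2 * c).
Proof.
move=> c0 ca cb.
have a0 : 0 <= a by apply: le_trans ca; rewrite exprn_ge0// ltW.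
have b0 : 0 <= b by apply: le_trans cb; rewrite exprn_ge0// ltW.
have sa : c <= Num.sqrt a by rewrite -(ger0_norm (ltW c0)) -sqrtr_sqr ler_wsqrtr.
have sb : c <= Num.sqrt b by rewrite -(ger0_norm (ltW c0)) -sqrtr_sqr ler_wsqrtr.
rewrite ler_pdivlMr; last by lra.
rewrite -{2}(sqr_sqrtr a0) -{2}(sqr_sqrtr b0) subr_sqr normrM ler_wpM2l//.
by rewrite ger0_norm; lra.
Qed.

Lemma norm_sign (R : realType) (s : R) : s = 1 \/ s = -1 -> `|s| = 1.
Proof. by case=> ->; rewrite ?normrN normr1. Qed.

Section LevelCoordinates.
Context {R : realType} {f : R -> R} {c M eps la lb : R}.
Context (FG : flat_graph f c M eps la lb).

(** The abscissa on the parabola of label [l] is [s * sqrt (l - 2 y)], so meeting the graph on the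
    side [s] is a fixed-point equation for the height. *)
Definition height_at (s l y : R) := `|y| <= eps /\ y = f (s * Num.sqrt (l - 2 * y)).

Lemma label_sub_ge l y : la <= l -> `|y| <= eps -> c ^+ 2 <= l - 2 * y.
Proof.
move=> lal; rewrite ler_norml => /andP[_ y2]; apply: le_trans (fg_la FG) _; lra.
Qed.

Lemma sqrt_label_lt l y : l <= lb -> `|y| <= eps -> Num.sqrt (l - 2 * y) < M.
Proof.
move=> llb; rewrite ler_norml => /andP[y1 y2].
have := fg_M FG; have := fg_eps FG; have := fg_c1 FG; have := fg_lbM FG => H1 H2 H3 H4.
rewrite -(ger0_norm (_ : 0 <= M)); last by lra.
rewrite -sqrtr_sqr ltr_sqrt; last by apply: exprn_gt0; lra.
nra.
Qed.

(** Beyond [c ^+ 2] the square root is Lipschitz with constant [1 / (2 c)], and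
    [eps / (2 c) <= 1 / 64]. Thus the map of [height_at] is a contraction in [y] with factor
    [1 / 32]; existence, uniqueness and regularity of heights rest on this. *)
Lemma height_lip s l l' y y' : s = 1 \/ s = -1 -> la <= l <= lb -> la <= l' <= lb ->
  `|y| <= eps -> `|y'| <= eps ->
  `|f (s * Num.sqrt (l - 2 * y)) - f (s * Num.sqrt (l' - 2 * y'))| <=
    (`|l - l'| + 2 * `|y - y'|) / 64.
Proof.
move=> sE /andP[l1 l2] /andP[l1' l2'] ye ye'.
have c0 := fg_c FG.
have N1 := norm_sign sE.
have B a : `|s * Num.sqrt a| = Num.sqrt a by rewrite normrM N1 mul1r ger0_norm// sqrtr_ge0.
apply: le_trans (fg_lip FG _ _) _; rewrite ?B ?sqrt_label_lt//.
rewrite -mulrBr normrM N1 mul1r.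
have := sqrt_lip c0 (label_sub_ge l1 ye) (label_sub_ge l1' ye') => H.
have e0 := fg_eps0 FG; have ec := fg_eps FG.
apply: le_trans (ler_wpM2l e0 H) _.
have -> : l - 2 * y - (l' - 2 * y') = (l - l') - 2 * (y - y') by ring.
have T : `|(l - l') - 2 * (y - y')| <= `|l - l'| + 2 * `|y - y'|.
  apply: le_trans (ler_normB _ _) _; rewrite normrM (ger0_norm (_ : 0 <= 2 :> R))//.
rewrite mulrCA -[leRHS]mulrC [leRHS]mulrC; apply: ler_pM => //.
  by apply: mulr_ge0 => //; rewrite invr_ge0; lra.
rewrite ler_pdivrMr; last by lra.
lra.
Qed.

Lemma height_uniq_lip s l l' y y' : s = 1 \/ s = -1 -> la <= l <= lb -> la <= l' <= lb ->
  height_at s l y -> height_at s l' y' -> `|y - y'| <= `|l - l'| / 32.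
Proof.
move=> sE hl hl' [ye yf] [ye' yf'].
have := height_lip sE hl hl' ye ye'; rewrite -yf -yf'.
have := normr_ge0 (l - l'); lra.
Qed.

Lemma height_ex s l : s = 1 \/ s = -1 -> la <= l <= lb -> exists y, height_at s l y.
Proof.
move=> sE hl; have e0 := fg_eps0 FG.
pose k y := y - f (s * Num.sqrt (l - 2 * y)).
have ek y : - eps <= y <= eps -> `|y| <= eps by rewrite ler_norml.
have kc : {within `[- eps, eps], continuous k}.
  apply: (@lip_within_continuous _ _ 2) => x y /ek hx /ek hy.
  have := height_lip sE hl hl hx hy; rewrite subrr normr0 add0r /k => H.
  have -> : x - f (s * Num.sqrt (l - 2 * x)) - (y - f (s * Num.sqrt (l - 2 * y))) =
    (x - y) - (f (s * Num.sqrt (l - 2 * x)) - f (s * Num.sqrt (l - 2 * y))) by ring.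
  apply: le_trans (ler_normB _ _) _; have := normr_ge0 (x - y); lra.
have fb y : `|y| <= eps -> - eps <= f (s * Num.sqrt (l - 2 * y)) <= eps.
  move=> ye; rewrite -ler_norml; apply: (fg_le FG).
  case/andP: hl => _ llb.
  have -> : `|s * Num.sqrt (l - 2 * y)| = Num.sqrt (l - 2 * y).
    by rewrite normrM (norm_sign sE) mul1r ger0_norm ?sqrtr_ge0.
  exact: sqrt_label_lt.
have k1 : k (- eps) <= 0.
  by have := fb (- eps); rewrite /k normrN ger0_norm// => /(_ (lexx _)); lra.
have k2 : 0 <= k eps.
  by have := fb eps; rewrite /k ger0_norm// => /(_ (lexx _)); lra.
have ee : - eps <= eps by lra.
have [|y] := @IVT _ k (- eps) eps 0 ee kc.
  by rewrite ge_min le_max k1 k2 orbT.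
rewrite in_itv/= => ye /subr0_eq E; exists y; split; [exact: ek | exact: E].
Qed.

Definition height (s l : R) := xget 0 [set y | height_at s l y].

Lemma heightP s l : s = 1 \/ s = -1 -> la <= l <= lb -> height_at s l (height s l).
Proof. by move=> sE hl; have [y hy] := height_ex sE hl; exact: (xgetI 0 hy). Qed.

Lemma height_unique s l y : s = 1 \/ s = -1 -> la <= l <= lb -> height_at s l y -> y = height s l.
Proof.
move=> sE hl hy; have := height_uniq_lip sE hl hl hy (heightP sE hl).
by rewrite subrr normr0 mul0r normr_le0 subr_eq0 => /eqP.
Qed.

Definition hor (s l : R) := Num.sqrt (l - 2 * height s l).
(** Angle at the focus between the upward vertical and the intersection point on the side [s]. *)
Definition tilt (s l : R) := atan (hor s l / (1 + height s l)).
Definition radius2 (s l : R) := l + 1 + height s l ^+ 2.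

Section LevelMeetsGraph.
Context (s : R) (sE : s = 1 \/ s = -1).

Lemma height_le l : la <= l <= lb -> `|height s l| <= eps.
Proof. by move=> hl; case: (heightP sE hl). Qed.

Lemma height_lt1 l : la <= l <= lb -> `|height s l| <= 1 / 32.
Proof.
move=> hl; apply: le_trans (height_le hl) _.
have := fg_eps FG; have := fg_c1 FG; lra.
Qed.

Lemma heightL l l' : la <= l <= lb -> la <= l' <= lb -> `|height s l - height s l'| <= `|l - l'| / 32.
Proof. by move=> hl hl'; apply: (height_uniq_lip sE hl hl'); exact: heightP. Qed.

Lemma hor_sqr l : la <= l <= lb -> hor s l ^+ 2 = l - 2 * height s l.
Proof.
move=> hl; rewrite sqr_sqrtr//.
have /andP[l1 _] := hl; apply: le_trans (label_sub_ge l1 (height_le hl)).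
by rewrite exprn_ge0// ltW// (fg_c FG).
Qed.

Lemma hor_ge l : la <= l <= lb -> c <= hor s l.
Proof.
move=> hl; have /andP[l1 _] := hl; have c0 := fg_c FG.
by rewrite -(ger0_norm (ltW c0)) -sqrtr_sqr ler_wsqrtr// label_sub_ge// height_le.
Qed.

Lemma hor_lt l : la <= l <= lb -> hor s l < M.
Proof. by move=> hl; apply: sqrt_label_lt; [case/andP: hl | exact: height_le]. Qed.

Lemma horL l l' : la <= l <= lb -> la <= l' <= lb -> `|hor s l - hor s l'| <= `|l - l'| / c.
Proof.
move=> hl hl'; have c0 := fg_c FG.
have /andP[l1 _] := hl; have /andP[l1' _] := hl'.
apply: le_trans (sqrt_lip c0 (label_sub_ge l1 (height_le hl)) (label_sub_ge l1' (height_le hl'))) _.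
rewrite invfM mulrA ler_wpM2r ?invr_ge0 ?(ltW c0)// ler_pdivrMr//.
have -> : l - 2 * height s l - (l' - 2 * height s l') = (l - l') - 2 * (height s l - height s l') by ring.
apply: le_trans (ler_normB _ _) _; rewrite normrM (ger0_norm (_ : 0 <= 2 :> R))//.
by have := heightL hl hl'; have := normr_ge0 (l - l'); lra.
Qed.

Lemma tiltL l l' : la <= l <= lb -> la <= l' <= lb ->
  `|tilt s l - tilt s l'| <= (2 / c + M) * `|l - l'|.
Proof.
move=> hl hl'.
have atanL (a b : R) : `|atan a - atan b| <= `|a - b|.
  wlog ab : a b / a < b.
    move=> H; case: (ltgtP a b) => [/H//|/H|->]; last by rewrite !subrr normr0.
    by rewrite distrC [leRHS]distrC.
  have [|x _] := @MVT R atan (fun x => (1 + x ^+ 2)^-1) a b ab (fun x _ => is_derive1_atan x).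
    by apply: continuous_subspaceT => x; exact: continuous_atan.
  rewrite distrC [leRHS]distrC => ->; rewrite normrM ler_piMl//.
  have x2 : 0 <= x ^+ 2 by exact: sqr_ge0.
  rewrite ger0_norm ?invr_ge0; last by lra.
  by rewrite invf_le1; lra.
apply: le_trans (atanL _ _) _.
have c0 := fg_c FG; have M4 := fg_M FG.
have := height_lt1 hl; rewrite ler_norml => /andP[b1 b2]; have := height_lt1 hl'; rewrite ler_norml => /andP[a1 a2].
have H1 := horL hl hl'; have H2 := heightL hl hl'.
have H3 := hor_ge hl'; have H4 := hor_lt hl'.
set x := hor s l in H1 *; set x' := hor s l' in H1 H3 H4 *.
set y := height s l in b1 b2 H2 *; set y' := height s l' in a1 a2 H2 *.
have -> : x / (1 + y) - x' / (1 + y') = (x - x') / (1 + y) - x' * (y - y') / ((1 + y) * (1 + y')).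
  by field; rewrite !gt_eqF//; lra.
have i1 : 0 <= (1 + y)^-1 <= 2.
  rewrite invr_ge0; apply/andP; split; first by lra.
  by rewrite -[leRHS]invrK lef_pV2 ?posrE; lra.
have i2 : 0 <= ((1 + y) * (1 + y'))^-1 <= 4.
  rewrite invr_ge0; apply/andP; split; first by apply: mulr_ge0; lra.
  by rewrite -[leRHS]invrK lef_pV2 ?posrE; nra.
apply: le_trans (ler_normB _ _) _; rewrite [leRHS]mulrDl; apply: lerD.
  rewrite normrM (ger0_norm (_ : 0 <= (1 + y)^-1)); last by lra.
  apply: le_trans (_ : `|l - l'| / c * 2 <= _); last by rewrite le_eqVlt; apply/orP; left; apply/eqP; ring.
  by apply: ler_pM => //; lra.
rewrite !normrM (ger0_norm (_ : 0 <= ((1 + y) * (1 + y'))^-1)); last by lra.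
rewrite (ger0_norm (_ : 0 <= x')); last by lra.
apply: le_trans (_ : M * (`|l - l'| / 32) * 4 <= _); last by have := normr_ge0 (l - l'); nra.
apply: ler_pM => //; [by apply: mulr_ge0 => //; lra | by lra | | by lra].
by apply: ler_pM => //; lra.
Qed.

Lemma tilt_itv l : la <= l <= lb -> 0 < tilt s l < pi / 2.
Proof.
move=> hl; rewrite atan_ltpi2 andbT.
have := height_lt1 hl; rewrite ler_norml => /andP[b1 b2].
have := hor_ge hl; have := fg_c FG => c0 hc.
rewrite -atan0; apply: lt_atan; rewrite divr_gt0//; lra.
Qed.

Lemma radius2_eq l : la <= l <= lb -> radius2 s l = hor s l ^+ 2 + (height s l + 1) ^+ 2.
Proof. by move=> hl; rewrite hor_sqr// /radius2; ring. Qed.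

Lemma radius2_gt1 l : la <= l <= lb -> 1 < radius2 s l.
Proof.
move=> /andP[l1 _]; rewrite /radius2.
have := sqr_ge0 (height s l); have := fg_la FG; have := fg_eps0 FG.
have : 0 < c ^+ 2 by rewrite exprn_gt0// (fg_c FG).
lra.
Qed.

Lemma radius2_le l : la <= l <= lb -> radius2 s l <= lb + 2.
Proof.
move=> hl; have := height_lt1 hl; rewrite /radius2 ler_norml.
move: hl; set h := height s l => /andP[_ l1] /andP[h1 h2].
have : h ^+ 2 <= 1 by nra.
lra.
Qed.

Lemma polar_height l : la <= l <= lb ->
  hor s l = Num.sqrt (radius2 s l) * sin (tilt s l) /\
  height s l + 1 = Num.sqrt (radius2 s l) * cos (tilt s l).
Proof.
move=> hl; have := height_lt1 hl; rewrite ler_norml => /andP[b1 b2].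
have r0 : 0 < Num.sqrt (radius2 s l).
  by rewrite sqrtr_gt0; apply: lt_trans (radius2_gt1 hl).
have y0 : 0 < height s l + 1 by lra.
have C : cos (tilt s l) = (height s l + 1) / Num.sqrt (radius2 s l).
  rewrite /tilt cos_atan.
  have -> : 1 + (hor s l / (1 + height s l)) ^+ 2 = radius2 s l / (height s l + 1) ^+ 2.
    by rewrite radius2_eq//; field; rewrite !gt_eqF//; lra.
  rewrite sqrtrM ?(ltW (lt_trans ltr01 (radius2_gt1 hl)))// sqrtrV ?sqr_ge0// sqrtr_sqr gtr0_norm//.
  by rewrite invfM invrK mulrC.
have T : tan (tilt s l) = hor s l / (1 + height s l) by rewrite /tilt atanK.
have c0 : 0 < cos (tilt s l) by rewrite C divr_gt0.
have S : sin (tilt s l) = cos (tilt s l) * (hor s l / (1 + height s l)).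
  by rewrite -T /tan mulrC divfK// gt_eqF.
by split; rewrite ?S C; field; rewrite !gt_eqF//; lra.
Qed.

Lemma radius2D l l' : la <= l <= lb -> la <= l' <= lb -> l <= l' ->
  (l' - l) / 2 <= radius2 s l' - radius2 s l.
Proof.
move=> hl hl' ll; have := heightL hl' hl.
rewrite (ger0_norm (_ : 0 <= l' - l)) ?subr_ge0// ler_norml.
have := height_lt1 hl; rewrite ler_norml; have := height_lt1 hl'; rewrite ler_norml /radius2.
set y := height s l; set y' := height s l' => /andP[? ?] /andP[? ?] /andP[? ?]; nra.
Qed.

Lemma lnD_ge (a b : R) : 0 < a -> a <= b -> (b - a) / b <= ln b - ln a.
Proof.
move=> a0 ab; have b0 : 0 < b by exact: lt_le_trans ab.
have ab0 : 0 < a / b by rewrite divr_gt0.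
have : ln (a / b) <= a / b - 1.
  by have := @le_ln1Dx R (a / b - 1); rewrite [1 + _]addrC subrK; apply; lra.
rewrite ln_div ?posrE// => H.
have -> : (b - a) / b = - (a / b - 1) by field; rewrite gt_eqF.
lra.
Qed.

End LevelMeetsGraph.
End LevelCoordinates.

(** * Closed orbits and levels *)

Lemma cos_eq1_ge (R : realType) (A : R) : 0 < A -> cos A = 1 -> 2 * pi <= A.
Proof.
move=> A0 cA; rewrite leNgt; apply/negP => A2.
have s0 : 0 < sin (A / 2) by apply: sin_gt0_pi; lra.
have := cos2Dsin2 (A / 2).
have : cos A = cos (A / 2) ^+ 2 - sin (A / 2) ^+ 2.
  by rewrite {1}(splitr A) cosD -!expr2.
rewrite cA; nra.
Qed.

Section OneTurn.
Context {R : realType} {n : nat} {Z : pwl_system R n} {f : R -> R} {mu c M eps la lb : R}.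
Context (GS : graph_system Z f mu c M eps) (FG : flat_graph f c M eps la lb).
Context (mu_small : mu * (2 / c + M) * (4 * (lb + 2)) < 1).
Implicit Types (g : R -> 'cV[R]_2) (z v : 'cV[R]_2).

Local Notation W := (work_region (M := M) (eps := eps) la lb).
Local Notation hgt := (@height R f eps).
Local Notation wid := (@hor R f eps).
Local Notation ang := (@tilt R f eps).
Local Notation rad2 := (@radius2 R f eps).

Definition graph_pt (s l : R) : 'cV[R]_2 := vec2 (s * wid s l) (hgt s l).

Lemma graph_ptP s z : s = 1 \/ s = -1 -> W z -> yc z = f (xc z) -> c < s * xc z ->
  la < label z < lb /\ z = graph_pt s (label z).
Proof.
move=> sE Wz yf cx; have lz := branch_label GS Wz yf; split => //.
have lz' : la <= label z <= lb by case/andP: lz => ? ?; rewrite !ltW.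
have [xM yM _] := Wz; have c0 := gs_c GS.
have ss : s * s = 1 by case: sE => ->; rewrite ?mulrNN mulr1.
have E : Num.sqrt (label z - 2 * yc z) = s * xc z.
  rewrite /label addrK -[RHS]ger0_norm; last by apply: ltW; apply: lt_trans cx.
  by rewrite normrM norm_sign// mul1r sqrtr_sqr.
have H : @height_at R f eps s (label z) (yc z).
  split; first by rewrite yf; exact: (gs_le GS).
  by rewrite E mulrA ss mul1r.
have hE := height_unique FG sE lz' H.
apply: vec2P; rewrite ?xc_vec2 ?yc_vec2//.
by rewrite /hor -hE E mulrA ss mul1r.
Qed.

Lemma label_graph_pt s l : s = 1 \/ s = -1 -> la <= l <= lb -> label (graph_pt s l) = l.
Proof.
move=> sE hl; rewrite /label xc_vec2 yc_vec2 exprMn (hor_sqr FG sE hl).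
have -> : s ^+ 2 = 1 by case: sE => ->; rewrite ?sqrrN expr1n.
by ring.
Qed.

Lemma graph_pt_branch s l : s = 1 \/ s = -1 -> la <= l <= lb ->
  yc (graph_pt s l) = f (xc (graph_pt s l)).
Proof. by move=> sE hl; rewrite xc_vec2 yc_vec2; have [_ {1}->] := heightP FG sE hl. Qed.

(** The half logarithm of the squared radius grows in [l] at rate at least [1 / (4 (lb + 2))], while
    [mu] times the angle varies at rate at most [mu (2 / c + M)]; [mu_small] says that the former
    wins. *)
Lemma spiral_mono (s th l l' : R) : s = 1 \/ s = -1 -> th = 1 \/ th = -1 ->
  la <= l <= lb -> la <= l' <= lb -> l < l' ->
  ln (rad2 s l) / 2 + th * mu * ang s l < ln (rad2 s l') / 2 + th * mu * ang s l'.
Proof.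
move=> sE thE hl hl' ll; have mu0 := gs_mu0 GS; have c0 := gs_c GS; have M4 := gs_M GS.
have r1 := radius2_gt1 FG s hl; have r2 := radius2_gt1 FG s hl'.
have r3 := radius2_le FG sE hl'.
have rD := radius2D FG sE hl hl' (ltW ll).
have T := tiltL FG sE hl' hl; rewrite (gtr0_norm (_ : 0 < l' - l)) ?subr_gt0// in T.
have r0 : 0 < rad2 s l by lra.
have rr : rad2 s l <= rad2 s l' by lra.
have L := lnD_ge r0 rr.
have K0 : 0 < 2 / c + M by rewrite addr_gt0 ?divr_gt0//; lra.
have lb2 : 0 < lb + 2 by lra.
have L2 : (l' - l) / (2 * (lb + 2)) <= ln (rad2 s l') - ln (rad2 s l).
  apply: le_trans L; rewrite ler_pdivrMr; last by lra.
  rewrite mulrAC ler_pdivlMr; last by lra.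
  have : 0 <= rad2 s l' by lra.
  nra.
have D0 : 0 < l' - l by rewrite subr_gt0.
have L3 : mu * ((2 / c + M) * (l' - l)) < (l' - l) / (2 * (lb + 2)) / 2.
  rewrite -mulrA -invfM ltr_pdivlMr; last by lra.
  have -> : mu * ((2 / c + M) * (l' - l)) * (2 * (lb + 2) * 2) =
    (mu * (2 / c + M) * (4 * (lb + 2))) * (l' - l) by ring.
  by rewrite gtr_pMl.
have L4 : `|mu * (ang s l' - ang s l)| <= mu * ((2 / c + M) * (l' - l)).
  by rewrite normrM gtr0_norm// ler_pM2l.
move: L4; rewrite ler_norml => /andP[L4 L5].
by case: thE => ->; lra.
Qed.

(** Logarithm of the radius corrected by [mu] times the angle, which is constant along the spiral.
    The lower arc from the left point of label [l] lands on the right point of label [l'] when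
    [psiR l' = psiL l], so the return map is the inverse of [psiR] after [psiL]. *)
Definition psiR l := ln (rad2 1 l) / 2 + mu * ang 1 l.
Definition psiL l := ln (rad2 (-1) l) / 2 + mu * (2 * pi - ang (-1) l).

Lemma psiR_mono l l' : la <= l <= lb -> la <= l' <= lb -> l < l' -> psiR l < psiR l'.
Proof.
move=> hl hl' ll; have := spiral_mono (or_introl erefl) (or_introl erefl) hl hl' ll.
by rewrite /psiR !mul1r.
Qed.

Lemma psiL_mono l l' : la <= l <= lb -> la <= l' <= lb -> l < l' -> psiL l < psiL l'.
Proof.
move=> hl hl' ll; have := spiral_mono (or_intror erefl) (or_intror erefl) hl hl' ll.
by rewrite /psiL; lra.
Qed.

Definition timeX l := wid 1 l + wid (-1) l.

Definition loop l (t : R) : 'cV[R]_2 :=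
  if t <= timeX l then vec2 (wid 1 l - t) ((l - (wid 1 l - t) ^+ 2) / 2)
  else let s := t - timeX l in
  vec2 (expR (mu * s) * (cos s * (- wid (-1) l) - sin s * (hgt (-1) l + 1)))
       (expR (mu * s) * (sin s * (- wid (-1) l) + cos s * (hgt (-1) l + 1)) - 1).

(** From a right point the motion is forced: a parabola to the left point of the same label, then a
    spiral back to the right. The lower bound [c] for the duration permits induction over time
    windows, and the absence of right points in between lets every right point be reached by
    successive turns. *)
Lemma one_turn g t0 l : trajectory Z g -> (forall t, W (g t)) -> la < l < lb ->
  g t0 = graph_pt 1 l ->
  exists l', let t2 := t0 + timeX l + (2 * pi - ang (-1) l - ang 1 l') in
    [/\ la < l' < lb, t0 + c < t2, psiR l' = psiL l, g t2 = graph_pt 1 l' &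
     (forall t, t0 < t < t2 -> ~ (yc (g t) = f (xc (g t)) /\ c < xc (g t))) /\
     (forall t, t0 <= t <= t2 -> g t = loop l (t - t0))].
Proof.
move=> tg Wg hl0 gt0; have hl : la <= l <= lb by case/andP: hl0 => ? ?; rewrite !ltW.
have s1 : (1 : R) = 1 \/ (1 : R) = -1 by left.
have s2 : (-1 : R) = 1 \/ (-1 : R) = -1 by right.
have oX := gs_oX GS; have oY := gs_oY GS; have dXY := gs_dXY GS.
have c0 := gs_c GS; have M4 := gs_M GS; have mu0 := gs_mu0 GS.
have h1c := hor_ge FG s1 hl; have h2c := hor_ge FG s2 hl.
have r0 : right_pt (f := f) (c := c) (g t0).
  split; first by rewrite gt0 graph_pt_branch.
  have : yc (g t0) = f (xc (g t0)) by rewrite gt0 graph_pt_branch.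
  move=> /(branch_side GS (fg_la FG) (Wg t0))[[_ //]|[_]].
  by rewrite gt0 xc_vec2 mul1r; lra.
have [t1 [t01 X1 L1]] := hit_left GS (fg_la FG) tg Wg (leave_right GS tg (Wg t0) r0).
have HX t : t0 <= t <= t1 -> xc (g t) = wid 1 l - (t - t0) /\ label (g t) = l.
  move=> /andP[t0t tt1].
  have Xw w : t0 < w < t -> zoneX Z (g w).
    by move=> /andP[w1 w2]; apply: X1 => //; exact: lt_le_trans tt1.
  have [-> ->] := flowX oX dXY (gs_fX GS) tg t0t Xw.
  by rewrite gt0 xc_vec2 mul1r label_graph_pt.
have t01' := ltW t01.
have [X1t l1t] : xc (g t1) = wid 1 l - (t1 - t0) /\ label (g t1) = l by apply: HX; rewrite t01' lexx.
have [L1f L1c] := L1.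
have [_ gt1] : la < label (g t1) < lb /\ g t1 = graph_pt (-1) (label (g t1)).
  by apply: graph_ptP => //; rewrite mulN1r; lra.
rewrite l1t in gt1.
have t1E : t1 = t0 + timeX l.
  by move: X1t; rewrite gt1 xc_vec2 mulN1r /timeX; lra.
have rho0 : 0 < rho2 (g t1).
  by rewrite /rho2 ltr_pwDl ?sqr_ge0// exprn_even_gt0//=; apply/eqP; lra.
have [t2 [t12 Y2 R2]] := hit_right GS (fg_la FG) tg Wg rho0 (leave_left GS tg (Wg t1) L1).
have [R2f R2c] := R2.
have [hl'0 gt2] : la < label (g t2) < lb /\ g t2 = graph_pt 1 (label (g t2)).
  by apply: graph_ptP => //; rewrite mul1r.
set l' := label (g t2) in hl'0 gt2.
have hl' : la <= l' <= lb by case/andP: hl'0 => ? ?; rewrite !ltW.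
have HY t : t1 <= t <= t2 ->
    xc (g t) = expR (mu * (t - t1)) * (cos (t - t1) * (- wid (-1) l) - sin (t - t1) * (hgt (-1) l + 1)) /\
    yc (g t) + 1 = expR (mu * (t - t1)) * (sin (t - t1) * (- wid (-1) l) + cos (t - t1) * (hgt (-1) l + 1)).
  move=> /andP[t1t tt2].
  have Yw w : t1 < w < t -> zoneY Z (g w).
    by move=> /andP[w1 w2]; apply: Y2 => //; exact: lt_le_trans tt2.
  have [-> ->] := flowY oY dXY (gs_fY GS) tg t1t Yw.
  by rewrite gt1 xc_vec2 yc_vec2 mulN1r.
have [P1 P2] := polar_height FG s2 hl; have [Q1 Q2] := polar_height FG s1 hl'.
have b2 := tilt_itv FG s2 hl; have b1 := tilt_itv FG s1 hl'.
set r2 := Num.sqrt (rad2 (-1) l) in P1 P2; set r1 := Num.sqrt (rad2 1 l') in Q1 Q2.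
set a2 := ang (-1) l in P1 P2 b2 *; set a1 := ang 1 l' in Q1 Q2 b1 *.
have rad21 := radius2_gt1 FG (-1) hl; have rad11 := radius2_gt1 FG 1 hl'.
have r20 : 0 < r2 by rewrite sqrtr_gt0; lra.
have r10 : 0 < r1 by rewrite sqrtr_gt0; lra.
have HYp t : t1 <= t <= t2 ->
    xc (g t) = - (expR (mu * (t - t1)) * r2 * sin (t - t1 + a2)) /\
    yc (g t) + 1 = expR (mu * (t - t1)) * r2 * cos (t - t1 + a2).
  by move=> /HY[-> ->]; rewrite P1 P2 (sinD (t - t1)) (cosD (t - t1)); split; ring.
have t12' := ltW t12.
have [Ex Ey] : xc (g t2) = - (expR (mu * (t2 - t1)) * r2 * sin (t2 - t1 + a2)) /\
    yc (g t2) + 1 = expR (mu * (t2 - t1)) * r2 * cos (t2 - t1 + a2) by apply: HYp; rewrite t12' lexx.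
rewrite gt2 xc_vec2 mul1r Q1 in Ex; rewrite gt2 yc_vec2 Q2 in Ey.
set s := t2 - t1 in Ex Ey; set E := expR (mu * s) in Ex Ey.
have s0 : 0 < s by rewrite subr_gt0.
have E0 : 0 < E by exact: expR_gt0.
have r1E : r1 = E * r2.
  have Er0 : 0 < E * r2 by exact: mulr_gt0.
  apply/eqP; rewrite -(@eqrXn2 _ 2) ?ltW//; apply/eqP.
  have C1 := cos2Dsin2 a1; have C2 := cos2Dsin2 (s + a2).
  transitivity ((r1 * cos a1) ^+ 2 + (r1 * sin a1) ^+ 2).
    by rewrite -[LHS]mulr1 -C1; ring.
  rewrite Ex Ey -[RHS]mulr1 -C2; ring.
have Er : E * r2 != 0 by rewrite mulf_neq0 ?gt_eqF.
have Sx : sin a1 = - sin (s + a2).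
  by apply: (mulfI Er); rewrite -{1}r1E Ex; ring.
have Cx : cos a1 = cos (s + a2).
  by apply: (mulfI Er); rewrite -{1}r1E Ey.
have cA : cos (s + a2 + a1) = 1.
  rewrite cosD Sx Cx mulrN opprK -!expr2; exact: cos2Dsin2.
have A0 : 0 < s + a2 + a1 by lra.
have A1 := cos_eq1_ge A0 cA.
(* So far the total angle is only known to have cosine 1 and to be at least [2 pi]. If it were
   larger, the spiral would pass vertically above the focus at distance at least [r2 > 1 + eps],
   hence above the graph, while still in the lower zone. *)
have AE : s + a2 + a1 = 2 * pi.
  apply/eqP; rewrite eq_le A1 andbT leNgt; apply/negP => A2.
  have A3 : 2 * pi <= s + a2 + a1 - 2 * pi.
    apply: cos_eq1_ge; first by rewrite subr_gt0.
    by rewrite cosB mulr_natl cos2pi sin2pi mulr1 mulr0 addr0.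
  have tm : t1 < t1 + (2 * pi - a2) < t2 by move: A3 s0 b1 b2; rewrite /s; lra.
  have /andP[tm1 tm2] := tm.
  have [|Hx Hy] := HYp (t1 + (2 * pi - a2)); first by rewrite (ltW tm1) (ltW tm2).
  have e2 : t1 + (2 * pi - a2) - t1 + a2 = pi *+ 2 by rewrite -mulr_natl; ring.
  rewrite e2 cos2pi mulr1 in Hy; rewrite e2 sin2pi mulr0 oppr0 in Hx.
  have E1 : 1 <= expR (mu * (t1 + (2 * pi - a2) - t1)).
    by apply: le_trans (expR_ge1Dx _); rewrite lerDl mulr_ge0 ?subr_ge0 ?(ltW tm1)// ltW.
  have := Y2 _ tm1 tm2; have [xM yM _] := Wg (t1 + (2 * pi - a2)).
  move/(gs_Y GS xM yM); rewrite Hx.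
  have M0 : `|0 : R| < M by rewrite normr0; lra.
  have := gs_le GS M0; rewrite ler_norml => /andP[_ f0] yf.
  have r2e : 1 + eps < r2.
    have e0 := gs_eps0 GS; have ec := gs_eps GS; have la0 := fg_la FG.
    have hlt := height_lt1 FG s2 hl; have /andP[lal _] := hl.
    rewrite -(ger0_norm (_ : 0 <= 1 + eps)); last by lra.
    rewrite -sqrtr_sqr ltr_sqrt; last by lra.
    by rewrite /radius2; have := sqr_ge0 (hgt (-1) l); nra.
  have : r2 <= expR (mu * (t1 + (2 * pi - a2) - t1)) * r2 by rewrite ler_pMl.
  lra.
have t2E : t2 = t0 + timeX l + (2 * pi - a2 - a1) by move: AE; rewrite /s t1E; lra.
exists l' => /=; rewrite -/a2 -/a1 -t2E; split => //.
- by move: t12; rewrite t1E /timeX; lra.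
- have R1 : rad2 1 l' = E ^+ 2 * rad2 (-1) l.
    rewrite -(@sqr_sqrtr _ (rad2 1 l')) ?(ltW (lt_trans ltr01 _))//.
    rewrite -(@sqr_sqrtr _ (rad2 (-1) l)) ?(ltW (lt_trans ltr01 _))//.
    by rewrite -/r1 -/r2 r1E exprMn.
  rewrite /psiR /psiL -/a1 -/a2 R1 lnM ?posrE ?exprn_gt0//; last by lra.
  rewrite lnXn// expRK -mulr_natl.
  have -> : a1 = 2 * pi - s - a2 by lra.
  by field.
split=> [t /andP[tt0 tt2] [tf tc]|t /andP[t0t tt2]].
  case: (ltgtP t t1) => [tt1|tt1|tE].
  - have [xM yM _] := Wg t.
    by have /(gs_X GS xM yM) := X1 t tt0 tt1; rewrite tf ltxx.
  - have [xM yM _] := Wg t.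
    by have /(gs_Y GS xM yM) := Y2 t tt1 tt2; rewrite tf ltxx.
  - by move: tc; rewrite tE; lra.
have lE : (t - t0 <= timeX l) = (t <= t1) by rewrite t1E lerBlDl.
rewrite /loop lE; case: leP => tt1.
  have [Hx Hl] := HX t (introT andP (conj t0t tt1)).
  apply: vec2P; rewrite ?xc_vec2 ?yc_vec2//.
  by rewrite -Hx; move: Hl; rewrite /label => <-; field.
have -> : t - t0 - timeX l = t - t1 by rewrite t1E; ring.
have [|Hx Hy] := HY t; first by rewrite (ltW tt1).
by apply: vec2P; rewrite ?xc_vec2 ?yc_vec2 ?Hx// -Hy addrK.
Qed.

End OneTurn.

Section Classify.
Context {R : realType} {n : nat} {Z : pwl_system R n} {f : R -> R} {mu c M eps la lb : R}.
Context (GS : graph_system Z f mu c M eps) (FG : flat_graph f c M eps la lb).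
Context (mu_small : mu * (2 / c + M) * (4 * (lb + 2)) < 1).
Implicit Types (g : R -> 'cV[R]_2) (z v : 'cV[R]_2).

Local Notation W := (work_region (M := M) (eps := eps) la lb).
Local Notation ptR := (@graph_pt R f eps 1).
Local Notation psR := (@psiR R f mu eps).
Local Notation psL := (@psiL R f mu eps).

Definition period l := timeX (f := f) (eps := eps) l +
  (2 * pi - tilt (f := f) (eps := eps) (-1) l - tilt (f := f) (eps := eps) 1 l).

Definition loop_set l := [set loop (f := f) (mu := mu) (eps := eps) l t | t in `[0, period l]].

Lemma open_near_right g (A : set 'cV[R]_2) t : continuous g -> open A -> A (g t) ->
  exists2 r, 0 < r & forall u, t < u -> u < t + r -> A (g u).
Proof.
move=> cg oA At; have /nbhs_ballP[d /= d0 Hd] : nbhs t (g @^-1` A).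
  by apply: cg; apply: open_nbhs_nbhs.
exists d => // u tu ud; apply: Hd; rewrite /ball/= distrC gtr0_norm; lra.
Qed.

Lemma reach_right g t : trajectory Z g -> (forall t, W (g t)) -> 0 < rho2 (g t) ->
  exists2 t0, t <= t0 & right_pt (f := f) (c := c) (g t0).
Proof.
move=> tg Wg r0; have cg := trajectory_continuous tg; have c0 := gs_c GS.
have fromL u : left_pt (f := f) (c := c) (g u) -> exists2 t0, u <= t0 & right_pt (f := f) (c := c) (g t0).
  move=> Lu; have [|v [uv _ Rv]] := hit_right GS (fg_la FG) tg Wg _ (leave_left GS tg (Wg u) Lu).
    by case: Lu => _ Lu; rewrite /rho2 ltr_pwDl ?sqr_ge0// exprn_even_gt0//=; apply/eqP; lra.
  by exists v => //; exact: ltW.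
have [xM yM _] := Wg t.
case: (ltgtP (yc (g t)) (f (xc (g t)))) => [Yt|Xt|gr].
- have := open_near_right cg (gs_oY GS) ((gs_Y GS xM yM).2 Yt).
  move=> /(hit_right GS (fg_la FG) tg Wg r0)[u [tu _ Ru]].
  by exists u => //; exact: ltW.
- have := open_near_right cg (gs_oX GS) ((gs_X GS xM yM).2 Xt).
  move=> /(hit_left GS (fg_la FG) tg Wg)[u [tu _ /fromL[w uw Rw]]].
  by exists w => //; lra.
- by have [Rt|/fromL//] := branch_side GS (fg_la FG) (Wg t) gr; exists t.
Qed.

(** The return map is increasing, so if the first return moves the label in the direction [sg], all
    later returns do too. The induction is on the number of time windows of length [c], each turn
    taking longer than one window. *)
Lemma label_drift g (sg : R) (j : nat) : trajectory Z g -> (forall t, W (g t)) -> sg = 1 \/ sg = -1 ->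
  forall t l, la < l < lb -> g t = ptR l -> 0 < sg * (psL l - psR l) ->
  forall u, t < u <= t + c * j%:R -> right_pt (f := f) (c := c) (g u) -> 0 < sg * (label (g u) - l).
Proof.
move=> tg Wg sgE; elim: j => [|j IH] t l hl gt0 dl u /andP[tu uj] Ru.
  by rewrite mulr0 in uj; lra.
have s1 : (1 : R) = 1 \/ (1 : R) = -1 by left.
have c0 := gs_c GS.
have [l' /= ] := one_turn GS FG tg Wg hl gt0.
set t2 := t + _ + _ => -[hl' ct2 E gt2 [noR _]].
have wk x : la < x < lb -> la <= x <= lb by case/andP => ? ?; rewrite !ltW.
have hlw := wk _ hl; have hlw' := wk _ hl'.
have ll : 0 < sg * (l' - l).
  move: dl; rewrite -E; case: (ltgtP l l') => [ll|ll|->]; last by rewrite subrr mulr0 ltxx.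
    by have := psiR_mono GS FG mu_small hlw hlw' ll; case: sgE => ->; lra.
  by have := psiR_mono GS FG mu_small hlw' hlw ll; case: sgE => ->; lra.
have dl' : 0 < sg * (psL l' - psR l').
  rewrite E; move: ll; case: (ltgtP l l') => [ll|ll|->]; last by rewrite subrr mulr0 ltxx.
    by have := psiL_mono GS FG mu_small hlw hlw' ll; case: sgE => ->; lra.
  by have := psiL_mono GS FG mu_small hlw' hlw ll; case: sgE => ->; lra.
case: (ltgtP u t2) => [ut|ut|uE].
- by case: (noR u) => //; rewrite tu.
- have := IH t2 l' hl' gt2 dl' u; rewrite ut /=; move: uj; rewrite -natr1 mulrDr mulr1 => uj H.
  suff : 0 < sg * (label (g u) - l') by lra.
  by apply: H Ru; lra.
- by rewrite uE gt2 (label_graph_pt FG s1 hlw').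
Qed.

Lemma psiR_inj l l' : la <= l <= lb -> la <= l' <= lb -> psR l = psR l' -> l = l'.
Proof.
move=> hl hl' E; have [ll|ll|//] := ltgtP l l'.
  by have := psiR_mono GS FG mu_small hl hl' ll; rewrite E ltxx.
by have := psiR_mono GS FG mu_small hl' hl ll; rewrite E ltxx.
Qed.

Lemma follow_loop g l (j : nat) : trajectory Z g -> (forall t, W (g t)) ->
  la < l < lb -> psR l = psL l ->
  forall t u, g t = ptR l -> t <= u <= t + c * j%:R -> loop_set l (g u).
Proof.
move=> tg Wg hl E; have c0 := gs_c GS.
have wk x : la < x < lb -> la <= x <= lb by case/andP => ? ?; rewrite !ltW.
elim: j => [|j IH] t u gt0 /andP[tu uj];
  have [l' /= ] := one_turn GS FG tg Wg hl gt0;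
  set t2 := t + _ + _ => -[hl' ct2 E' gt2 [_ gl]];
  have ll := psiR_inj (wk _ hl') (wk _ hl) (etrans E' (esym E));
  have pE : t2 - t = period l by rewrite /t2 /period ll; ring.
  by exists (u - t); [rewrite /= in_itv/= -pE; lra | rewrite gl//; lra].
have [ut|ut] := leP u t2.
  by exists (u - t); [rewrite /= in_itv/= -pE; lra | rewrite gl//; lra].
apply: (IH t2); first by rewrite -ll.
by move: uj; rewrite -natr1; lra.
Qed.

(** A periodic orbit in the region has a right point, and its label can drift neither up nor down,
    since it is recovered after one period. Hence the return map fixes it, and the orbit follows the
    explicit loop. *)
Lemma periodic_orbit_loop O : periodic_orbit Z O -> O `<=` W ->
  exists l, [/\ la < l < lb, psR l = psL l & O = loop_set l].
Proof.
move=> [g [T [tg T0 gT ig ->]]] OW.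
have Wg t : W (g t) by apply: OW; exists t.
have c0 := gs_c GS.
have wk x : la < x < lb -> la <= x <= lb by case/andP => ? ?; rewrite !ltW.
have s1 : (1 : R) = 1 \/ (1 : R) = -1 by left.
have gTn (j : nat) t : g (t + T * j%:R) = g t.
  elim: j => [|j IH]; first by rewrite mulr0 addr0.
  by rewrite -natr1 mulrDr mulr1 addrA gT.
have [t0 rt0] : exists t0, right_pt (f := f) (c := c) (g t0).
  have [ts r0] : exists ts, 0 < rho2 (g ts).
    (* Otherwise the trajectory rests at the focus, against injectivity on a period. *)
    apply: contrapT => nex.
    have z0 t : xc (g t) = 0 /\ yc (g t) = -1.
      have /negP := fun h => nex (ex_intro _ t h); rewrite -leNgt /rho2 => H.
      have H1 := sqr_ge0 (xc (g t)); have H2 := sqr_ge0 (yc (g t) + 1).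
      have /eqP : xc (g t) ^+ 2 = 0 by lra.
      have /eqP : (yc (g t) + 1) ^+ 2 = 0 by lra.
      by rewrite !sqrf_eq0 addr_eq0 => /eqP -> /eqP.
    have : g 0 = g (T / 2) by apply: vec2P; rewrite ?(z0 _).1 ?(z0 _).2.
    by move/ig; rewrite !in_itv/=; lra.
  by have [t0 _ ?] := reach_right tg Wg r0; exists t0.
have [gr cx] := rt0.
have [|hl gt0] := graph_ptP GS FG s1 (Wg t0) gr; first by rewrite mul1r.
set l := label (g t0) in hl gt0.
have upT (d b t : R) : 0 < d -> exists j : nat, b <= t + d * j%:R.
  move=> d0; exists (Num.bound `|(b - t) / d|).
  have := archi_boundP (normr_ge0 ((b - t) / d)); have := ler_norm ((b - t) / d) => H1 H2.
  have := le_lt_trans H1 H2; rewrite ltr_pdivrMr// [_ * d]mulrC; lra.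
have E : psR l = psL l.
  (* A strict drift in either direction contradicts the fact that the right point at [t0] is met
     again at [t0 + T]. *)
  have drift (sg : R) : sg = 1 \/ sg = -1 -> ~ 0 < sg * (psL l - psR l).
    move=> sgE d0; have [j hj] := upT c (t0 + T) t0 c0.
    have := label_drift (j := j) tg Wg sgE hl gt0 d0 (u := t0 + T).
    by rewrite gT subrr mulr0 ltxx hj andbT ltrDl => /(_ T0 rt0).
  have := drift 1 s1; have := drift (-1) (or_intror erefl).
  by case: (ltgtP (psR l) (psL l)) => // H H1 H2; exfalso; [apply: H2|apply: H1]; lra.
exists l; split => //; apply/seteqP; split => [z [t _ <-]|z [t]].
  have [j hj] := upT T t0 t T0; rewrite -(gTn j).
  have [i hi] := upT c (t + T * j%:R) t0 c0.
  by apply: (follow_loop (j := i) tg Wg hl E gt0); rewrite hj.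
rewrite /= in_itv/= => /andP[t0' tp] <-; exists (t + t0) => //.
have [l' /= [hl' ct2 E' gt2 [_ gl]]] := one_turn GS FG tg Wg hl gt0.
have ll := psiR_inj (wk _ hl') (wk _ hl) (etrans E' (esym E)).
rewrite gl ?addrK// lerDr t0' /= -[X in _ <= X]addrA -lerBrDr ll.
by move: tp; rewrite /period; lra.
Qed.

End Classify.

(** * The explicit loops as Filippov periodic orbits *)

Section Spiral.
Context {R : realType} (mu p q : R).

Definition spiralx s : R := expR (mu * s) * (cos s * p - sin s * q).
Definition spiraly s : R := expR (mu * s) * (sin s * p + cos s * q).

Lemma is_derive_expM t : is_derive t (1 : R) (fun s => expR (mu * s)) (mu * expR (mu * t)).
Proof.
have D := @is_deriveZ _ _ _ _ mu t 1 _ (@is_derive_id _ _ t 1).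
have := @is_derive1_comp _ _ _ t _ _ (is_derive_expR (mu * t)) D.
by move/is_derive_eq; apply; rewrite /GRing.scale /= mulr1 mulrC.
Qed.

Lemma is_derive_spiralx t : is_derive t (1 : R) spiralx (mu * spiralx t - spiraly t).
Proof.
have DC := @is_deriveZ _ _ _ _ p t 1 _ (is_derive_cos t).
have DS := @is_deriveZ _ _ _ _ q t 1 _ (is_derive_sin t).
have := @is_deriveM _ _ _ _ t 1 _ _ (is_derive_expM t) (@is_deriveB _ _ _ _ _ t 1 _ _ DC DS).
set F := (F in is_derive _ _ F _); have -> : F = spiralx.
  by apply/funext => s; rewrite -[LHS]/(expR (mu * s) * (p * cos s - q * sin s)) /spiralx; ring.
move/is_derive_eq; apply; rewrite (_ : (_ - _) t = p * cos t - q * sin t)// /spiralx /spiraly /GRing.scale /=; ring.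
Qed.

Lemma is_derive_spiraly t : is_derive t (1 : R) spiraly (spiralx t + mu * spiraly t).
Proof.
have DC := @is_deriveZ _ _ _ _ q t 1 _ (is_derive_cos t).
have DS := @is_deriveZ _ _ _ _ p t 1 _ (is_derive_sin t).
have := @is_deriveM _ _ _ _ t 1 _ _ (is_derive_expM t) (@is_deriveD _ _ _ _ _ t 1 _ _ DS DC).
set F := (F in is_derive _ _ F _); have -> : F = spiraly.
  by apply/funext => s; rewrite -[LHS]/(expR (mu * s) * (p * sin s + q * cos s)) /spiraly; ring.
move/is_derive_eq; apply; rewrite (_ : (_ + _) t = p * sin t + q * cos t)// /spiralx /spiraly /GRing.scale /=; ring.
Qed.

End Spiral.

Lemma derive_continuous (R : realType) (h h' : R -> R) :
  (forall t, is_derive t (1 : R) h (h' t)) -> continuous h.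
Proof. by move=> H t; have [d _] := H t; apply/differentiable_continuous/derivable1_diffP. Qed.

Lemma sqrt_expR (R : realType) (x : R) : 0 < x -> Num.sqrt x = expR (ln x / 2).
Proof.
move=> x0; have E0 := expR_ge0 (ln x / 2).
rewrite -[RHS]ger0_norm// -sqrtr_sqr; congr Num.sqrt.
by rewrite expr2 -expRD -splitr lnK.
Qed.

(** The expression is the derivative of [y + th * eps * x] along the lower flow, heights being
    measured from the focus. On the left [mu * y] works against the sign, so [- c] is required; on
    the right it helps, and [c / 2] is enough. *)
Lemma slope_sign (R : realType) (x y th eps mu c : R) : th = 1 \/ th = -1 ->
  0 <= eps -> 32 * eps <= c -> 0 < mu -> 4 * mu <= c -> 0 < c -> `|mu * x| <= 1 ->
  (x <= - c -> 0 <= y <= 3 -> x + mu * y + th * eps * (mu * x - y) < 0) /\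
  (c / 2 <= x -> 0 <= y <= 3 -> 0 < x + mu * y + th * eps * (mu * x - y)).
Proof.
move=> thE e0 ec mu0 muc c0; rewrite ler_norml; set m := mu * x => /andP[m1 m2].
split=> hx /andP[y1 y2].
  have : mu * y <= 3 * mu by rewrite mulrC ler_wpM2r// ltW.
  have A : - 4 <= m - y <= 4 by lra.
  have : th * eps * (m - y) <= 4 * eps by case: thE => ->; nra.
  lra.
have : 0 <= mu * y by rewrite mulr_ge0// ltW.
have A : - 4 <= m - y <= 4 by lra.
have : - (4 * eps) <= th * eps * (m - y) by case: thE => ->; nra.
lra.
Qed.

Lemma pihalf_itv (R : realType) (a : R) : 0 <= a -> a <= pi / 2 -> 0 <= a <= pi.
Proof. by move=> a0 a1; have := pi_gt0 R; lra. Qed.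

Lemma sin_cos_mono (R : realType) (a b : R) : 0 <= a -> a <= b -> b <= pi / 2 ->
  [/\ sin a <= sin b, cos b <= cos a & 0 <= cos b].
Proof.
move=> a0; rewrite le_eqVlt => /predU1P[<- a1|ab b1].
  by split => //; apply: cos_ge0_pihalf; have := pi_gt0 R; lra.
have b0 : 0 <= b by lra.
have a1 : a <= pi / 2 by lra.
split; last by apply: cos_ge0_pihalf; have := pi_gt0 R; lra.
  by apply/ltW; rewrite ltr_sin// in_itv/=; have := pi_gt0 R; lra.
by apply/ltW; rewrite ltr_cos// in_itv/=; exact: pihalf_itv.
Qed.

Lemma parabola_gap (R : realType) (x a y l e w : R) : a ^+ 2 = l - 2 * y ->
  w - y <= e * (a - x) -> (a - x) * ((a + x) / 2 - e) <= (l - x ^+ 2) / 2 - w.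
Proof.
move=> S L; have -> : (a - x) * ((a + x) / 2 - e) = (a ^+ 2 - x ^+ 2) / 2 - e * (a - x) by field.
by rewrite S; move: L; set D := e * _; set X := x ^+ 2; lra.
Qed.

Section Arc.
Context {R : realType} {n : nat} {Z : pwl_system R n} {f : R -> R} {mu c M eps la lb : R}.
Context (GS : graph_system Z f mu c M eps) (FG : flat_graph f c M eps la lb).
Context (l : R) (hl : la <= l <= lb).
Context (psi_eq : psiR (f := f) (mu := mu) (eps := eps) l = psiL (f := f) (mu := mu) (eps := eps) l).
Implicit Types (g : R -> 'cV[R]_2) (z v : 'cV[R]_2).

Local Notation W := (work_region (M := M) (eps := eps) la lb).
Local Notation x1 := (@hor R f eps 1 l).
Local Notation x2 := (@hor R f eps (-1) l).
Local Notation y1 := (@height R f eps 1 l).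
Local Notation y2 := (@height R f eps (-1) l).
Local Notation a1 := (@tilt R f eps 1 l).
Local Notation a2 := (@tilt R f eps (-1) l).
Local Notation r1 := (Num.sqrt (@radius2 R f eps 1 l)).
Local Notation r2 := (Num.sqrt (@radius2 R f eps (-1) l)).

Let s1 : (1 : R) = 1 \/ (1 : R) = -1. Proof. by left. Qed.
Let s2 : (-1 : R) = 1 \/ (-1 : R) = -1. Proof. by right. Qed.

Definition sweep := 2 * pi - a2 - a1.
Definition ax s := spiralx mu (- x2) (y2 + 1) s.
Definition ay s := spiraly mu (- x2) (y2 + 1) s.

Lemma sweep_gt0 : 0 < sweep.
Proof. by have := tilt_itv FG s1 hl; have := tilt_itv FG s2 hl; rewrite /sweep; lra. Qed.

Lemma r2_gt0 : 0 < r2.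
Proof. by rewrite sqrtr_gt0; apply: lt_trans (radius2_gt1 FG (-1) hl). Qed.

Lemma exp_sweep : expR (mu * sweep) * r2 = r1.
Proof.
rewrite !sqrt_expR ?(lt_trans ltr01 (radius2_gt1 FG _ hl))// -expRD; congr expR.
by move: psi_eq; rewrite /psiR /psiL /sweep; lra.
Qed.

Lemma r1_le : r1 <= 2 * r2.
Proof.
have -> : 2 = Num.sqrt (2 ^+ 2) :> R by rewrite sqrtr_sqr ger0_norm.
rewrite -sqrtrM ?sqr_ge0// ler_wsqrtr// /radius2.
have := height_lt1 FG s1 hl; rewrite ler_norml => /andP[h1 h2].
have := sqr_ge0 y2; have := fg_la FG; have := sqr_ge0 c; have := fg_eps0 FG.
case/andP: hl; nra.
Qed.

Lemma height2 s : s = 1 \/ s = -1 -> 2 * (@height R f eps s l + 1) <= 3.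
Proof. by move=> sE; have := height_lt1 FG sE hl; rewrite ler_norml; lra. Qed.

Lemma ax_polar s : ax s = - (expR (mu * s) * r2 * sin (s + a2)).
Proof.
have [P1 P2] := polar_height FG s2 hl.
by rewrite /ax /spiralx P1 P2 (sinD s); ring.
Qed.

Lemma ay_polar s : ay s = expR (mu * s) * r2 * cos (s + a2).
Proof.
have [P1 P2] := polar_height FG s2 hl.
by rewrite /ay /spiraly P1 P2 (cosD s); ring.
Qed.

Lemma radius_itv s : 0 <= s <= sweep -> r2 <= expR (mu * s) * r2 <= r1.
Proof.
move=> /andP[s0 ss]; have mu0 := ltW (gs_mu0 GS); have r20 := r2_gt0.
rewrite ler_peMl ?(ltW r20)//=; last first.
  by apply: le_trans (expR_ge1Dx _); rewrite lerDl mulr_ge0.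
by rewrite -exp_sweep ler_pM2r// ler_expR ler_wpM2l.
Qed.

Lemma arc_rho s : ax s ^+ 2 + ay s ^+ 2 = (expR (mu * s) * r2) ^+ 2.
Proof.
rewrite ax_polar ay_polar sqrrN !exprMn -mulrDr [X in _ * X]addrC.
by rewrite cos2Dsin2 mulr1.
Qed.

Lemma arc_rho_itv s : 0 <= s <= sweep ->
  radius2 (f := f) (eps := eps) (-1) l <= ax s ^+ 2 + ay s ^+ 2 <= radius2 (f := f) (eps := eps) 1 l.
Proof.
move=> hs; rewrite arc_rho; have /andP[h1 h2] := radius_itv hs; have r20 := r2_gt0.
have q1 : 0 <= radius2 (f := f) (eps := eps) 1 l by apply: ltW; apply: lt_trans (radius2_gt1 FG _ hl).
have q2 : 0 <= radius2 (f := f) (eps := eps) (-1) l by apply: ltW; apply: lt_trans (radius2_gt1 FG _ hl).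
apply/andP; split.
  apply: le_trans (_ : r2 ^+ 2 <= _); first by rewrite sqr_sqrtr.
  by apply: lerXn2r; rewrite ?nnegrE; lra.
apply: le_trans (_ : _ <= r1 ^+ 2) _; last by rewrite sqr_sqrtr.
by apply: lerXn2r; rewrite ?nnegrE; lra.
Qed.

Lemma arc_bound s : 0 <= s <= sweep -> `|ax s| < M /\ `|ay s - 1| < M /\ `|ay s| < M.
Proof.
move=> /arc_rho_itv/andP[_ h]; have := le_trans h (radius2_le FG s1 hl).
have := fg_lbM FG; have := fg_M FG.
set x := ax s; set y := ay s => M4 lbM H.
have X : `|x| ^+ 2 <= lb + 2 by rewrite real_normK ?num_real//; have := sqr_ge0 y; lra.
have Y : `|y| ^+ 2 <= lb + 2 by rewrite real_normK ?num_real//; have := sqr_ge0 x; lra.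
have X0 := normr_ge0 x; have Y0 := normr_ge0 y.
have Y1 : `|y| < M - 1.
  by rewrite ltNge; apply/negP => hh; nra.
split; first by rewrite ltNge; apply/negP => hh; nra.
split; last by lra.
by apply: le_lt_trans (ler_normB _ _) _; rewrite normr1; lra.
Qed.

(** While the arc is within a right angle of the upward vertical, [slope_sign] applies. At the start
    the radius and the sine both grow, so the abscissa stays beyond [- c]; near the end the radius
    is at least [r2 >= r1 / 2], so the abscissa is at least [c / 2]. The same ratio of radii keeps
    the heights below 3. *)
Lemma arc_slope s (th : R) : th = 1 \/ th = -1 -> 0 < s < sweep ->
  (s + a2 < pi / 2 ->
    ax s + mu * ay s + th * eps * (mu * ax s - ay s) < 0) /\
  (2 * pi - (s + a2) < pi / 2 ->
    0 < ax s + mu * ay s + th * eps * (mu * ax s - ay s)).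
Proof.
move=> thE /andP[s0 ss].
have hs : 0 <= s <= sweep by rewrite !ltW.
have /andP[h1 h2] := radius_itv hs; have r20 := r2_gt0.
have [X [_ _]] := arc_bound hs.
have X1 : `|mu * ax s| <= 1.
  rewrite normrM gtr0_norm ?(gs_mu0 GS)//; apply: le_trans (gs_muM GS).
  by rewrite ler_pM2l ?(gs_mu0 GS)// ltW.
have [N Ps] := slope_sign (ay s) thE (gs_eps0 GS) (gs_eps GS) (gs_mu0 GS) (gs_mu GS) (gs_c GS) X1.
have /andP[t1a t1b] := tilt_itv FG s1 hl; have /andP[t2a t2b] := tilt_itv FG s2 hl.
have [P1 P2] := polar_height FG s1 hl; have [Q1 Q2] := polar_height FG s2 hl.
have E0 : 0 <= expR (mu * s) * r2 by apply: le_trans h1; exact: ltW.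
split=> hth.
  have a2s : a2 <= s + a2 by rewrite lerDr ltW.
  have [S Cc C0] := sin_cos_mono (ltW t2a) a2s (ltW hth).
  have sa0 : 0 <= sin a2 by apply: sin_ge0_pi; apply: pihalf_itv => //; exact: ltW.
  apply: N.
    rewrite ax_polar lerN2; apply: le_trans (hor_ge FG s2 hl) _; rewrite Q1.
    by apply: ler_pM => //; exact: ltW.
  rewrite ay_polar mulr_ge0 //=.
  apply: le_trans (_ : (2 * r2) * cos a2 <= _).
    by apply: ler_pM => //; exact: le_trans r1_le.
  by rewrite -mulrA -Q2; exact: height2.
have ep : s + a2 = pi *+ 2 - (2 * pi - (s + a2)) by rewrite mulr2n; ring.
have wa : a1 <= 2 * pi - (s + a2) by move: ss; rewrite /sweep; lra.
set w := 2 * pi - (s + a2) in hth ep wa.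
have [S Cc C0] := sin_cos_mono (ltW t1a) wa (ltW hth).
have sa0 : 0 <= sin a1 by apply: sin_ge0_pi; apply: pihalf_itv => //; exact: ltW.
apply: Ps.
  rewrite ax_polar ep sinB cos2pi sin2pi mul0r mul1r sub0r mulrN opprK.
  apply: le_trans (_ : r1 / 2 * sin a1 <= _).
    by rewrite mulrAC ler_pM2r ?invr_gt0// -P1 (hor_ge FG s1 hl).
  apply: ler_pM => //.
  by rewrite ler_pdivrMr// mulrC; apply: le_trans r1_le _; rewrite ler_pM2l.
rewrite ay_polar ep cosB cos2pi sin2pi mul0r mul1r addr0 mulr_ge0 //=.
apply: le_trans (_ : r1 * cos a1 <= _); first by apply: ler_pM.
rewrite -P2; have := height2 s1; set h := height _ _; lra.
Qed.

Lemma ax0 : ax 0 = - x2.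
Proof. by rewrite /ax /spiralx mulr0 expR0 cos0 sin0; ring. Qed.

Lemma ay0 : ay 0 = y2 + 1.
Proof. by rewrite /ay /spiraly mulr0 expR0 cos0 sin0; ring. Qed.

Lemma ax_sweep : ax sweep = x1.
Proof.
have [P1 _] := polar_height FG s1 hl.
rewrite ax_polar exp_sweep P1 /sweep.
have -> : 2 * pi - a2 - a1 + a2 = pi *+ 2 - a1 by rewrite mulr2n; ring.
by rewrite sinB cos2pi sin2pi; ring.
Qed.

Lemma ay_sweep : ay sweep = y1 + 1.
Proof.
have [_ P2] := polar_height FG s1 hl.
rewrite ay_polar exp_sweep P2 /sweep.
have -> : 2 * pi - a2 - a1 + a2 = pi *+ 2 - a1 by rewrite mulr2n; ring.
by rewrite cosB cos2pi sin2pi; ring.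
Qed.

Lemma slope_mvt (th a b : R) : a < b -> exists2 s, a < s < b &
  (ay b + th * eps * ax b) - (ay a + th * eps * ax a) =
  (ax s + mu * ay s + th * eps * (mu * ax s - ay s)) * (b - a).
Proof.
move=> ab; pose F : R -> R := ay + (th * eps) \*: ax.
have D t : is_derive t (1 : R) F (ax t + mu * ay t + th * eps * (mu * ax t - ay t)).
  exact: (@is_deriveD _ _ _ _ _ t 1 _ _ (is_derive_spiraly _ _ _ t)
    (@is_deriveZ _ _ _ _ (th * eps) t 1 _ (is_derive_spiralx _ _ _ t))).
have [s] := MVT ab (fun t _ => D t) (continuous_subspaceT (derive_continuous D)).
by rewrite in_itv /= => hs E; exists s.
Qed.

(** Near either end both tilted heights [y + eps * x] and [y - eps * x] are strictly monotone, which
    beats the Lipschitz bound of the graph. In the middle range the arc is at or below the height of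
    the focus, far under the graph. *)
Lemma arc_below s : 0 < s < sweep -> ay s - 1 < f (ax s).
Proof.
move=> /andP[s0 ss]; have hs : 0 <= s <= sweep by rewrite !ltW.
have s00 := ltW sweep_gt0; have sw : 0 <= sweep <= sweep by rewrite s00 lexx.
have sz : (0 : R) <= 0 <= sweep by rewrite s00 lexx.
have [X _] := arc_bound hs; have [X' _] := arc_bound sw; have [X0 _] := arc_bound sz.
have e32 := gs_eps GS; have c1 := gs_c1 GS.
have r20 := r2_gt0; have /andP[h1 _] := radius_itv hs.
have t1 := tilt_itv FG s1 hl; have t2 := tilt_itv FG s2 hl.
have [u1 u2] := heightP FG s1 hl; have [v1 v2] := heightP FG s2 hl.
have [A|A] := ltP (s + a2) (pi / 2).
  have sl (th : R) : th = 1 \/ th = -1 -> (ay s + th * eps * ax s) - (ay 0 + th * eps * ax 0) < 0.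
    move=> thE; have [w /andP[w1 w2] ->] := slope_mvt th s0.
    rewrite pmulr_llt0; last by lra.
    by apply: (arc_slope thE _).1; lra.
  have F1 := sl 1 s1; have F2 := sl (-1) s2.
  have := fg_lip FG X X0; rewrite ay0 in F1 F2.
  have -> : f (ax 0) = y2 by rewrite ax0 [RHS]v2 mulN1r.
  have e0 := gs_eps0 GS.
  rewrite ler_norml => /andP[G _].
  have : eps * `|ax s - ax 0| = eps * (ax s - ax 0) \/ eps * `|ax s - ax 0| = - (eps * (ax s - ax 0)).
    by have [_|_] := ger0P (ax s - ax 0); [left|right; rewrite mulrN].
  by case=> G2; rewrite G2 in G; lra.
have [B|B] := ltP (2 * pi - (s + a2)) (pi / 2).
  have sl (th : R) : th = 1 \/ th = -1 -> 0 < (ay sweep + th * eps * ax sweep) - (ay s + th * eps * ax s).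
    move=> thE; have [w /andP[w1 w2] ->] := slope_mvt th ss.
    rewrite pmulr_lgt0; last by lra.
    by apply: (arc_slope thE _).2; lra.
  have F1 := sl 1 s1; have F2 := sl (-1) s2.
  have := fg_lip FG X X'; rewrite ay_sweep in F1 F2.
  have -> : f (ax sweep) = y1 by rewrite ax_sweep [RHS]u2 mul1r.
  rewrite ler_norml => /andP[G _].
  have : eps * `|ax s - ax sweep| = eps * (ax s - ax sweep) \/ eps * `|ax s - ax sweep| = - (eps * (ax s - ax sweep)).
    by have [_|_] := ger0P (ax s - ax sweep); [left|right; rewrite mulrN].
  by case=> G2; rewrite G2 in G; lra.
have : cos (s + a2) <= 0.
  have -> : s + a2 = (s + a2 - pi) + pi by ring.
  by rewrite cosDpi oppr_le0 cos_ge0_pihalf//; lra.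
have := fg_le FG X; rewrite ler_norml => /andP[f1 _] C.
have : ay s <= 0 by rewrite ay_polar mulr_ge0_le0//; lra.
lra.
Qed.

(** Each half of the parabola is compared with the endpoint on its own side: there the parabola has
    mean slope at least [c / 2] in absolute value, more than the slope [eps] of the graph. *)
Lemma arcX_above x : - x2 <= x <= x1 ->
  f x <= (l - x ^+ 2) / 2 /\ (- x2 < x < x1 -> f x < (l - x ^+ 2) / 2).
Proof.
move=> /andP[xa xb]; have c0 := gs_c GS; have e32 := gs_eps GS; have e0 := gs_eps0 GS.
have C1 := hor_ge FG s1 hl; have C2 := hor_ge FG s2 hl.
have M1 := hor_lt FG s1 hl; have M2 := hor_lt FG s2 hl.
have [_ u2] := heightP FG s1 hl; have [_ v2] := heightP FG s2 hl.
have S1 := hor_sqr FG s1 hl; have S2 := hor_sqr FG s2 hl.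
have XM : `|x| < M by rewrite ltr_norml; lra.
have X1M : `|x1| < M by rewrite ltr_norml; lra.
have X2M : `|- x2| < M by rewrite ltr_norml; lra.
have [x0|x0] := leP 0 x.
  have := fg_lip FG XM X1M; have -> : f x1 = y1 by rewrite [RHS]u2 mul1r.
  rewrite (ler0_norm (_ : x - x1 <= 0)) ?opprB ?subr_le0//.
  move=> /(le_trans (ler_norm _))/(parabola_gap S1) => A.
  have K : 0 < (x1 + x) / 2 - eps by move: x0 C1 e32 c0; lra.
  split=> [|/andP[_ xx]]; [rewrite -subr_ge0; apply: le_trans A | rewrite -subr_gt0; apply: lt_le_trans A].
    by apply: mulr_ge0; [rewrite subr_ge0 | exact: ltW].
  by apply: mulr_gt0 => //; rewrite subr_gt0.
have := fg_lip FG XM X2M; have -> : f (- x2) = y2 by rewrite [RHS]v2 mulN1r.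
rewrite opprK (ger0_norm (_ : 0 <= x + x2)); last by rewrite -lerBlDr sub0r.
have -> : x + x2 = x2 - - x by rewrite opprK addrC.
move=> /(le_trans (ler_norm _))/(parabola_gap S2); rewrite sqrrN => A.
have K : 0 < (x2 + - x) / 2 - eps by move: x0 C2 e32 c0; lra.
split=> [|/andP[xx _]]; [rewrite -subr_ge0; apply: le_trans A | rewrite -subr_gt0; apply: lt_le_trans A].
  by apply: mulr_ge0; [rewrite opprK -lerBlDl sub0r | exact: ltW].
by apply: mulr_gt0 => //; rewrite opprK -ltrBlDl sub0r.
Qed.

End Arc.

Section Periodic.
Context {R : realType} (T : R) (T0 : 0 < T).

Definition wind t : int := Num.floor (t / T).
Definition frac t : R := t - T * (wind t)%:~R.

Lemma frac_itv t : 0 <= frac t < T.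
Proof.
have /andP[] := floor_itv (t / T); rewrite ler_pdivlMr// ltr_pdivrMr// intrD /frac /wind => h1 h2.
by rewrite subr_ge0 [T * _]mulrC h1 /=; move: h2; lra.
Qed.

Lemma wind_eq t (m : int) : 0 <= t - T * m%:~R < T -> wind t = m.
Proof.
move=> h; apply: floor_def; rewrite ler_pdivlMr// ltr_pdivrMr// intrD.
by move: h; lra.
Qed.

Lemma frac_eq t (m : int) : 0 <= t - T * m%:~R < T -> frac t = t - T * m%:~R.
Proof. by move=> /wind_eq E; rewrite /frac E. Qed.

Lemma frac_id t : 0 <= t < T -> frac t = t.
Proof. by move=> h; rewrite (@frac_eq _ 0) ?mulr0 ?subr0. Qed.

Lemma fracDT t : frac (t + T) = frac t.
Proof.
rewrite (@frac_eq (t + T) (wind t + 1)) /frac; first by rewrite intrD; ring.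
by have := frac_itv t; rewrite /frac intrD; lra.
Qed.

(** If the two times belong to different periods, the increment is split at the common value
    [h 0 = h T]. *)
Lemma periodic_lip (h : R -> 'cV[R]_2) (K : R) : h 0 = h T ->
  (forall s t, 0 <= s -> s <= t -> t <= T -> `|h t - h s| <= K * (t - s)) ->
  forall s t, s <= t -> `|h (frac t) - h (frac s)| <= K * (t - s).
Proof.
move=> hT hL s t st; have fs := frac_itv s; have ft := frac_itv t.
have [E|E] := eqVneq (wind s) (wind t).
  have D : frac t - frac s = t - s by rewrite /frac E; ring.
  by rewrite -D; apply: hL; lra.
have lt1 : wind s < wind t by rewrite lt_neqAle E le_floor// ler_pM2r ?invr_gt0.
have {}lt1 : (wind s)%:~R + 1 <= (wind t)%:~R :> R by move: lt1; rewrite -lezD1 -(ler_int R) intrD.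
have K0 : 0 <= K.
  have := hL 0 T (lexx _) (ltW T0) (lexx _); rewrite hT subrr normr0 subr0.
  by rewrite pmulr_lge0.
have -> : h (frac t) - h (frac s) = (h (frac t) - h 0) + (h T - h (frac s)) by rewrite hT subrKA.
apply: le_trans (ler_normD _ _) _.
have H1 := hL 0 (frac t) (lexx _) _ _; have H2 := hL (frac s) T _ _ (lexx _).
apply: le_trans (lerD (H1 _ _) (H2 _ _)) _; rewrite ?subr0; try lra.
rewrite -mulrDr ler_wpM2l// /frac; nra.
Qed.

End Periodic.

Section LipschitzZones.
Context {R : realType}.

Lemma lip_locally_abs_continuous (g : R -> 'cV[R]_2) (K : R) :
  (forall s t, s <= t -> `|g t - g s| <= K * (t - s)) -> locally_abs_continuous g.
Proof.
move=> H a b e e0; have K1 : 0 < `|K| + 1 by rewrite ltr_wpDl.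
exists (e / (`|K| + 1)); first exact: divr_gt0.
move=> m s t st _; rewrite ltr_pdivlMr// => S.
apply: le_lt_trans S; rewrite mulr_suml; apply: ler_sum => i _.
have [_ [sti _]] := st i; apply: le_trans (H _ _ sti) _.
rewrite mulrC ler_wpM2l ?subr_ge0//; have := ler_norm K; lra.
Qed.

Lemma mvt_lip (h h' : R -> R) (K a b : R) : (forall t, is_derive t (1 : R) h (h' t)) -> a <= b ->
  (forall t, a <= t <= b -> `|h' t| <= K) -> `|h b - h a| <= K * (b - a).
Proof.
move=> D ab H; have D' x : x \in `]a, b[ -> is_derive x 1 h (h' x) by [].
have [s] := MVT_segment ab D' (continuous_subspaceT (derive_continuous D)).
rewrite in_itv/= => hs ->; rewrite normrM (ger0_norm (_ : 0 <= b - a)) ?subr_ge0//.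
by rewrite ler_wpM2r ?subr_ge0// H.
Qed.

Lemma lip_cat (h : R -> 'cV[R]_2) (K a b c : R) :
  (forall s t, a <= s -> s <= t -> t <= b -> `|h t - h s| <= K * (t - s)) ->
  (forall s t, b <= s -> s <= t -> t <= c -> `|h t - h s| <= K * (t - s)) ->
  forall s t, a <= s -> s <= t -> t <= c -> `|h t - h s| <= K * (t - s).
Proof.
move=> H1 H2 s t as_ st tc.
have [tb|bt] := leP t b; first exact: H1.
have [bs|sb] := leP b s; first exact: H2.
have -> : h t - h s = (h t - h b) + (h b - h s) by rewrite subrKA.
apply: le_trans (ler_normD _ _) _.
have := H1 s b as_ (ltW sb) (lexx _); have := H2 b t (lexx _) (ltW bt) tc; lra.
Qed.

End LipschitzZones.

Section LoopSpeed.
Context {R : realType} {n : nat} {Z : pwl_system R n} {f : R -> R} {mu c M eps la lb : R}.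
Context (GS : graph_system Z f mu c M eps) (FG : flat_graph f c M eps la lb).
Context (l : R) (hl : la <= l <= lb).
Context (psi_eq : psiR (f := f) (mu := mu) (eps := eps) l = psiL (f := f) (mu := mu) (eps := eps) l).
Implicit Types (g : R -> 'cV[R]_2) (z v : 'cV[R]_2).

Local Notation W := (work_region (M := M) (eps := eps) la lb).
Local Notation x1 := (@hor R f eps 1 l).
Local Notation x2 := (@hor R f eps (-1) l).
Local Notation y1 := (@height R f eps 1 l).
Local Notation y2 := (@height R f eps (-1) l).
Local Notation tX := (timeX (f := f) (eps := eps) l).
Local Notation T := (period (f := f) (eps := eps) l).
Local Notation sw := (sweep (f := f) (eps := eps) l).
Local Notation ax := (ax (f := f) (mu := mu) (eps := eps) l).
Local Notation ay := (ay (f := f) (mu := mu) (eps := eps) l).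
Local Notation lp := (loop (f := f) (mu := mu) (eps := eps) l).

Let s1 : (1 : R) = 1 \/ (1 : R) = -1. Proof. by left. Qed.
Let s2 : (-1 : R) = 1 \/ (-1 : R) = -1. Proof. by right. Qed.

Lemma periodE : T = tX + sw. Proof. by []. Qed.

Lemma tX_gt0 : 0 < tX.
Proof.
have := hor_ge FG s1 hl; have := hor_ge FG s2 hl; have := fg_c FG.
by rewrite /timeX; lra.
Qed.

Lemma period_gt : tX < T.
Proof. by rewrite periodE ltrDl (sweep_gt0 FG hl). Qed.

Lemma loopX t : t <= tX -> lp t = vec2 (x1 - t) ((l - (x1 - t) ^+ 2) / 2).
Proof. by rewrite /loop => ->. Qed.

Lemma loopY t : tX <= t -> lp t = vec2 (ax (t - tX)) (ay (t - tX) - 1).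
Proof.
rewrite le_eqVlt => /predU1P[<-|Xt]; last by rewrite /loop leNgt Xt.
rewrite loopX// subrr ax0 ay0.
have -> : x1 - tX = - x2 by rewrite /timeX; ring.
by rewrite sqrrN (hor_sqr FG s2 hl); congr vec2; field.
Qed.

Lemma loop0 : lp 0 = @graph_pt R f eps 1 l.
Proof.
rewrite loopX ?(ltW tX_gt0)// subr0 (hor_sqr FG s1 hl) /graph_pt mul1r.
by congr vec2; field.
Qed.

Lemma loop_closed : lp 0 = lp T.
Proof.
rewrite loop0 loopY ?(ltW period_gt)//.
have -> : T - tX = sw by rewrite periodE; ring.
by rewrite (ax_sweep FG hl psi_eq) (ay_sweep FG hl psi_eq) addrK /graph_pt mul1r.
Qed.

Lemma is_derive_back x t : is_derive t (1 : R) (fun s => x - s) (-1).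
Proof.
have := @is_deriveB _ _ _ _ _ t 1 _ _ (is_derive_cst x t 1) (@is_derive_id _ _ t 1).
by rewrite sub0r.
Qed.

Lemma is_derive_parabola x t : is_derive t (1 : R) (fun s => (l - (x - s) ^+ 2) / 2) (x - t).
Proof.
have D := is_derive_back x t.
have := @is_deriveZ _ _ _ _ (2^-1) t 1 _ (@is_deriveB _ _ _ _ _ t 1 _ _ (is_derive_cst l t 1)
  (@is_deriveM _ _ _ _ t 1 _ _ D D)).
set F := (F in is_derive _ _ F _); have -> : F = fun s => (l - (x - s) ^+ 2) / 2.
  by apply/funext => s; rewrite -[LHS]/(2^-1 * (l - (x - s) * (x - s))) expr2 mulrC.
by move/is_derive_eq; apply; rewrite /GRing.scale /=; field.
Qed.

Lemma is_derive_shift (h : R -> R) (d m t : R) : is_derive (t - m) (1 : R) h d ->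
  is_derive t (1 : R) (fun s => h (s - m)) d.
Proof.
move=> D.
have := @is_deriveB _ _ _ _ _ t 1 _ _ (@is_derive_id _ _ t 1) (is_derive_cst m t 1).
rewrite subr0 => Dm.
by have := @is_derive1_comp _ h (fun s => s - m) t _ _ D Dm; rewrite mulr1.
Qed.

Lemma loop_lip s t : 0 <= s -> s <= t -> t <= T -> `|lp t - lp s| <= (2 * (M + 1)) * (t - s).
Proof.
apply: (@lip_cat _ lp (2 * (M + 1)) 0 tX T) => {}s {}t.
  move=> s0 st tt; rewrite !loopX//; last exact: le_trans tt.
  apply: le_trans (norm_vec2 _) _; rewrite xcD ycD xcN ycN !xc_vec2 !yc_vec2.
  have B w : s <= w <= t -> `|x1 - w| <= M.
    move=> hw; have := hor_lt FG s1 hl; have := hor_lt FG s2 hl; have := hor_ge FG s1 hl.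
    have := hor_ge FG s2 hl; have := fg_c FG; move: tt; rewrite /timeX ler_norml; lra.
  have -> : 2 * (M + 1) * (t - s) = (M + 1) * (t - s) + (M + 1) * (t - s) by ring.
  apply: lerD.
    apply: (mvt_lip (is_derive_back x1)) => // w _.
    by rewrite normrN normr1; have := fg_M FG; lra.
  by apply: (mvt_lip (is_derive_parabola x1)) => // w /B; lra.
move=> s0 st tt; rewrite !loopY//; last exact: le_trans st.
apply: le_trans (norm_vec2 _) _; rewrite xcD ycD xcN ycN !xc_vec2 !yc_vec2.
have -> : ay (t - tX) - 1 - (ay (s - tX) - 1) = ay (t - tX) - ay (s - tX) by ring.
have M4 := fg_M FG; have mu0 := gs_mu0 GS; have muM := gs_muM GS.
have B w : s - tX <= w <= t - tX -> `|ax w| < M /\ `|ay w| < M.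
  move=> hw; have [] := arc_bound (s := w) GS FG hl psi_eq; last by move=> ? [].
  by move: tt; rewrite periodE; lra.
have muB (x : R) : `|x| < M -> `|mu * x| <= 1.
  by move=> hx; rewrite normrM gtr0_norm//; apply: le_trans muM; rewrite ler_pM2l// ltW.
have ts : s - tX <= t - tX by lra.
have -> : 2 * (M + 1) * (t - s) = (M + 1) * (t - tX - (s - tX)) + (M + 1) * (t - tX - (s - tX)) by ring.
apply: lerD.
  apply: (mvt_lip (is_derive_spiralx _ _ _)) => // w /B[hx hy].
  by apply: le_trans (ler_normB _ _) _; have := muB _ hx; lra.
apply: (mvt_lip (is_derive_spiraly _ _ _)) => // w /B[hx hy].
by apply: le_trans (ler_normD _ _) _; have := muB _ hy; lra.
Qed.

Lemma loop_zoneX t : 0 < t < tX -> zoneX Z (lp t).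
Proof.
move=> /andP[t0 tt]; rewrite loopX ?(ltW tt)//.
have := arcX_above GS FG hl (x := x1 - t).
have := hor_lt FG s1 hl; have := hor_lt FG s2 hl; have := hor_ge FG s1 hl.
have := hor_ge FG s2 hl; have := fg_c FG; move: tt; rewrite /timeX => tt c0 h1 h2 h3 h4 [|_ K]; first by lra.
have XM : `|x1 - t| < M by rewrite ltr_norml; lra.
have fl := K _; have lb4 := fg_lbM FG; have := gs_le GS XM; rewrite ler_norml => /andP[f1 _].
have e32 := fg_eps FG; have c1 := fg_c1 FG.
apply/(gs_X GS); rewrite ?xc_vec2 ?yc_vec2//; last by apply: fl; lra.
rewrite ltr_norml; apply/andP; split; first by have := fl _; lra.
have := sqr_ge0 (x1 - t); have := fg_M FG; case/andP: hl; lra.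
Qed.

Lemma loop_zoneY t : tX < t < T -> zoneY Z (lp t).
Proof.
move=> /andP[t0 tt]; rewrite loopY ?(ltW t0)//.
have h1 : 0 < t - tX < sw by move: tt; rewrite periodE; lra.
have h2 : 0 <= t - tX <= sw by case/andP: h1 => ? ?; rewrite !ltW.
have [? [? _]] := arc_bound GS FG hl psi_eq h2.
by apply/(gs_Y GS); rewrite ?xc_vec2 ?yc_vec2//; exact: (arc_below GS FG hl psi_eq h1).
Qed.

End LoopSpeed.

Lemma near_itv (R : realType) (a b t : R) (P : R -> Prop) : a < t < b ->
  (forall u, a < u < b -> P u) -> \forall u \near t, P u.
Proof.
move=> /andP[at_ tb] H; apply/nbhs_ballP; exists (Num.min (t - a) (b - t)) => /=.
  by rewrite lt_min !subr_gt0 at_.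
move=> u; rewrite /ball /= lt_min !ltr_norml => h; apply: H.
by lra.
Qed.

Section LoopTrajectory.
Context {R : realType} {n : nat} {Z : pwl_system R n} {f : R -> R} {mu c M eps la lb : R}.
Context (GS : graph_system Z f mu c M eps) (FG : flat_graph f c M eps la lb).
Context (l : R) (hl : la + eps ^+ 2 < l < lb - eps ^+ 2).
Context (psi_eq : psiR (f := f) (mu := mu) (eps := eps) l = psiL (f := f) (mu := mu) (eps := eps) l).
Implicit Types (g : R -> 'cV[R]_2) (z v : 'cV[R]_2).

Local Notation W := (work_region (M := M) (eps := eps) la lb).
Local Notation x1 := (@hor R f eps 1 l).
Local Notation x2 := (@hor R f eps (-1) l).
Local Notation tX := (timeX (f := f) (eps := eps) l).
Local Notation T := (period (f := f) (eps := eps) l).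
Local Notation sw := (sweep (f := f) (eps := eps) l).
Local Notation ax := (ax (f := f) (mu := mu) (eps := eps) l).
Local Notation ay := (ay (f := f) (mu := mu) (eps := eps) l).
Local Notation lp := (loop (f := f) (mu := mu) (eps := eps) l).

Let s1 : (1 : R) = 1 \/ (1 : R) = -1. Proof. by left. Qed.
Let s2 : (-1 : R) = 1 \/ (-1 : R) = -1. Proof. by right. Qed.

Let hlw : la <= l <= lb.
Proof. by have := sqr_ge0 eps; case/andP: hl => h1 h2 h3; apply/andP; split; lra. Qed.

Let tX0 := tX_gt0 FG hlw.
Let TX := period_gt FG hlw.
Let T0 : 0 < T := lt_trans tX0 TX.

Definition orbit_fun t := lp (frac T t).

Lemma filippov_field z (b : bool) : (if b then zoneX Z z else zoneY Z z) ->
  filippov Z z (if b then fieldX Z z else fieldY Z z).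
Proof.
have oX := gs_oX GS; have oY := gs_oY GS; have dXY := gs_dXY GS.
case: b => Hz; [exists 1 | exists 0].
  split; rewrite ?ler01 ?lexx// ?scale1r ?subrr ?scale0r ?addr0// => H.
  by case: H; exact: subset_closure.
split; rewrite ?ler01 ?lexx// ?scale0r ?subr0 ?scale1r ?add0r// => H.
by case: H; exact: subset_closure.
Qed.

Lemma orbit_fun_derive t : 0 < frac T t -> frac T t != tX ->
  exists2 v, filippov Z (orbit_fun t) v & is_derive t (1 : R) orbit_fun v.
Proof.
move=> f0 fX; have /andP[_ fT] := frac_itv T0 t.
set m := T * (wind T t)%:~R; have fE : frac T t = t - m by [].
rewrite fE in f0 fX fT.
case: (ltgtP (t - m) tX) fX => // h _.
  exists (fieldX Z (orbit_fun t)).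
    by apply: (@filippov_field _ true); apply: (loop_zoneX GS FG hlw); rewrite fE f0.
  pose G u : 'cV[R]_2 := vec2 (x1 - (u - m)) ((l - (x1 - (u - m)) ^+ 2) / 2).
  have GE u : m < u < m + tX -> G u = orbit_fun u.
    move=> hu; rewrite /orbit_fun; have := @frac_eq _ _ T0 u (wind T t).
    rewrite -/m => ->; last by move: hu TX; lra.
    by rewrite loopX//; lra.
  have ht : m < t < m + tX by lra.
  rewrite (gs_fX GS) -(GE t ht) xc_vec2.
  apply: (near_eq_is_derive (near_itv ht GE)); apply/is_derive_vec2.
  rewrite xc_vec2 yc_vec2; split.
    rewrite (_ : _ \o _ = fun u => x1 - (u - m)); last by apply/funext => u /=; rewrite xc_vec2.
    by apply: (@is_derive_shift _ (fun s => x1 - s)); exact: is_derive_back.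
  rewrite (_ : _ \o _ = fun u => (l - (x1 - (u - m)) ^+ 2) / 2); last by apply/funext => u /=; rewrite yc_vec2.
  by apply: (@is_derive_shift _ (fun s => (l - (x1 - s) ^+ 2) / 2)); exact: is_derive_parabola.
exists (fieldY Z (orbit_fun t)).
  by apply: (@filippov_field _ false); apply: (loop_zoneY GS FG hlw psi_eq); rewrite fE h.
pose m' := m + tX.
pose G u : 'cV[R]_2 := vec2 (ax (u - m')) (ay (u - m') - 1).
have GE u : m' < u < m + T -> G u = orbit_fun u.
  move=> hu; rewrite /orbit_fun; have := @frac_eq _ _ T0 u (wind T t).
  rewrite -/m => ->; last by move: hu tX0; rewrite /m'; lra.
  rewrite (loopY FG hlw)//; last by move: hu; rewrite /m'; lra.
  by rewrite /G /m' opprD addrA.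
have ht : m' < t < m + T by rewrite /m'; lra.
rewrite (gs_fY GS) -(GE t ht) xc_vec2 yc_vec2 subrK.
apply: (near_eq_is_derive (near_itv ht GE)); apply/is_derive_vec2.
rewrite xc_vec2 yc_vec2; split.
  rewrite (_ : _ \o _ = fun u => ax (u - m')); last by apply/funext => u /=; rewrite xc_vec2.
  by apply: is_derive_shift; exact: is_derive_spiralx.
rewrite (_ : _ \o _ = fun u => ay (u - m') - 1); last by apply/funext => u /=; rewrite yc_vec2.
apply: (@is_derive_shift _ (fun s => ay s - 1)).
have := @is_deriveB _ _ _ _ _ (t - m') 1 _ _ (is_derive_spiraly mu (- x2) (height (f := f) (eps := eps) (-1) l + 1) (t - m')) (is_derive_cst (1 : R) (t - m') 1).
by rewrite subr0.
Qed.

Lemma orbit_fun_trajectory : trajectory Z orbit_fun.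
Proof.
split.
  apply: (@lip_locally_abs_continuous _ _ (2 * (M + 1))).
  apply: (periodic_lip T0 (h := lp)); first exact: (loop_closed FG hlw psi_eq).
  exact: (loop_lip GS FG hlw psi_eq).
(* The velocity may be undefined at the junctions of the arcs, which recur periodically and are
   therefore countably many. *)
pose N := range (fun p : int * bool => T * p.1%:~R + (if p.2 then tX else 0)).
have cN : countable N by apply: (card_le_trans (card_image_le _ _)); exact: countableP.
exists N; split; first by apply: countable_measurable => // t; exact: measurable_set1.
  exact: countable_lebesgue_measure0.
move=> t /= nt; apply: contrapT => nN; apply: nt; apply: orbit_fun_derive.
  have /andP[+ _] := frac_itv T0 t; rewrite le_eqVlt => /predU1P[E|//].
  by case: nN; exists (wind T t, false) => //=; move: E; rewrite /frac addr0; lra.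
apply/eqP => E; case: nN; exists (wind T t, true) => //=.
by move: E; rewrite /frac; lra.
Qed.

(** The upper arc lies on or above the graph and the lower arc strictly below it. Along the first
    the abscissa is strictly decreasing, along the second the distance to the focus is strictly
    increasing. *)
Lemma orbit_fun_inj : {in `[0, T[ &, injective orbit_fun}.
Proof.
move=> s t; rewrite !in_itv/= => hs ht; rewrite /orbit_fun !frac_id//.
have side w : 0 <= w < T -> (w <= tX -> f (xc (lp w)) <= yc (lp w)) /\
   (tX < w -> yc (lp w) < f (xc (lp w))).
  move=> /andP[w0 wT]; split=> hw.
    rewrite loopX// xc_vec2 yc_vec2; apply: (arcX_above GS FG hlw _).1.
    by move: hw; rewrite /timeX; lra.
  rewrite (loopY FG hlw) ?(ltW hw)// xc_vec2 yc_vec2; apply: (arc_below GS FG hlw psi_eq).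
  by move: wT hw; rewrite periodE; lra.
have [sa sb] := side _ hs; have [ta tb] := side _ ht.
case: (leP s tX) => [hsX|hsX]; case: (leP t tX) => [htX|htX] E.
- by move: E; rewrite !loopX// => /(congr1 xc); rewrite !xc_vec2; lra.
- by have := sa hsX; rewrite E leNgt tb.
- by have := ta htX; rewrite -E leNgt sb.
have : (ax (s - tX)) ^+ 2 + (ay (s - tX)) ^+ 2 = (ax (t - tX)) ^+ 2 + (ay (t - tX)) ^+ 2.
  move: E; rewrite !(loopY FG hlw) ?ltW// => E.
  have := congr1 xc E; rewrite !xc_vec2 => ->.
  by have := congr1 yc E; rewrite !yc_vec2 => /addIr ->.
rewrite !(arc_rho FG hlw) => H.
have r0 := r2_gt0 FG hlw; have mu0 := gs_mu0 GS.
have : expR (mu * (s - tX)) * Num.sqrt (radius2 (f := f) (eps := eps) (-1) l) =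
       expR (mu * (t - tX)) * Num.sqrt (radius2 (f := f) (eps := eps) (-1) l).
  apply/eqP; rewrite -(@eqrXn2 _ 2) ?mulr_ge0 ?expR_ge0 ?sqrtr_ge0//; exact/eqP.
move/(mulIf (lt0r_neq0 r0))/expR_inj/(mulfI (lt0r_neq0 mu0)).
by move/addIr.
Qed.

Lemma loop_set_range : loop_set (f := f) (mu := mu) (eps := eps) l = range orbit_fun.
Proof.
apply/seteqP; split=> [z [t]|z [t _ <-]].
  rewrite /= in_itv/= => /andP[t0]; rewrite le_eqVlt => /predU1P[->|tT] <-.
    by exists 0 => //; rewrite /orbit_fun frac_id ?lexx// (loop_closed FG hlw psi_eq).
  by exists t => //; rewrite /orbit_fun frac_id// t0.
have /andP[h1 h2] := frac_itv T0 t.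
by exists (frac T t) => //=; rewrite in_itv/= h1 ltW.
Qed.

Lemma loop_periodic_orbit : periodic_orbit Z (loop_set (f := f) (mu := mu) (eps := eps) l).
Proof.
exists orbit_fun, T; split => //; [exact: orbit_fun_trajectory | | exact: orbit_fun_inj | exact: loop_set_range].
by move=> t; rewrite /orbit_fun fracDT.
Qed.

(** The label is the squared distance to the focus minus [1 + y^2]. On the lower arc that distance
    stays between its end values [l + 1 + v^2] and [l + 1 + u^2], so in the strip the label moves by
    at most [eps ^+ 2]. Hence the margin required of [l]. *)
Lemma loop_label t : 0 <= t <= T ->
  W (lp t) /\ (`|yc (lp t)| <= eps -> `|label (lp t) - l| <= eps ^+ 2).
Proof.
move=> /andP[t0 tT].
have c0 := fg_c FG; have lb4 := fg_lbM FG; have M4 := fg_M FG.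
have suf z : `|xc z| < M -> `|yc z| < M -> (`|yc z| <= eps -> `|label z - l| <= eps ^+ 2) ->
    W z /\ (`|yc z| <= eps -> `|label z - l| <= eps ^+ 2).
  move=> xM yM H; split => //; split => // -[/H]; rewrite ler_norml => /andP[h1 h2].
  by case/andP: hl => ? ?; case; lra.
have [hX|hX] := leP t tX.
  have xi : - x2 <= x1 - t <= x1 by move: hX; rewrite /timeX; lra.
  have XM : `|x1 - t| < M.
    by have := hor_lt FG s1 hlw; have := hor_lt FG s2 hlw; rewrite ltr_norml; move: xi; lra.
  rewrite loopX//; apply: suf; rewrite /label ?xc_vec2 ?yc_vec2//.
    have [fl _] := arcX_above GS FG hlw xi; have := fg_le FG XM; rewrite ler_norml => /andP[f1 _].
    have e32 := fg_eps FG; have c1 := fg_c1 FG; have := sqr_ge0 (x1 - t).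
    by rewrite ltr_norml; case/andP: hlw; set X := (x1 - t) ^+ 2 in fl *; lra.
  move=> _; rewrite (_ : _ - l = 0) ?normr0 ?sqr_ge0//; set X := (x1 - t) ^+ 2; by field.
have ht : 0 <= t - tX <= sw by move: tT hX; rewrite periodE; lra.
have [B1 [B2 _]] := arc_bound GS FG hlw psi_eq ht.
have /andP[h1 h2] := arc_rho_itv GS FG hlw psi_eq ht.
rewrite (loopY FG hlw) ?(ltW hX)//; apply: suf; rewrite /label ?xc_vec2 ?yc_vec2// => ye.
have e0 := fg_eps0 FG.
have Y2 : (ay (t - tX) - 1) ^+ 2 <= eps ^+ 2 by rewrite -[leLHS]real_normK ?num_real// lerXn2r ?nnegrE.
have := height_le FG s1 hlw; have := height_le FG s2 hlw => E2 E1.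
have U2 : (height (f := f) (eps := eps) 1 l) ^+ 2 <= eps ^+ 2 by rewrite -[leLHS]real_normK ?num_real// lerXn2r ?nnegrE.
have Y0 := sqr_ge0 (ay (t - tX) - 1); have V0 := sqr_ge0 (height (f := f) (eps := eps) (-1) l).
have yE : 2 * (ay (t - tX) - 1) = ay (t - tX) ^+ 2 - (ay (t - tX) - 1) ^+ 2 - 1 by ring.
rewrite ler_norml yE; move: h1 h2; rewrite /radius2.
move: Y2 U2 Y0 V0.
set Y := (ay (t - tX) - 1) ^+ 2; set U := height (f := f) (eps := eps) 1 l ^+ 2; set V := height (f := f) (eps := eps) (-1) l ^+ 2.
set a := ax _ ^+ 2; set b := ay _ ^+ 2; set e2 := eps ^+ 2; lra.
Qed.

Lemma loop_set_work : loop_set (f := f) (mu := mu) (eps := eps) l `<=` W.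
Proof. by move=> z [t]; rewrite /= in_itv/= => /loop_label[Wt _] <-. Qed.

End LoopTrajectory.

(** * Isolation and counting of the closed orbits *)

Lemma counting_ge (R : realType) (T : choiceType) (A : set T) (N : nat) (F : 'I_N -> T) :
  injective F -> (forall i, A (F i)) -> (N%:R%:E <= counting A :> \bar R)%E.
Proof.
move=> inj FA; rewrite /counting; case: ifPn => [|_]; last exact: leey.
move=> /asboolP fA; rewrite lee_fin ler_nat.
have -> : N = #|` [fset F i | i : 'I_N]%fset| by rewrite card_imfset//= size_enum_ord.
apply: fsubset_leq_card; apply/fsubsetP => x /imfsetP[i _ ->].
by rewrite in_fset_set//; apply: mem_set.
Qed.

Section LimitCycles.
Context {R : realType} {n : nat} {Z : pwl_system R n} {f : R -> R} {mu c M eps la lb : R}.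
Context (GS : graph_system Z f mu c M eps) (FG : flat_graph f c M eps la lb).
Context (mu_small : mu * (2 / c + M) * (4 * (lb + 2)) < 1).
Implicit Types (g : R -> 'cV[R]_2) (z v : 'cV[R]_2).

Local Notation W := (work_region (M := M) (eps := eps) la lb).
Local Notation psR := (@psiR R f mu eps).
Local Notation psL := (@psiL R f mu eps).
Local Notation ptR := (@graph_pt R f eps 1).
Local Notation lset := (@loop_set R f mu eps).

Definition cycle_labels := [set l | la < l < lb /\ psR l = psL l].

Let s1 : (1 : R) = 1 \/ (1 : R) = -1. Proof. by left. Qed.
Let s2 : (-1 : R) = 1 \/ (-1 : R) = -1. Proof. by right. Qed.

Lemma label_continuous : continuous (@label R).
Proof.
have cx := @xc_continuous R; have cy := @yc_continuous R.
rewrite (_ : @label R = fun z => xc z * xc z + 2 * yc z); last first.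
  by apply/funext => w; rewrite /label expr2.
move=> z; apply: (@continuousD _ _ _ (fun z => xc z * xc z) (fun z => 2 * yc z)).
  by apply: continuousM; exact: cx.
by apply: continuousM; [exact: cst_continuous | exact: cy].
Qed.

Lemma open_work_region : open W.
Proof.
have cnx : continuous (fun z : 'cV[R]_2 => `|xc z|).
  by move=> z; apply: continuous_comp; [exact: xc_continuous | exact: norm_continuous].
have cny : continuous (fun z : 'cV[R]_2 => `|yc z|).
  by move=> z; apply: continuous_comp; [exact: yc_continuous | exact: norm_continuous].
have oP (h : 'cV[R]_2 -> R) (a : R) : continuous h -> open [set z | h z < a].
  by move=> ch; rewrite (_ : mkset _ = h @^-1` [set x | x < a])//; apply: open_comp => //; exact: open_lt.
have oP' (h : 'cV[R]_2 -> R) (a : R) : continuous h -> open [set z | a < h z].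
  by move=> ch; rewrite (_ : mkset _ = h @^-1` [set x | a < x])//; apply: open_comp => //; exact: open_gt.
rewrite (_ : W = [set z | `|xc z| < M] `&` [set z | `|yc z| < M] `&`
  ([set z | eps < `|yc z|] `|` ([set z | la < label z] `&` [set z | label z < lb]))).
  apply: openI; first by apply: openI; exact: oP.
  by apply: openU; [exact: oP' | apply: openI; [apply: oP'|apply: oP]; exact: label_continuous].
apply/seteqP; split=> z /=.
  move=> [xM yM nz]; split => //; case: (ltP eps `|yc z|) => [|ye]; first by left.
  right; split; rewrite ltNge; apply/negP => H; apply: nz; split => //; [left|right]; exact: H.
move=> [[xM yM] H]; split => // -[ye]; case: H => [|[h1 h2] [|]]; first by rewrite ltNge ye.
  by rewrite leNgt h1.
by rewrite leNgt h2.
Qed.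

(** The open arcs lie in the zones, hence off the graph, and the left junction has negative
    abscissa; only the starting point remains. *)
Lemma loop_set_right l l' : la + eps ^+ 2 < l < lb - eps ^+ 2 -> psR l = psL l ->
  la <= l' <= lb -> lset l (ptR l') -> l' = l.
Proof.
move=> hl El hl'; have hlw : la <= l <= lb.
  by have := sqr_ge0 eps; case/andP: hl => h1 h2 h3; apply/andP; split; lra.
move=> [t]; rewrite /= in_itv/= => /andP[t0 tT] E.
have gr := graph_pt_branch FG s1 hl'; have xl := hor_ge FG s1 hl'; have c0 := fg_c FG.
have lab := label_graph_pt FG s1 hl'.
have [Wt _] := loop_label GS FG hl El (introT andP (conj t0 tT)).
have [xM yM _] := Wt.
have done_ : loop (f := f) (mu := mu) (eps := eps) l t = ptR l -> l' = l.
  by move=> Et; rewrite -lab -E Et (label_graph_pt FG s1 hlw).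
have [tE|tn] := eqVneq t 0.
  by apply: done_; rewrite tE (loop0 FG hlw).
have [tE|tn'] := eqVneq t (period (f := f) (eps := eps) l).
  by apply: done_; rewrite tE -(loop_closed FG hlw El) (loop0 FG hlw).
have t0' : 0 < t by rewrite lt_neqAle eq_sym tn.
have tT' : t < period (f := f) (eps := eps) l by rewrite lt_neqAle tn'.
case: (ltgtP t (timeX (f := f) (eps := eps) l)) => [h|h|h].
- have : zoneX Z (loop (f := f) (mu := mu) (eps := eps) l t) by apply: (loop_zoneX GS FG hlw); rewrite t0'.
  by move/(gs_X GS xM yM); rewrite E gr ltxx.
- have : zoneY Z (loop (f := f) (mu := mu) (eps := eps) l t) by apply: (loop_zoneY GS FG hlw El); rewrite h.
  by move/(gs_Y GS xM yM); rewrite E gr ltxx.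
- have := congr1 xc E; rewrite loopX ?h// !xc_vec2 mul1r /timeX.
  by have := hor_ge FG s2 hlw; lra.
Qed.

Lemma loop_set_inj l l' : la + eps ^+ 2 < l < lb - eps ^+ 2 -> psR l = psL l ->
  la < l' < lb -> lset l = lset l' -> l' = l.
Proof.
move=> hl El /andP[h1 h2] E; have hl' : la <= l' <= lb by rewrite !ltW.
apply: (loop_set_right hl El hl'); rewrite E; exists 0; last exact: (loop0 FG hl').
rewrite /= in_itv/= lexx /=; apply: ltW; apply: lt_trans (period_gt FG hl'); exact: (tX_gt0 FG hl').
Qed.

(** The isolating neighbourhood is the work region without the right points of all other loops;
    every loop contains its own right point. Finiteness of the labels makes the removed set
    closed. *)
Lemma loop_limit_cycle l : finite_set cycle_labels ->
  la + eps ^+ 2 < l < lb - eps ^+ 2 -> psR l = psL l -> limit_cycle Z (lset l).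
Proof.
move=> fin hl El; split; first exact: (loop_periodic_orbit GS FG hl El).
pose P := [set ptR l' | l' in cycle_labels `\ l].
exists (W `&` ~` P); split.
- apply: openI; first exact: open_work_region.
  rewrite openC; apply: compact_closed; first exact: norm_hausdorff.
  by apply: finite_compact; apply: finite_image; apply: sub_finite_set fin => x [].
- move=> z lz; split; first exact: (loop_set_work GS FG hl El).
  move=> [l' [[/andP[h1 h2] _] nl] E]; apply: nl; rewrite -E in lz.
  by apply: (loop_set_right hl El) lz; rewrite !ltW.
- move=> O' pO OU; have OW : O' `<=` W by move=> z /OU[].
  have [l' [hl' El' OE]] := periodic_orbit_loop GS FG mu_small pO OW.
  rewrite OE; congr (lset _); apply: contrapT => nl.
  have /andP[h1 h2] := hl'; have hlw' : la <= l' <= lb by rewrite !ltW.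
  have : O' (ptR l').
    rewrite OE; exists 0; last exact: (loop0 FG hlw').
    rewrite /= in_itv/= lexx /=; apply: ltW; apply: lt_trans (period_gt FG hlw'); exact: (tX_gt0 FG hlw').
  by move=> /OU[_]; apply; exists l'.
Qed.

Lemma limit_cycles_ge (N : nat) (lam : 'I_N -> R) : finite_set cycle_labels -> injective lam ->
  (forall i, la + eps ^+ 2 < lam i < lb - eps ^+ 2 /\ psR (lam i) = psL (lam i)) ->
  (N%:R%:E <= counting (@limit_cycle R n Z) :> \bar R)%E.
Proof.
move=> fin inj H; apply: (@counting_ge _ _ _ _ (fun i => lset (lam i))).
  move=> i j E; apply: inj; have [h1 h2] := H j; have [h3 h4] := H i.
  apply: (loop_set_inj h1 h2 _ (esym E)).
  by have := sqr_ge0 eps; case/andP: h3 => h5 h6 h7; apply/andP; split; lra.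
by move=> i; have [h1 h2] := H i; exact: loop_limit_cycle.
Qed.

End LimitCycles.

(** * Generic levels are finite *)

Lemma seq_separated (R : realType) (s : seq R) : exists2 d : R, 0 < d &
  forall x y, x \in s -> y \in s -> x != y -> d <= `|x - y|.
Proof.
elim: s => [|z s [d d0 IH]]; first by exists 1.
have [e e0 He] : exists2 e : R, 0 < e & forall x, x \in s -> x != z -> e <= `|x - z|.
  elim: s {IH} => [|w s [e e0 He]]; first by exists 1.
  exists (if w == z then e else Num.min e `|w - z|).
    by case: eqVneq => // wz; rewrite lt_min e0 normr_gt0 subr_eq0.
  move=> x; rewrite inE => /predU1P[->|/He H] xz; first by rewrite (negPf xz) ge_min lexx orbT.
  by case: ifP => _; [exact: H | rewrite ge_min H].
exists (Num.min d e) => [|x y]; first by rewrite lt_min d0.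
rewrite !inE => /predU1P[->|xs] /predU1P[->|ys] xy.
- by rewrite eqxx in xy.
- by rewrite distrC ge_min He ?orbT// eq_sym.
- by rewrite ge_min He ?orbT.
- by rewrite ge_min IH.
Qed.

Section Level.
Context {R : realType} (h : R -> R) (a b K : R).
Context (ab : a < b) (hL : forall s t, a <= s <= b -> a <= t <= b -> `|h s - h t| <= K * `|s - t|).

Let K0 : 0 <= K.
Proof.
have := hL (s := a) (t := b); rewrite !lexx ltW//= => /(_ isT isT) H.
have := le_trans (normr_ge0 _) H; rewrite pmulr_lge0// normr_gt0 subr_eq0; by rewrite lt_eqF.
Qed.

Let mesh (m : nat) : R := (b - a) / m.+1%:R.
Let node (m j : nat) : R := a + mesh m * j%:R.
Let band (m j : nat) : set R := `[h (node m j) - K * mesh m, h (node m j) + K * mesh m].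
(** Number of grid cells whose band of possible values contains [c], a discrete form of the Banach
    indicatrix. There are [m.+1] cells, and one more index because [cell] sends [b] to [m.+1]. *)
Let hits (m : nat) (c : R) : \bar R := (\sum_(j < m.+2) (\1_(band m j) c)%:E)%E.

Let mesh_gt0 m : 0 < mesh m.
Proof. by rewrite divr_gt0 ?subr_gt0. Qed.

Let cell m t : nat := Num.truncn ((t - a) / mesh m).

Let cellP m t : a <= t <= b -> (cell m t < m.+2)%N /\ node m (cell m t) <= t < node m (cell m t) + mesh m.
Proof.
move=> /andP[at_ tb]; have m0 := mesh_gt0 m.
have t0 : 0 <= (t - a) / mesh m by rewrite divr_ge0 ?subr_ge0// ltW.
have /andP[h1 h2] := truncn_itv t0; rewrite -/(cell m t) in h1 h2.
rewrite ler_pdivlMr// in h1; rewrite ltr_pdivrMr// -natr1 in h2.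
split; last by rewrite /node; lra.
rewrite ltnS -(ler_nat R) -(ler_pM2r m0); apply: (le_trans h1).
by rewrite /mesh mulrCA divff ?pnatr_eq0// mulr1; lra.
Qed.

Let cell_band m t : a <= t <= b -> band m (cell m t) (h t).
Proof.
move=> tab; have [jm jt] := cellP m tab; have /andP[h1 h2] := jt.
have nab : a <= node m (cell m t) <= b.
  case/andP: tab => ? tb; rewrite lerDl mulr_ge0 ?(ltW (mesh_gt0 m))//=; exact: le_trans tb.
have := hL nab tab; rewrite (ler0_norm (_ : node m (cell m t) - t <= 0)) ?subr_le0// opprB.
have : K * (t - node m (cell m t)) <= K * mesh m by rewrite ler_wpM2l//; lra.
move=> H1 H2; have := le_trans H2 H1; rewrite ler_norml /band /= in_itv/=; lra.
Qed.

Let hits_ge0 m c : (0 <= hits m c)%E.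
Proof. by apply: sume_ge0 => j _; rewrite lee_fin. Qed.

Let measurable_hits m (D : set R) : measurable_fun D (hits m).
Proof.
apply: emeasurable_sum => j; apply/measurable_EFinP; apply: measurable_indic.
exact: measurable_itv.
Qed.

(** There are [m + 2] bands of length [2 * (K * mesh)], and [(m + 2) / (m + 1) <= 2]: the bound does
    not depend on [m]. *)
Let integral_hits m D : measurable D ->
  (\int[lebesgue_measure]_(c in D) hits m c <= (4 * (K * (b - a)))%:E)%E.
Proof.
move=> mD; have mb j : measurable (band m j) by exact: measurable_itv.
rewrite ge0_integral_sum//; last first.
  by move=> j; apply/measurable_EFinP; apply: measurable_indic; exact: mb.
apply: (@le_trans _ _ (\sum_(j < m.+2) (2 * (K * mesh m))%:E)%E).
  apply: lee_sum => j _; rewrite integral_indic//; last exact: mb.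
  apply: (@le_trans _ _ (lebesgue_measure (band m j))).
    apply: le_measure; [apply: mem_set; exact: (measurableI _ _ (mb j : measurable _) mD) | apply: mem_set; exact: mb | exact: subIsetl].
  rewrite /band lebesgue_measure_itv/= lte_fin; case: ifP => _.
    by rewrite lee_fin; lra.
  by rewrite lee_fin; apply: mulr_ge0 => //; apply: mulr_ge0 => //; exact: ltW.
rewrite sumEFin lee_fin sumr_const card_ord -mulr_natr.
have : mesh m * m.+2%:R <= 2 * (b - a).
  rewrite /mesh mulrAC ler_pdivrMr// -subr_ge0 -!natr1.
  have := ler0n R m; have : 0 < b - a by rewrite subr_gt0.
  by nra.
by move/(ler_wpM2l K0); lra.
Qed.

(** Once the mesh is finer than the separation of the chosen preimages of [c], they occupy distinct
    cells, and each of these cells is counted. *)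
Let hits_many (B : {fset R}) c : [set` B] `<=` [set t | a <= t <= b /\ h t = c] ->
  \forall m \near \oo, (#|` B|%:R%:E <= hits m c)%E.
Proof.
move=> HB; have [d d0 Hd] := seq_separated (enum_fset B).
have [n0 Hn0] : exists n0 : nat, (b - a) / d < n0%:R.
  exists (Num.bound ((b - a) / d)); apply: archi_boundP.
  by apply: divr_ge0; [rewrite subr_ge0 ltW | exact: ltW].
near=> m.
have md : mesh m < d.
  rewrite /mesh ltr_pdivrMr// mulrC -ltr_pdivrMr//; apply: (lt_le_trans Hn0).
  by rewrite ler_nat; apply: leqW; near: m; exact: nbhs_infty_ge.
pose F (t : B) : 'I_m.+2 := inord (cell m (val t)).
have tB (t : B) : a <= val t <= b /\ h (val t) = c by apply: HB; rewrite /=; exact: valP.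
have FE t : F t = cell m (val t) :> nat by rewrite inordK//; have [] := cellP m (tB t).1.
have Finj : injective F.
  move=> s t E; apply/val_inj/eqP; apply: contraTT isT => st.
  have := Hd _ _ (valP s) (valP t) st.
  have [_ /andP[s1 s2]] := cellP m (tB s).1; have [_ /andP[t1 t2]] := cellP m (tB t).1.
  have EE : cell m (val s) = cell m (val t) by rewrite -!FE E.
  rewrite EE in s1 s2; move=> dd; have : `|val s - val t| < d.
    by rewrite ltr_norml; lra.
  by rewrite ltNge dd.
rewrite /hits sumEFin lee_fin.
apply: le_trans (_ : _ <= \sum_(j in F @: [set: B]%SET) \1_(band m j) c) _.
  rewrite (eq_bigr (fun=> 1)); last first.
    move=> j /imsetP[t _ ->]; rewrite indicE mem_set// FE.
    by have := cell_band m (tB t).1; rewrite (tB t).2.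
  by rewrite sumr_const card_imset// cardsT -cardfE.
by rewrite [leRHS](bigID (mem (F @: [set: B]%SET)))/= lerDl sumr_ge0.
Unshelve. all: by end_near. Qed.

(** If every level between [p] and [q] had infinitely many preimages, the lower limit of [hits]
    would exceed any [n] there; by Fatou its integral is at most [4 * (K * (b - a))], which fails
    once [n (q - p)] is larger. *)
Lemma generic_level (p q : R) : p < q ->
  exists2 c, p < c < q & finite_set [set t | a <= t <= b /\ h t = c].
Proof.
move=> pq; apply: contrapT => nex.
have inf c : p < c < q -> infinite_set [set t | a <= t <= b /\ h t = c].
  by move=> hc fin; apply: nex; exists c.
pose C : R := 4 * (K * (b - a)).
have [n Hn] : exists n : nat, C / (q - p) < n%:R.
  exists (Num.bound (C / (q - p))); apply: archi_boundP; apply: divr_ge0; last by rewrite subr_ge0 ltW.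
  by apply: mulr_ge0 => //; apply: mulr_ge0 => //; rewrite subr_ge0 ltW.
rewrite ltr_pdivrMr ?subr_gt0// in Hn.
pose D : set R := `]p, q[%classic.
have mD : measurable D by exact: measurable_itv.
have := @fatou _ _ R lebesgue_measure D mD hits (fun m => @measurable_hits m D) (fun m c _ => hits_ge0 m c).
apply/negP; rewrite -ltNge.
apply: (@le_lt_trans _ _ C%:E).
  rewrite limn_einf_lim; apply: lime_le; first exact: is_cvg_einfs.
  apply: nearW => m; apply: le_trans (integral_hits m mD).
  by apply: ereal_inf_lbound; exists m => //=.
apply: (@lt_le_trans _ _ (n%:R * (q - p))%:E); first by rewrite lte_fin.
apply: (@le_trans _ _ (\int[lebesgue_measure]_(c in D) n%:R%:E)%E).
  have muD : lebesgue_measure D = (q - p)%:E by rewrite /D lebesgue_measure_itv/= lte_fin pq EFinB.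
  rewrite integral_cst; last exact: mD.
  by rewrite EFinM le_eqVlt; apply/orP; left; apply/eqP; congr (_ * _)%E; exact: esym muD.
apply: ge0_le_integral => //.
  rewrite /limn_einf; apply: measurableT_comp => //; apply: measurable_fun_limn_esup => m.
  by apply: measurableT_comp => //; exact: measurable_hits.
move=> c; rewrite /D /= in_itv/= => hc.
have [B HB nB] := infinite_set_fset n (inf c hc).
have [n0 _ Hn0] := hits_many HB.
rewrite limn_einf_lim; apply: lime_ge; first exact: is_cvg_einfs.
exists n0 => // m /= nm; apply: le_ereal_inf_tmp => _ [k /= mk <-].
apply: (@le_trans _ _ (#|` B|%:R%:E)); first by rewrite lee_fin ler_nat.
by apply: Hn0; rewrite /= (leq_trans nm).
Qed.

End Level.

(** * The level function *)

Section LevelFun.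
Context {R : realType} {f : R -> R} {c M eps la lb : R}.
Context (FG : flat_graph f c M eps la lb).

Local Notation rad2 := (@radius2 R f eps).
Local Notation sw := (@sweep R f eps).

Let s1 : (1 : R) = 1 \/ (1 : R) = -1. Proof. by left. Qed.
Let s2 : (-1 : R) = 1 \/ (-1 : R) = -1. Proof. by right. Qed.

(** The one value of [mu] for which the loop of label [l] closes; the angle swept does not involve
    [mu], which makes the equation solvable for it. *)
Definition level l := (ln (rad2 1 l) - ln (rad2 (-1) l)) / 2 / sw l.

Lemma psi_level mu l : la <= l <= lb ->
  psiR (f := f) (mu := mu) (eps := eps) l = psiL (f := f) (mu := mu) (eps := eps) l <-> level l = mu.
Proof.
move=> hl; have s0 := sweep_gt0 FG hl; rewrite /psiR /psiL /level; split=> H.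
  set X := ln _ in H *; set Y := ln (rad2 (-1) l) in H *.
  have -> : (X - Y) / 2 = mu * sw l by rewrite /sweep; lra.
  by rewrite mulfK// gt_eqF.
set X := ln _ in H *; set Y := ln (rad2 (-1) l) in H *.
have : (X - Y) / 2 = mu * sw l by rewrite -H divfK// gt_eqF.
by rewrite /sweep; lra.
Qed.

Lemma ln_lip (a b : R) : 1 <= a -> 1 <= b -> `|ln a - ln b| <= `|a - b|.
Proof.
wlog ab : a b / a <= b => [H a1 b1|a1 b1].
  by have [ab|ba] := leP a b; [exact: H | rewrite distrC [leRHS]distrC; apply: H => //; exact: ltW].
have a0 : 0 < a by lra.
have b0 : 0 < b by lra.
rewrite distrC [leRHS]distrC !ger0_norm ?subr_ge0 ?ler_ln ?posrE//.
have ba0 : 0 < b / a by rewrite divr_gt0.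
have := @le_ln1Dx R (b / a - 1); rewrite [1 + _]addrC subrK ln_div ?posrE// => H.
apply: le_trans (H _) _; first by lra.
have -> : b / a - 1 = (b - a) / a by field; rewrite gt_eqF.
by rewrite ler_pdivrMr// ler_peMr// subr_ge0.
Qed.

Lemma radius2_lip s l l' : s = 1 \/ s = -1 -> la <= l <= lb -> la <= l' <= lb ->
  `|rad2 s l - rad2 s l'| <= 2 * `|l - l'|.
Proof.
move=> sE hl hl'; have H := heightL FG sE hl hl'.
have := height_lt1 FG sE hl; have := height_lt1 FG sE hl'; rewrite /radius2.
set u := height s l in H *; set v := height s l' in H * => hv hu.
have -> : l + 1 + u ^+ 2 - (l' + 1 + v ^+ 2) = (l - l') + (u - v) * (u + v) by ring.
apply: le_trans (ler_normD _ _) _; rewrite normrM.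
have : `|u + v| <= 1 by apply: le_trans (ler_normD _ _) _; lra.
have := normr_ge0 (u - v); have := normr_ge0 (l - l'); have := normr_ge0 (u + v); nra.
Qed.

Lemma sweep_ge l : la <= l <= lb -> 1 <= sw l.
Proof.
move=> hl; have /andP[_ t1] := tilt_itv FG s1 hl; have /andP[_ t2] := tilt_itv FG s2 hl.
by rewrite /sweep; have := pi_ge2 R; lra.
Qed.

Lemma sweep_lt l : la <= l <= lb -> sw l < 2 * pi.
Proof.
move=> hl; have /andP[t1 _] := tilt_itv FG s1 hl; have /andP[t2 _] := tilt_itv FG s2 hl.
by rewrite /sweep; lra.
Qed.

Lemma level_lip : exists K : R, forall l l', la <= l <= lb -> la <= l' <= lb ->
  `|level l - level l'| <= K * `|l - l'|.
Proof.
have c0 := fg_c FG; have M4 := fg_M FG; have lab := fg_lb FG; have la0 := fg_la FG.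
pose K1 : R := 2 / c + M.
exists (2 + (lb + 2) * (2 * K1)) => l l' hl hl'.
set N := (ln (rad2 1 l) - ln (rad2 (-1) l)) / 2.
set N' := (ln (rad2 1 l') - ln (rad2 (-1) l')) / 2.
have g1 s x : la <= x <= lb -> 1 <= rad2 s x by move=> hx; apply: ltW; exact: (radius2_gt1 FG s hx).
have D0 := normr_ge0 (l - l').
have HN : `|N - N'| <= 2 * `|l - l'|.
  have -> : N - N' = ((ln (rad2 1 l) - ln (rad2 1 l')) - (ln (rad2 (-1) l) - ln (rad2 (-1) l'))) / 2.
    by rewrite /N /N'; field.
  rewrite normrM (ger0_norm (_ : 0 <= 2^-1 :> R)) ?invr_ge0// ler_pdivrMr//.
  apply: le_trans (ler_normB _ _) _.
  have := le_trans (ln_lip (g1 1 _ hl) (g1 1 _ hl')) (radius2_lip s1 hl hl').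
  have := le_trans (ln_lip (g1 (-1) _ hl) (g1 (-1) _ hl')) (radius2_lip s2 hl hl').
  lra.
have HB : `|N'| <= lb + 2.
  rewrite /N' normrM (ger0_norm (_ : 0 <= 2^-1 :> R)) ?invr_ge0// ler_pdivrMr//.
  apply: le_trans (ler_normB _ _) _.
  have lnb s : s = 1 \/ s = -1 -> `|ln (rad2 s l')| <= lb + 2.
    move=> sE; rewrite ger0_norm; last exact: ln_ge0 (g1 _ _ hl').
    have := @le_ln1Dx R (rad2 s l' - 1); rewrite [1 + _]addrC subrK => H.
    have := radius2_le FG sE hl'; have := g1 s _ hl' => h1 h2.
    by apply: le_trans (H _) _; lra.
  by have := lnb 1 s1; have := lnb (-1) s2; lra.
have S1 := sweep_ge hl; have S2 := sweep_ge hl'.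
have HS : `|sw l' - sw l| <= 2 * K1 * `|l - l'|.
  have -> : sw l' - sw l = (tilt (f := f) (eps := eps) (-1) l - tilt (f := f) (eps := eps) (-1) l') +
     (tilt (f := f) (eps := eps) 1 l - tilt (f := f) (eps := eps) 1 l') by rewrite /sweep; ring.
  apply: le_trans (ler_normD _ _) _.
  by have := tiltL FG s1 hl hl'; have := tiltL FG s2 hl hl'; rewrite -/K1; lra.
have -> : level l - level l' = (N - N') / sw l + N' * (sw l' - sw l) / (sw l * sw l').
  by rewrite /level -/N -/N'; field; rewrite !gt_eqF//; lra.
have i1 : 0 <= (sw l)^-1 <= 1 by rewrite invr_ge0 invf_le1; lra.
have i2 : 0 <= (sw l * sw l')^-1 <= 1 by rewrite invr_ge0 invf_le1; nra.
have /andP[i1a i1b] := i1; have /andP[i2a i2b] := i2.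
clearbody N N'.
apply: le_trans (ler_normD _ _) _; rewrite [leRHS]mulrDl; apply: lerD.
  rewrite normrM (ger0_norm i1a) -[leRHS]mulr1; exact: ler_pM.
rewrite !normrM (ger0_norm i2a) -[leRHS]mulr1; apply: ler_pM => //.
  by rewrite -[leRHS]mulrA; apply: ler_pM => //.
Qed.

(** The squared radii differ by at least [d] and are at most [lb + 2], so their logarithms differ by
    at least [d / (lb + 2)]. The factor 2 and the sweep, at most 8, cost 16; the constant 32 leaves
    room. *)
Lemma level_ge l (d : R) : la <= l <= lb -> 0 <= d ->
  d <= height (f := f) (eps := eps) 1 l ^+ 2 - height (f := f) (eps := eps) (-1) l ^+ 2 ->
  d / (32 * (lb + 2)) <= level l.
Proof.
move=> hl d0 H.
have S0 := sweep_gt0 FG hl; have S2 := sweep_lt hl.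
have R1 := radius2_gt1 FG 1 hl; have R2 := radius2_gt1 FG (-1) hl; have R3 := radius2_le FG s1 hl.
have rD : rad2 1 l - rad2 (-1) l >= d by rewrite /radius2; lra.
have r20 : 0 < rad2 (-1) l by lra.
have rr : rad2 (-1) l <= rad2 1 l by lra.
have L := lnD_ge r20 rr.
have S8 : sw l <= 8 by apply: ltW; apply: lt_le_trans S2 _; have := pihalf_lt2 R; lra.
have e1 : d / (lb + 2) <= ln (rad2 1 l) - ln (rad2 (-1) l).
  apply: le_trans L; apply: le_trans (_ : d / rad2 1 l <= _).
    by apply: ler_wpM2l => //; rewrite lef_pV2 ?posrE; lra.
  by rewrite ler_pM2r ?invr_gt0; lra.
rewrite /level ler_pdivlMr// ler_pdivlMr//.
have -> : d / (32 * (lb + 2)) = d / (lb + 2) / 32 by field; rewrite gt_eqF; lra.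
have e0 : 0 <= d / (lb + 2) by rewrite divr_ge0; lra.
by apply: le_trans e1; move: e0; set e := d / _; nra.
Qed.

Lemma level_le l (d : R) : la <= l <= lb -> 0 <= d ->
  height (f := f) (eps := eps) 1 l ^+ 2 - height (f := f) (eps := eps) (-1) l ^+ 2 <= d ->
  level l <= d.
Proof.
move=> hl d0 H.
have S0 := sweep_gt0 FG hl; have S1 := sweep_ge hl.
have R1 := radius2_gt1 FG 1 hl; have R2 := radius2_gt1 FG (-1) hl.
rewrite /level ler_pdivrMr// ler_pdivrMr//.
have rD : rad2 1 l - rad2 (-1) l <= d by rewrite /radius2; lra.
have dd : d <= d * sw l * 2 by nra.
apply: le_trans dd; case: (leP (rad2 1 l) (rad2 (-1) l)) => rr.
  apply: le_trans d0; rewrite subr_le0 ler_ln ?posrE//; lra.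
have := ln_lip (ltW R1) (ltW R2); rewrite (ger0_norm (_ : 0 <= rad2 1 l - rad2 (-1) l)); last by rewrite subr_ge0 ltW.
by move/(le_trans (ler_norm _)); lra.
Qed.

End LevelFun.

Lemma continuous_zero_between (R : realType) (h : R -> R) (K a b m : R) : a < b ->
  (forall s t, a <= s <= b -> a <= t <= b -> `|h s - h t| <= K * `|s - t|) ->
  (h a - m) * (h b - m) < 0 -> exists2 t, a < t < b & h t = m.
Proof.
move=> ab hL H; have [|t] := @IVT _ h a b m (ltW ab) (lip_within_continuous hL).
  rewrite ge_min le_max; case: (ltgtP (h a) m) H => [h1|h1|->] H; last by rewrite subrr mul0r ltxx in H.
    rewrite /= leNgt; apply/negP => h2.
    by move: H; rewrite ltNge mulr_le0 ?subr_le0 ?ltW.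
  rewrite /= andbT leNgt; apply/negP => h2.
  by move: H; rewrite ltNge mulr_ge0 ?subr_ge0 ?ltW.
rewrite in_itv/= => /andP[ta tb] E; exists t => //.
by rewrite !lt_neqAle ta tb !andbT; apply/andP; split; apply/eqP => h1; move: H; rewrite -?E ?h1 ?subrr ?mul0r ?mulr0 ltxx.
Qed.

(** The levels alternate between at least [m1] and at most [m0] at the [N + 1] points [lam i], so
    every [mu] strictly between is attained in each of the [N] gaps. A generic such [mu] has
    finitely many labels in the whole window, and only then is the system taken. *)
Theorem many_cycles (R : realType) (n N : nat) (f : R -> R) (c M eps la lb m0 m1 : R) (lam : nat -> R) :
  flat_graph f c M eps la lb -> 0 <= m0 -> m0 < m1 ->
  4 * m1 <= c -> m1 * M <= 1 -> m1 * (2 / c + M) * (4 * (lb + 2)) <= 1 ->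
  (forall i, (i <= N)%N -> la + eps ^+ 2 < lam i < lb - eps ^+ 2) ->
  (forall i, (i < N)%N -> lam i < lam i.+1) ->
  (forall i, (i <= N)%N -> odd i -> m1 <= level (f := f) (eps := eps) (lam i)) ->
  (forall i, (i <= N)%N -> ~~ odd i -> level (f := f) (eps := eps) (lam i) <= m0) ->
  (forall mu, 0 < mu -> mu < m1 -> exists Z : pwl_system R n, graph_system Z f mu c M eps) ->
  exists Z : pwl_system R n, (N%:R%:E <= counting (@limit_cycle R n Z) :> \bar R)%E.
Proof.
move=> FG m00 m01 m1c m1M m1b lamI lamD oddH evenH HZ.
have c0 := fg_c FG; have M4 := fg_M FG; have lab := fg_lb FG; have la0 := fg_la FG.
have [N0|N0] := posnP N.
  have [||Z _] := HZ ((m0 + m1) / 2); [lra | lra |].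
  by exists Z; rewrite N0; rewrite /counting; case: ifP => _; rewrite ?leey// lee_fin ler0n.
have e20 := sqr_ge0 eps.
have lamW i : (i <= N)%N -> la <= lam i <= lb.
  by move=> /lamI /andP[h1 h2]; apply/andP; split; lra.
have [K HK] := level_lip FG.
have lalb : la < lb by have := lamI 0%N (leq0n _); lra.
have [mu /andP[mu0 mu1] fin] := generic_level lalb HK m01.
have mupos : 0 < mu by lra.
have [Z GS] := HZ mu mupos mu1; exists Z.
have small : mu * (2 / c + M) * (4 * (lb + 2)) < 1.
  apply: lt_le_trans m1b; rewrite -!mulrA ltr_pM2r// mulr_gt0//; last by have := sqr_ge0 c; have := fg_eps0 FG; lra.
  by rewrite addr_gt0 ?divr_gt0//; lra.
have zer (i : 'I_N) : exists2 l, lam i < l < lam i.+1 & level (f := f) (eps := eps) l = mu.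
  have iN := ltn_ord i; have wi := lamW i (ltnW iN); have wi1 := lamW i.+1 iN.
  apply: (continuous_zero_between (K := K) (lamD i iN)).
    move=> s t hs ht; apply: HK.
      by case/andP: wi wi1 => ? ? /andP[? ?]; case/andP: hs => ? ?; apply/andP; split; lra.
    by case/andP: wi wi1 => ? ? /andP[? ?]; case/andP: ht => ? ?; apply/andP; split; lra.
  have [oi|ei] := boolP (odd i).
    have h1 := oddH i (ltnW iN) oi; have h2 := evenH i.+1 iN; rewrite /= oi /= in h2.
    rewrite pmulr_rlt0; last by lra.
    by have := h2 isT; lra.
  have h1 := evenH i (ltnW iN) ei; have h2 := oddH i.+1 iN ei.
  by rewrite nmulr_rlt0; lra.
pose P (i : 'I_N) := [set l | lam i < l < lam i.+1 /\ level (f := f) (eps := eps) l = mu].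
pose z i := xget 0 (P i).
have zP (i : 'I_N) : lam i < z i < lam i.+1 /\ level (f := f) (eps := eps) (z i) = mu.
  have [l h1 h2] := zer i; have Pl : P i l by split.
  exact: (xgetI 0 Pl).
have mono i j : (i <= j <= N)%N -> lam i <= lam j.
  elim: j => [|j IH] /andP[ij jN]; first by move: ij; rewrite leqn0 => /eqP ->.
  move: ij; rewrite leq_eqVlt => /predU1P[->//|ij]; apply: (le_trans (IH _)).
    by rewrite -ltnS ij ltnW.
  by apply: ltW; exact: lamD.
have zin (i : 'I_N) : la + eps ^+ 2 < z i < lb - eps ^+ 2.
  have [/andP[h1 h2] _] := zP i; have iN := ltn_ord i.
  have /andP[h3 _] := lamI i (ltnW iN); have /andP[_ h4] := lamI i.+1 iN.
  by apply/andP; split; lra.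
apply: (limit_cycles_ge GS FG small (lam := z)).
- apply: sub_finite_set fin => l [/andP[h1 h2] E].
  have hl : la <= l <= lb by rewrite !ltW.
  by split => //; apply/(psi_level FG mu hl).
- have zlt (i j : 'I_N) : (i < j)%N -> z i < z j.
    move=> ij; have [/andP[_ h1] _] := zP i; have [/andP[h2 _] _] := zP j.
    have : lam i.+1 <= lam j by apply: mono; rewrite ij ltnW.
    lra.
  move=> i j E; apply: val_inj; case: (ltngtP i j) => // /zlt; by rewrite E ltxx.
- move=> i; split; first exact: zin.
  have hz : la <= z i <= lb by have /andP[? ?] := zin i; apply/andP; split; lra.
  by apply/(psi_level FG mu hz); have [] := zP i.
Qed.

(** * Star-shaped ovals *)

(** A connected subset that is relatively open and relatively closed is a component. The traces of
    an open and of a closed set of the whole space encode the relative topology. *)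
Lemma clopen_component (T : topologicalType) (A B O K : set T) (x : T) : B x -> connected B ->
  open O -> closed K -> B = A `&` O -> B = A `&` K -> connected_component A x = B.
Proof.
move=> Bx cB oO cK BO BK; apply/seteqP; split; last first.
  by apply: connected_component_max => //; rewrite BO => z [].
move=> z [C [Cx CA cC] Cz].
have CBO : C `&` O = C `&` B by rewrite BO setIA (setIidl CA).
have CBK : C `&` K = C `&` B by rewrite BK setIA (setIidl CA).
have CB : C `&` B = C.
  apply: cC; [by exists x | by exists O | by exists K].
by move: Cz; rewrite -CB => -[].
Qed.

Section Oval.
Context {R : realType} (F : 'cV[R]_2 -> R) (c0 : 'cV[R]_2) (S : R).
Context (cF : continuous F) (S0 : 0 < S) (F0 : 0 < F c0).
Context (Fstar : forall z l, `|z - c0| <= S -> 0 <= F z -> 0 <= l < 1 -> 0 < F (c0 + l *: (z - c0))).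
Context (Fbd : forall z, `|z - c0| = S -> F z < 0).

Let cN : continuous (fun z : 'cV[R]_2 => `|z - c0|).
Proof.
move=> z; apply: continuous_comp; last exact: norm_continuous.
by apply: (@continuousB _ _ _ id (fun=> c0)); [exact: cvg_id | exact: cst_continuous].
Qed.

Definition inside := [set z | `|z - c0| < S /\ 0 < F z].
(** [F] is controlled only in the ball of radius [S] of the maximum norm. Its zero set may have
    further components beyond, so everything there counts as outside, whatever the sign of [F]. *)
Definition outside := [set z | S <= `|z - c0| \/ F z < 0].
Definition oval := [set z | `|z - c0| < S /\ F z = 0].

Let open_norm_lt : open [set z | `|z - c0| < S].
Proof. by apply: (@open_comp _ _ _ [set x | x < S]) => [z _|]; [exact: cN | exact: open_lt]. Qed.

Let open_norm_gt : open [set z | S < `|z - c0|].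
Proof. by apply: (@open_comp _ _ _ [set x | S < x]) => [z _|]; [exact: cN | exact: open_gt]. Qed.

Let open_pos : open [set z | 0 < F z].
Proof. by apply: (@open_comp _ _ F [set x | 0 < x]) => [z _|]; [exact: cF | exact: open_gt]. Qed.

Let open_neg : open [set z | F z < 0].
Proof. by apply: (@open_comp _ _ F [set x | x < 0]) => [z _|]; [exact: cF | exact: open_lt]. Qed.

Lemma open_inside : open inside.
Proof. exact: openI open_norm_lt open_pos. Qed.

Lemma open_outside : open outside.
Proof.
rewrite (_ : outside = [set z | S < `|z - c0|] `|` [set z | F z < 0]); first exact: openU.
apply/seteqP; split=> z /=; last by case=> [/ltW ?|?]; [left|right].
by case=> [|?]; [rewrite le_eqVlt => /predU1P[/esym/Fbd ?|?]; [right|left] | right].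
Qed.

Let ray_continuous (w : 'cV[R]_2) : continuous (fun s : R => c0 + s *: w).
Proof.
move=> s; apply: (@continuousD _ _ _ (fun=> c0) (fun s : R => s *: w)); first exact: cst_continuous.
exact: scalel_continuous.
Qed.

Let ray_connected (w : 'cV[R]_2) a b : connected [set c0 + s *: w | s in `[a, b]].
Proof.
apply: connected_continuous_connected; first exact: segment_connected.
exact/continuous_subspaceT/ray_continuous.
Qed.

Let ray_norm (w : 'cV[R]_2) (s : R) : `|c0 + s *: w - c0| = `|s| * `|w|.
Proof. by rewrite addrC addKr normrZ. Qed.

Lemma connected_inside : connected inside.
Proof.
rewrite (_ : inside = \bigcup_(z in inside) [set c0 + s *: (z - c0) | s in `[0, 1]]).
  apply: bigcup_connected; last by move=> z _; exact: ray_connected.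
  by exists c0 => z _ /=; exists 0; [rewrite in_itv/= lexx ler01 | rewrite scale0r addr0].
apply/seteqP; split=> [z Iz|w [z [zS Fz] [s]]].
  by exists z => //; exists 1; [rewrite /= in_itv/= lexx ler01 | rewrite scale1r subrKC].
rewrite /= in_itv/= => /andP[s0 s1] <-.
move: s1; rewrite le_eqVlt => /predU1P[->|s1]; first by rewrite scale1r subrKC.
split; last by apply: Fstar; rewrite ?s0 ?ltW.
rewrite ray_norm ger0_norm//; apply: le_lt_trans zS.
by rewrite ler_piMl// ltW.
Qed.

Definition dir (t : R) : 'cV[R]_2 := vec2 (cos t) (sin t).

Let dir_continuous : continuous dir.
Proof. by move=> t; apply: vec2_continuous; [exact: continuous_cos | exact: continuous_sin]. Qed.

Let dir_le t : `|dir t| <= 2.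
Proof.
apply: le_trans (norm_vec2 _) _; rewrite xc_vec2 yc_vec2.
have : `|cos t| <= 1 by rewrite ler_norml cos_geN1 cos_le1.
have : `|sin t| <= 1 by rewrite ler_norml sin_geN1 sin_le1.
lra.
Qed.

Let polarE (w : 'cV[R]_2) : exists2 r : R, 0 <= r & exists t, w = r *: dir t.
Proof.
pose r := Num.sqrt (xc w ^+ 2 + yc w ^+ 2).
have r2 : r ^+ 2 = xc w ^+ 2 + yc w ^+ 2 by rewrite sqr_sqrtr// addr_ge0// sqr_ge0.
exists r; first exact: sqrtr_ge0.
have [r0|r0] := eqVneq r 0.
  have x2 := sqr_ge0 (xc w); have y2 := sqr_ge0 (yc w).
  rewrite r0 expr0n/= in r2; exists 0; rewrite r0 scale0r.
  have /eqP : xc w ^+ 2 = 0 by lra.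
  have /eqP : yc w ^+ 2 = 0 by lra.
  rewrite !sqrf_eq0 => /eqP y0 /eqP x0.
  by apply: vec2P; rewrite ?x0 ?y0 /xc /yc mxE.
have rp : 0 < r by rewrite lt_neqAle eq_sym r0 sqrtr_ge0.
pose x := xc w / r; pose y := yc w / r.
have xy : x ^+ 2 + y ^+ 2 = 1 by rewrite /x /y !exprMn -mulrDl -r2 exprVn divff// expf_neq0.
have x1 : -1 <= x <= 1 by rewrite -ler_norml -(@expr_le1 _ 2)// real_normK ?num_real//; have := sqr_ge0 y; lra.
have ca : cos (acos x) = x by rewrite acosK.
have sa : sin (acos x) = `|y|.
  rewrite sin_acos//; have -> : 1 - x ^+ 2 = y ^+ 2 by lra.
  by rewrite sqrtr_sqr.
have [y0|y0] := leP 0 y.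
  exists (acos x); apply: vec2P; rewrite ?xcZ ?ycZ ?xc_vec2 ?yc_vec2 ?ca ?sa ?ger0_norm// /x /y mulrC divfK//.
exists (- acos x); apply: vec2P; rewrite ?xcZ ?ycZ ?xc_vec2 ?yc_vec2 ?cosN ?sinN ?ca ?sa ?ltr0_norm ?opprK//.
  by rewrite /x mulrC divfK.
by rewrite /y mulrC divfK.
Qed.

Let dir_ge t : 1 <= 2 * `|dir t|.
Proof.
have := xc_norm (dir t); have := yc_norm (dir t); rewrite xc_vec2 yc_vec2 => h1 h2.
have : `|cos t| ^+ 2 + `|sin t| ^+ 2 = 1 by rewrite !real_normK ?num_real// cos2Dsin2.
move: h1 h2; set a := `|cos t|; set b := `|sin t|; set d := `|dir t| => h1 h2 E.
have a0 : 0 <= a := normr_ge0 _; have b0 : 0 <= b := normr_ge0 _.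
by rewrite leNgt; apply/negP => H; nra.
Qed.

(** The star condition read backwards: a point with [F >= 0] further out on the ray would make [F]
    positive at [z]. *)
Lemma outward z l : outside z -> 1 <= l -> outside (c0 + l *: (z - c0)).
Proof.
move=> Oz l1; have l0 : 0 < l by lra.
have [H|H] := leP S `|c0 + l *: (z - c0) - c0|; first by left.
right; rewrite ltNge; apply/negP => Fw.
case: Oz => [zS|Fz].
  move: H; rewrite ray_norm gtr0_norm// ltNge => /negP; apply.
  by apply: le_trans zS _; rewrite ler_peMl.
move: l1; rewrite le_eqVlt => /predU1P[l1|l1].
  by move: Fw; rewrite -l1 scale1r subrKC leNgt Fz.
have := @Fstar (c0 + l *: (z - c0)) l^-1 (ltW H) Fw.
rewrite invr_ge0 (ltW l0) invf_lt1// l1 => /(_ isT).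
by rewrite [c0 + _ - c0]addrC addKr scalerA mulVf ?gt_eqF// scale1r subrKC => /ltW; rewrite leNgt Fz.
Qed.

(** Every outside point is joined along its ray, inside the set, to a large Euclidean circle, which
    is connected as an image of the line. *)
Lemma connected_outside : connected outside.
Proof.
pose circle := [set c0 + (4 * S) *: dir t | t in [set: R]].
have cC : connected circle.
  rewrite (_ : circle = (fun t => c0 + (4 * S) *: dir t) @` [set: R])//.
  apply: connected_continuous_connected; first by apply/connected_intervalP => x y _ _ z _.
  apply: continuous_subspaceT => t.
  apply: (@continuousD _ _ _ (fun=> c0) (fun t : R => (4 * S) *: dir t)); first exact: cst_continuous.
  by apply: continuousZl_tmp; exact: dir_continuous.
(* A Euclidean unit vector has maximum norm at least [1 / 2], so the radius [4 * S] is safely beyond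
   the ball. *)
have far t r : 4 * S <= r -> outside (c0 + r *: dir t).
  move=> hr; left; rewrite ray_norm ger0_norm; last by have := S0; lra.
  by have := dir_ge t; have := S0; nra.
have seg z : outside z -> exists X : set 'cV[R]_2, [/\ connected X, X `<=` outside, X z & X `&` circle !=set0].
  move=> Oz; have [r r0 [t zE]] := polarE (z - c0).
  have zc : z = c0 + r *: dir t by rewrite -zE subrKC.
  have rp : 0 < r.
    rewrite lt_neqAle r0 andbT eq_sym; apply/eqP => re; move: zc; rewrite re scale0r addr0 => zc.
    by case: Oz; rewrite zc; [rewrite subrr normr0 leNgt S0 | move/lt_trans => /(_ _ F0); rewrite ltxx].
  exists [set c0 + s *: dir t | s in `[Num.min r (4 * S), Num.max r (4 * S)]]; split.
  - exact: ray_connected.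
  - move=> w [s]; rewrite /= in_itv/= ge_min le_max => /andP[/orP[rs|hs] _] <-; last exact: far.
    have -> : c0 + s *: dir t = c0 + (s / r) *: (z - c0) by rewrite zE scalerA divfK// gt_eqF.
    by apply: outward => //; rewrite ler_pdivlMr// mul1r.
  - by exists r => //=; rewrite in_itv/= ge_min le_max lexx.
  - exists (c0 + (4 * S) *: dir t); split; last by exists t.
    by exists (4 * S) => //=; rewrite in_itv/= ge_min le_max lexx !orbT.
pose Q z := [set X : set 'cV[R]_2 | [/\ connected X, X `<=` outside, X z & X `&` circle !=set0]].
pose X z := xget set0 (Q z).
have XP z : outside z -> [/\ connected (X z), X z `<=` outside, X z z & X z `&` circle !=set0].
  by move=> /seg[Y HY]; have QY : Q z Y by []; exact: (xgetI set0 QY).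
rewrite (_ : outside = \bigcup_(z in outside) (X z `|` circle)).
  apply: bigcup_connected; last by move=> z /XP[h1 _ _ h2]; apply: connectedU.
  by exists (c0 + (4 * S) *: dir 0) => z _; right; exists 0.
apply/seteqP; split=> [z Oz|w [z Oz]].
  by exists z => //; left; have [] := XP z Oz.
by case=> [|[t _ <-]]; [have [_ h _ _] := XP z Oz; exact: h | exact: far].
Qed.

Let reach t : exists2 r : R, 0 < r & `|r *: dir t| < S /\ F (c0 + r *: dir t) = 0.
Proof.
have d0 : 0 < `|dir t| by have := dir_ge t; lra.
pose b := S / `|dir t|; have b0 : 0 < b by rewrite divr_gt0.
have Fb : F (c0 + b *: dir t) < 0.
  by apply: Fbd; rewrite ray_norm gtr0_norm// divfK// gt_eqF.
have cG : {within `[0, b], continuous (fun s => F (c0 + s *: dir t))}.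
  apply: continuous_subspaceT => s; apply: continuous_comp; [exact: ray_continuous | exact: cF].
have [|r] := @IVT _ (fun s => F (c0 + s *: dir t)) 0 b 0 (ltW b0) cG.
  by rewrite scale0r addr0 ge_min le_max (ltW F0) (ltW Fb) orbT.
rewrite in_itv/= => /andP[r0 rb] Fr.
have rp : 0 < r.
  rewrite lt_neqAle r0 andbT; apply/eqP => re; move: Fr; rewrite -re scale0r addr0 => Fr.
  by move: F0; rewrite Fr ltxx.
have rlt : r < b.
  by rewrite lt_neqAle rb andbT; apply/eqP => re; move: Fb; rewrite -re Fr ltxx.
by exists r => //; split => //; rewrite normrZ (gtr0_norm rp) -ltr_pdivlMr.
Qed.

Let hit t := [set r : R | 0 < r /\ (`|r *: dir t| < S /\ F (c0 + r *: dir t) = 0)].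

Let rad t : R := xget 0 (hit t).

Let radP t : 0 < rad t /\ (`|rad t *: dir t| < S /\ F (c0 + rad t *: dir t) = 0).
Proof. by have [r h1 h2] := reach t; have H : hit t r by []; exact: (xgetI 0 H). Qed.

Let before (w : 'cV[R]_2) r s : 0 <= s -> s < r -> `|r *: w| <= S -> 0 <= F (c0 + r *: w) -> 0 < F (c0 + s *: w).
Proof.
move=> s0 sr rS Fr; have r0 : 0 < r by lra.
have := @Fstar (c0 + r *: w) (s / r).
rewrite [c0 + _ - c0]addrC addKr scalerA divfK ?gt_eqF//; apply => //.
by rewrite divr_ge0 ?(ltW r0)//= ltr_pdivrMr// mul1r.
Qed.

Let rad_uniq t r : 0 < r -> `|r *: dir t| < S -> F (c0 + r *: dir t) = 0 -> r = rad t.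
Proof.
move=> r0 rS Fr; have [p0 [pS Fp]] := radP t.
case: (ltgtP r (rad t)) => // h.
  by have := before (ltW r0) h (ltW pS); rewrite Fp Fr ltxx => /(_ (lexx _)).
by have := before (ltW p0) h (ltW rS); rewrite Fp Fr ltxx => /(_ (lexx _)).
Qed.

(** On a ray [F] is positive before its zero and negative after it, within the ball. By continuity
    of [F] these strict signs persist for nearby directions and trap the zero between the two test
    radii. *)
Let rad_continuous : continuous rad.
Proof.
move=> t0; have [p0 [pS Fp]] := radP t0; set p := rad t0 in p0 pS Fp *.
have cdir r : continuous (fun t => r *: dir t).
  by move=> t; apply: continuousZl_tmp; exact: dir_continuous.
have cFd r : continuous (fun t => F (c0 + r *: dir t)).
  move=> t; apply: continuous_comp; last exact: cF.
  by apply: (@continuousD _ _ _ (fun=> c0) (fun t : R => r *: dir t)); [exact: cst_continuous | exact: cdir].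
have cNd r : continuous (fun t => `|r *: dir t|).
  by move=> t; apply: continuous_comp; [exact: cdir | exact: norm_continuous].
have d2 := dir_le t0; have d1 := dir_ge t0.
have low r : 0 <= r -> r < p -> \forall t \near t0, r < rad t.
  move=> r0 rp; near=> t.
  have Fr : 0 < F (c0 + r *: dir t).
    near: t; have /cvgr_gt := cFd r t0; apply.
    by apply: (before r0 rp (ltW pS)); rewrite Fp.
  have rS : `|r *: dir t| < S.
    near: t; have /cvgr_lt := cNd r t0; apply; apply: le_lt_trans pS.
    by rewrite !normrZ (ger0_norm r0) (gtr0_norm p0); apply: ler_wpM2r => //; exact: ltW.
  have [q0 [qS Fq]] := radP t.
  rewrite ltNge; apply/negP; rewrite le_eqVlt => /predU1P[E|h]; first by move: Fr; rewrite -E Fq ltxx.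
  by have := before (ltW q0) h (ltW rS); rewrite Fq ltxx => /(_ (ltW Fr)).
have upp r : p < r -> `|r *: dir t0| < S -> \forall t \near t0, rad t < r.
  move=> pr rS; have r0 : 0 < r by lra.
  have Fr0 : F (c0 + r *: dir t0) < 0.
    rewrite ltNge; apply/negP => /(before (ltW p0) pr (ltW rS)); by rewrite Fp ltxx.
  near=> t.
  have Fr : F (c0 + r *: dir t) < 0 by near: t; have /cvgr_lt := cFd r t0; apply.
  have [q0 [qS Fq]] := radP t.
  rewrite ltNge; apply/negP; rewrite le_eqVlt => /predU1P[E|h]; first by move: Fr; rewrite E Fq ltxx.
  by have := before (ltW r0) h (ltW qS); rewrite Fq => /(_ (lexx _)); rewrite ltNge ltW.
apply/cvgrPdist_lt => /= e e0.
pose dd := Num.min e ((S - `|p *: dir t0|) / 4).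
have dd0 : 0 < dd by rewrite lt_min e0 divr_gt0 ?subr_gt0.
have dde : dd <= e by rewrite /dd ge_min lexx.
have ddS : dd <= (S - `|p *: dir t0|) / 4 by rewrite /dd ge_min lexx orbT.
near=> t.
have h1 : Num.max 0 (p - dd) < rad t.
  near: t; apply: low; first by rewrite le_max lexx.
  by rewrite gt_max p0 ltrBlDr ltrDl.
have h2 : rad t < p + dd.
  near: t; apply: upp; first by rewrite ltrDl.
  rewrite scalerDl; apply: le_lt_trans (ler_normD _ _) _.
  rewrite [ `|dd *: _|]normrZ (gtr0_norm dd0).
  have : dd * `|dir t0| <= dd * 2 by apply: ler_wpM2l d2; exact: ltW.
  move: pS ddS; set a := `|p *: dir t0|; lra.
move: h1; rewrite gt_max => /andP[_ h1].
by rewrite -/p ltr_norml; lra.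
Unshelve. all: by end_near. Qed.

Lemma connected_oval : connected oval.
Proof.
rewrite (_ : oval = (fun t => c0 + rad t *: dir t) @` [set: R]).
  apply: connected_continuous_connected; first by apply/connected_intervalP => x y _ _ z _.
  apply: continuous_subspaceT => t.
  apply: (@continuousD _ _ _ (fun=> c0) (fun t : R => rad t *: dir t)); first exact: cst_continuous.
  by apply: (@continuousZ _ _ _ rad dir); [exact: rad_continuous | exact: dir_continuous].
apply/seteqP; split=> [z [zS Fz]|z [t _ <-]].
  have [r r0 [t zE]] := polarE (z - c0).
  have zc : z = c0 + r *: dir t by rewrite -zE subrKC.
  have rp : 0 < r.
    rewrite lt_neqAle r0 andbT eq_sym; apply/eqP => re; move: zc; rewrite re scale0r addr0 => zc.
    by move: F0; rewrite -zc Fz ltxx.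
  by exists t => //; rewrite -(rad_uniq rp) -?zE ?subrKC.
have [p0 [pS Fp]] := radP t.
by split => //; rewrite [c0 + _]addrC addrK.
Qed.

(** All three sets are connected. The oval is relatively clopen because [F < 0] on the sphere, so
    the open and the closed ball cut the same part from the zero set; the two zones are open and
    complementary off the oval. *)
Theorem oval_components :
  [/\ is_component [set z | F z = 0] oval, is_component (~` oval) inside,
      is_component (~` oval) outside, inside <> outside & inside `|` outside = ~` oval].
Proof.
have cov : inside `|` outside = ~` oval.
  apply/seteqP; split=> z.
    by case=> [[zS Fz] [_ E]|[zS|Fz] [zS' E]]; [move: Fz; rewrite E ltxx | move: zS; rewrite leNgt zS' | move: Fz; rewrite E ltxx].
  move=> nO; have [h|h] := leP S `|z - c0|; first by right; left.
  case: (ltgtP (F z) 0) => h'; [by right; right | by left | by case: nO].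
have disj z : inside z -> outside z -> False.
  by move=> [zS Fz] [|]; [rewrite leNgt zS | move/(lt_trans Fz); rewrite ltxx].
have [r0 [rS Fr]] := radP 0.
have In0 : inside c0 by split; rewrite ?subrr ?normr0.
have Out0 : outside (c0 + (4 * S) *: dir 0).
  by left; rewrite ray_norm ger0_norm; have := dir_ge 0; have := S0; nra.
split => //.
- exists (c0 + rad 0 *: dir 0) => //; apply/esym.
  apply: (@clopen_component _ _ _ [set z | `|z - c0| < S] [set z | `|z - c0| <= S]) => //.
  + by split => //; rewrite [c0 + _]addrC addrK.
  + exact: connected_oval.
  + rewrite (_ : mkset _ = ~` [set z | S < `|z - c0|]); first exact: open_closedC.
    by apply/seteqP; split=> z /=; rewrite leNgt => /negP.
  + by apply/seteqP; split=> z [].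
  + apply/seteqP; split=> z [] /=; first by move=> /ltW.
    by move=> Fz; rewrite le_eqVlt => /predU1P[/Fbd|//]; rewrite Fz ltxx.
- exists c0; first by rewrite -cov; left.
  apply/esym/(@clopen_component _ _ _ inside (~` outside)) => //; [exact: connected_inside | exact: open_inside | exact: open_closedC open_outside | | ].
    by rewrite -cov; apply/seteqP; split=> z; [split => //; left | case].
  rewrite -cov; apply/seteqP; split=> z; first by move=> Iz; split; [left | exact: disj].
  by case=> -[].
- exists (c0 + (4 * S) *: dir 0); first by rewrite -cov; right.
  apply/esym/(@clopen_component _ _ _ outside (~` inside)) => //; [exact: connected_outside | exact: open_outside | exact: open_closedC open_inside | | ].
    by rewrite -cov; apply/seteqP; split=> z; [split => //; right | case].
  rewrite -cov; apply/seteqP; split=> z; first by move=> Iz; split; [right | move=> h; exact: (disj z)].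
  by case=> -[].
- by move=> E; apply: (disj c0) => //; rewrite -E.
Qed.

End Oval.

(** * Chebyshev polynomials *)

Section Chebyshev.
Context {R : realType}.
Implicit Types (x y th : R) (m : nat).

(** Two consecutive polynomials are carried along, so that the two-step recurrence becomes
    structural. *)
Fixpoint cheb_pair m : {poly R} * {poly R} :=
  if m is m'.+1 then
    let: (p, p') := cheb_pair m' in (p', 2%:P * 'X * p' - p)
  else (1, 'X).

Definition cheb m : {poly R} := (cheb_pair m).1.

Lemma cheb0 : cheb 0 = 1. Proof. by []. Qed.
Lemma cheb1 : cheb 1 = 'X. Proof. by []. Qed.
Lemma chebS m : cheb m.+2 = 2%:P * 'X * cheb m.+1 - cheb m.
Proof. by rewrite /cheb /=; case: (cheb_pair m). Qed.

Lemma cheb_ind (P : nat -> Prop) : P 0%N -> P 1%N -> (forall m, P m -> P m.+1 -> P m.+2) -> forall m, P m.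
Proof.
move=> P0 P1 PS m; suff : P m /\ P m.+1 by case.
by elim: m => [//|m [h1 h2]]; split => //; exact: PS.
Qed.

Lemma horner_chebS m x : (cheb m.+2).[x] = 2 * x * (cheb m.+1).[x] - (cheb m).[x].
Proof. by rewrite chebS !hornerE. Qed.

Lemma cheb_cos m th : (cheb m).[cos th] = cos (m%:R * th).
Proof.
elim/cheb_ind: m => [||m IH1 IH2].
- by rewrite cheb0 mul0r cos0 hornerE.
- by rewrite cheb1 mul1r hornerE.
rewrite horner_chebS IH1 IH2.
have -> : m.+2%:R * th = m.+1%:R * th + th by rewrite -natr1; ring.
have -> : m%:R * th = m.+1%:R * th - th by rewrite -natr1; ring.
rewrite (cosD _ th) (cosB _ th); ring.
Qed.

Lemma chebN m x : (cheb m).[- x] = (-1) ^+ m * (cheb m).[x].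
Proof.
elim/cheb_ind: m => [||m IH1 IH2].
- by rewrite cheb0 !hornerC expr0 mul1r.
- by rewrite cheb1 !hornerX expr1 mulN1r.
by rewrite !horner_chebS IH1 IH2 !exprS; ring.
Qed.

Lemma size_cheb m : size (cheb m) = m.+1 /\ lead_coef (cheb m) != 0.
Proof.
have sz : size (cheb m) = m.+1.
  elim/cheb_ind: m => [||m IH1 IH2].
  - by rewrite cheb0 size_poly1.
  - by rewrite cheb1 size_polyX.
  rewrite chebS -mulrA mul_polyC size_polyDl; rewrite size_scale ?pnatr_eq0//.
    by rewrite mulrC size_mulX ?IH2// -size_poly_eq0 IH2.
  by rewrite size_polyN IH1 mulrC size_mulX ?IH2// -size_poly_eq0 IH2.
by split => //; rewrite lead_coef_eq0 -size_poly_eq0 sz.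
Qed.

(** The increments on [[x, y]] grow with the degree. The induction needs the values and the
    increments together; the consequence wanted is slope at least 1 beyond 1 in positive degree. *)
Lemma cheb_slope m x y : 1 <= x -> x <= y ->
  [/\ 1 <= (cheb m).[y], 1 <= (cheb m.+1).[y], 0 <= (cheb m).[y] - (cheb m).[x] &
    (cheb m).[y] - (cheb m).[x] <= (cheb m.+1).[y] - (cheb m.+1).[x]].
Proof.
elim: m x y => [|m IH] x y x1 xy.
  by rewrite cheb0 cheb1 !hornerE; split; lra.
have [h1 h2 h3 h4] := IH x y x1 xy.
(* At the base point 1 all the polynomials equal 1, so this instance compares the values at [y] in
   consecutive degrees. *)
have [_ g2 g3 g4] := IH 1 y (lexx _) (le_trans x1 xy).
have one p : (cheb p).[1] = 1 by rewrite -cos0 cheb_cos mulr0.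
rewrite horner_chebS (horner_chebS m x).
move: g3 g4 h1 h2 h3 h4; rewrite !one.
set a := (cheb m).[y]; set a' := (cheb m).[x]; set b := (cheb m.+1).[y]; set b' := (cheb m.+1).[x].
move=> g3 g4 h1 h2 h3 h4; split => //; [nra | lra | ].
have : 0 <= (y - x) * b by rewrite mulr_ge0; lra.
have : 0 <= (x - 1) * (b - b') by rewrite mulr_ge0; lra.
nra.
Qed.

Lemma cheb_slope1 m x y : 1 <= x -> x <= y -> y - x <= (cheb m.+1).[y] - (cheb m.+1).[x].
Proof.
move=> x1 xy; elim: m => [|m IH]; first by rewrite cheb1 !hornerE.
by have [_ _ _] := cheb_slope m.+1 x1 xy; apply: le_trans.
Qed.

Lemma cheb_le1 m x : -1 <= x <= 1 -> `|(cheb m).[x]| <= 1.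
Proof. by move=> hx; rewrite -(acosK hx) cheb_cos ler_norml cos_geN1 cos_le1. Qed.

Lemma cheb_le2 m x : `|x| <= 2 -> `|(cheb m).[x]| <= (cheb m).[2].
Proof.
wlog x0 : x / 0 <= x => [H hx|].
  have [x0|x0] := leP 0 x; first exact: H.
  rewrite -[x]opprK chebN normrM normrX normrN1 expr1n mul1r; apply: H; first by lra.
  by rewrite normrN.
rewrite ger0_norm// => x2.
have [h1 _ _ _] := @cheb_slope m 1 2 (lexx _) (ler1n _ 2).
have [x1|x1] := leP x 1; first by apply: le_trans h1; apply: cheb_le1; lra.
have [g1 _ _ _] := @cheb_slope m 1 x (lexx _) (ltW x1).
have [_ _ g2 _] := cheb_slope m (ltW x1) x2.
by rewrite ger0_norm; lra.
Qed.

Lemma poly_lip (p : {poly R}) (B : R) : exists2 K : R, 0 < K &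
  forall x y, `|x| <= B -> `|y| <= B -> `|p.[x]| <= K /\ `|p.[x] - p.[y]| <= K * `|x - y|.
Proof.
elim/poly_ind: p => [|p a [K K0 IH]].
  by exists 1 => // x y _ _; rewrite !horner0 subrr normr0 mul1r.
exists (K * (`|B| + 1) + `|a| + K) => [|x y hx hy].
  by rewrite ltr_wpDl// addr_ge0// mulr_ge0 ?addr_ge0// ltW.
have [h1 h2] := IH x y hx hy; have [h3 _] := IH y y hy hy.
have xB : `|x| <= `|B| + 1 by have := ler_norm B; lra.
have yB : `|y| <= `|B| + 1 by have := ler_norm B; lra.
rewrite !hornerE; have a0 := normr_ge0 a; have x0 := normr_ge0 x; have B0 := normr_ge0 B.
have d0 := normr_ge0 (x - y).
split.
  apply: le_trans (ler_normD _ _) _; rewrite normrM.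
  have : `|p.[x]| * `|x| <= K * (`|B| + 1) by apply: ler_pM.
  lra.
have -> : p.[x] * x + a - (p.[y] * y + a) = (p.[x] - p.[y]) * x + p.[y] * (x - y) by ring.
apply: le_trans (ler_normD _ _) _; rewrite !normrM.
have : `|p.[x] - p.[y]| * `|x| <= K * `|x - y| * (`|B| + 1) by apply: ler_pM.
have : `|p.[y]| * `|x - y| <= K * `|x - y| by apply: ler_wpM2r.
have : 0 <= `|a| * `|x - y| by apply: mulr_ge0.
lra.
Qed.

End Chebyshev.

(** * The algebraic curve *)

Section CurvePoly.
Context {R : realType}.

Definition mon (a b : nat) : multinom 2 := Multinom [tuple a; b].

Lemma mon0 a b : mon a b ord0 = a. Proof. by []. Qed.
Lemma mon1 a b : mon a b ord_max = b. Proof. by []. Qed.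

Lemma mon_eq a b a' b' : (mon a b == mon a' b') = (a == a') && (b == b').
Proof.
apply/eqP/andP => [E|[/eqP-> /eqP->]//].
by rewrite -(mon0 a b) -(mon1 a b) E !eqxx.
Qed.

Lemma mdeg_mon a b : mdeg (mon a b) = (a + b)%N.
Proof. by rewrite mdegE big_ord_recl big_ord1. Qed.

Definition monom (a b : nat) : mpoly 2 R := mpolyX R (mon a b).

Lemma meval_monom (z : 'cV[R]_2) a b : meval (fun i => z i ord0) (monom a b) = xc z ^+ a * yc z ^+ b.
Proof.
rewrite mevalX big_ord_recl big_ord1; congr (_ ^+ _ * _ ^+ _).
by rewrite /yc; congr (z _ _); apply: val_inj.
Qed.

Definition curve_poly (sg kap e : R) (P Q : {poly R}) : mpoly 2 R :=
  sg *: (monom 0 1 - \sum_(i < size P) P`_i *: monom (2 * i) 0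
    - kap *: \sum_(i < size Q) Q`_i *: monom 1 i) - e *: monom 0 2.

Lemma meval_curve (sg kap e : R) (P Q : {poly R}) (z : 'cV[R]_2) :
  meval (fun i => z i ord0) (curve_poly sg kap e P Q) =
  sg * (yc z - P.[xc z ^+ 2] - kap * (xc z * Q.[yc z])) - e * yc z ^+ 2.
Proof.
have ms m (G : 'I_m -> mpoly 2 R) : meval (fun i => z i ord0) (\sum_i G i) = \sum_i meval (fun i => z i ord0) (G i).
  exact: raddf_sum.
rewrite /curve_poly mevalB !mevalZ !mevalB mevalZ !ms !meval_monom.
rewrite expr0 !mul1r expr1; congr (sg * (_ - _ - _) - _).
  rewrite horner_coef; apply: eq_bigr => i _.
  by rewrite mevalZ meval_monom expr0 mulr1 exprM.
congr (_ * _); rewrite horner_coef mulr_sumr; apply: eq_bigr => i _.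
by rewrite mevalZ meval_monom expr1 mulrCA.
Qed.

(** The monomial [x y^(n-1)] carries the degree: it occurs only in the term with [Q], with
    coefficient [- sg * kap * lead_coef Q]. *)
Lemma size_curve_poly (n : nat) (sg kap e : R) (P Q : {poly R}) :
  (2 < n)%N -> (2 * (size P).-1 <= n)%N -> size Q = n -> sg != 0 -> kap != 0 ->
  mmeasure mdeg (curve_poly sg kap e P Q) = n.+1.
Proof.
move=> n2 sP sQ sg0 kap0; apply/eqP; rewrite eqn_leq; apply/andP; split.
  have le (a b : mpoly 2 R) : (mmeasure mdeg a <= n.+1)%N -> (mmeasure mdeg b <= n.+1)%N -> (mmeasure mdeg (a - b) <= n.+1)%N.
    by move=> ha hb; apply: leq_trans (mmeasureD_le _ _ _) _; rewrite geq_max ha mmeasureN.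
  have leZ c (a : mpoly 2 R) : (mmeasure mdeg a <= n.+1)%N -> (mmeasure mdeg (c *: a) <= n.+1)%N.
    by apply: leq_trans; exact: mmeasureZ_le.
  have leX a b : (a + b <= n)%N -> (mmeasure mdeg (monom a b) <= n.+1)%N.
    by move=> h; rewrite mmeasureX -[X in (X < _)%N]/(mdeg (mon a b)) mdeg_mon.
  have leS (I : finType) (F : I -> mpoly 2 R) : (forall i, mmeasure mdeg (F i) <= n.+1)%N -> (mmeasure mdeg (\sum_i F i) <= n.+1)%N.
    by move=> h; apply: leq_trans (mmeasure_sum _ _ _ _) _; apply/bigmax_leqP.
  rewrite /curve_poly; apply: (le); last by apply: (leZ); apply: (leX); apply: ltnW.
  apply: (leZ); apply: (le); last by apply: (leZ); apply: (leS) => i; apply: (leZ); apply: (leX); rewrite add1n -sQ.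
  apply: (le); first by apply: (leX); apply: ltnW; apply: ltnW.
  apply: (leS) => i; apply: (leZ); apply: (leX); rewrite addn0.
  by apply: leq_trans sP; rewrite leq_mul2l /= -ltnS (leq_trans (ltn_ord i))// leqSpred.
rewrite -[n](@subnKC 1); last by apply: ltn_trans n2.
rewrite -mdeg_mon; apply: msize_mdeg_lt; rewrite mcoeff_msupp.
have ms k m (G : 'I_k -> mpoly 2 R) : mcoeff m (\sum_i G i) = \sum_i mcoeff m (G i).
  exact: raddf_sum.
rewrite /curve_poly mcoeffB !mcoeffZ !mcoeffB mcoeffZ !ms !mcoeffX !mon_eq /=.
rewrite big1; last by move=> i _; rewrite mcoeffZ mcoeffX mon_eq andbC; case: n n2 {sP sQ} => [|[|n]]//= _; rewrite mulr0.
have n1 : (n - 1 < size Q)%N by rewrite sQ subn1 ltn_predL; apply: ltn_trans n2.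
rewrite (bigD1 (Ordinal n1))//= big1; last first.
  move=> i ni; rewrite mcoeffZ mcoeffX mon_eq /=; case: eqP => [E|]; last by rewrite mulr0.
  by case/eqP: ni; apply: val_inj.
rewrite mcoeffZ mcoeffX mon_eq !eqxx /= mulr1 mulr0 !subr0 sub0r addr0.
rewrite mulf_neq0// oppr_eq0 mulf_neq0// subn1 -sQ -/(lead_coef Q) lead_coef_eq0 -size_poly_eq0 sQ.
by case: n n2 {sP sQ n1}.
Qed.

End CurvePoly.

(** * Star-shapedness of the curve *)

Section Star.
Context {R : realType} (sig : R -> R) (E : R -> R -> R) (C L S d kap : R).
Context (sig_slope : forall X' X, 3 <= X' -> X' <= X -> X - X' <= sig X - sig X').
Context (sig_le : forall X, 0 <= X <= 4 -> `|sig X| <= C).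
Context (sig_lip : forall X X', 0 <= X <= 4 -> 0 <= X' <= 4 -> `|sig X - sig X'| <= C * `|X - X'|).
Context (sig_far : forall X' X, 0 <= X' <= 4 -> 4 <= X -> sig X' <= sig X).
Context (E_le : forall x y, `|x| <= S -> `|y| <= S -> `|E x y| <= L).
Context (E_lip : forall x y x' y', `|x| <= S -> `|y| <= S -> `|x'| <= S -> `|y'| <= S ->
  `|E x y - E x' y'| <= L * (`|x - x'| + `|y - y'|)).
Context (d0 : 0 < d) (dC : d * C <= 1 / 2) (kap0 : 0 < kap) (kapL : kap * L <= 1 / 2).
Context (kapLS : kap * L * (2 * S) <= 1) (kapLd : kap * L * (2 * S) <= d).

(** The curve function in coordinates centred at [(0, 32 * sg)]: completing the square in
    [sg * y - y^2 / 64] yields [16 - y^2 / 64]. *)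
Definition bowl x y : R := 16 - y ^+ 2 / 64 - d * sig (x ^+ 2) - kap * E x y.

(** If [(l x)^2 >= 3], shrinking gains at least [3 d (1 - l)] from [sig], more than the perturbation
    can take. Otherwise, if [y^2 <= 512], the value is positive outright, the constant 16 losing at
    most [8 + 1/2 + 1/2]. Otherwise the square of [y] gains [8 (1 - l)], against losses of
    [4 (1 - l)] from [sig] and [1 - l] from the perturbation. *)
Lemma bowl_star x y l : `|x| <= S -> `|y| <= S -> 0 <= l < 1 -> 0 <= bowl x y ->
  0 < bowl (l * x) (l * y).
Proof.
move=> hx hy /andP[l0 l1] B; have [[[[[d0' dC'] kap0'] kapL'] kapLS'] kapLd'] := (d0, dC, kap0, kapL, kapLS, kapLd).
have lx : `|l * x| <= S by rewrite normrM ger0_norm//; have := normr_ge0 x; nra.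
have ly : `|l * y| <= S by rewrite normrM ger0_norm//; have := normr_ge0 y; nra.
have S0 : 0 <= S by apply: le_trans hx.
have ED : - ((1 - l) * (L * (2 * S))) <= E (l * x) (l * y) - E x y <= (1 - l) * (L * (2 * S)).
  rewrite -ler_norml; apply: le_trans (E_lip lx ly hx hy) _.
  have -> : l * x - x = - ((1 - l) * x) by ring.
  have -> : l * y - y = - ((1 - l) * y) by ring.
  rewrite !normrN !normrM (ger0_norm (_ : 0 <= 1 - l)); last by lra.
  have L0 : 0 <= L by apply: le_trans (normr_ge0 _) (E_le hx hy).
  rewrite -mulrDr mulrCA ler_wpM2l//; first by lra.
  by rewrite ler_wpM2l//; lra.
have kED : kap * (E (l * x) (l * y) - E x y) <= (1 - l) * (kap * L * (2 * S)).
  rewrite -mulrA mulrCA ler_pM2l//; lra.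
have k1 : (1 - l) * (kap * L * (2 * S)) <= 1 - l by rewrite -[leRHS]mulr1 ler_wpM2l//; lra.
have kd : (1 - l) * (kap * L * (2 * S)) <= (1 - l) * d by rewrite ler_wpM2l//; lra.
have diff : bowl (l * x) (l * y) = bowl x y + (1 - l ^+ 2) * y ^+ 2 / 64
    + d * (sig (x ^+ 2) - sig ((l * x) ^+ 2)) - kap * (E (l * x) (l * y) - E x y).
  by rewrite /bowl; field.
have X'E : (l * x) ^+ 2 = l ^+ 2 * x ^+ 2 by rewrite exprMn.
have X0 := sqr_ge0 x; have Y0 := sqr_ge0 y.
have l2 : l ^+ 2 <= l by nra.
have l20 := sqr_ge0 l.
have X'X : (l * x) ^+ 2 <= x ^+ 2 by rewrite X'E; nra.
have X'0 := sqr_ge0 (l * x).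
have [X3|X3] := leP 3 ((l * x) ^+ 2).
  have := sig_slope X3 X'X; rewrite {1}X'E.
  set a := sig _; set b := sig _ => H.
  have H3 : 3 * (1 - l) <= x ^+ 2 - l ^+ 2 * x ^+ 2 by nra.
  have : d * (3 * (1 - l)) <= d * (a - b) by rewrite ler_pM2l//; lra.
  have : 0 < d * (1 - l) by rewrite mulr_gt0//; lra.
  have : 0 <= (1 - l ^+ 2) * y ^+ 2 by rewrite mulr_ge0//; lra.
  by rewrite diff -/a -/b; lra.
have X'4 : 0 <= (l * x) ^+ 2 <= 4 by rewrite X'0; lra.
have [Y8|Y8] := leP (y ^+ 2) (8 * 64).
  have := sig_le X'4; rewrite ler_norml => /andP[_ s2].
  have := E_le lx ly; rewrite ler_norml => /andP[_ e2].
  have : d * sig ((l * x) ^+ 2) <= d * C by rewrite ler_pM2l.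
  have : kap * E (l * x) (l * y) <= kap * L by rewrite ler_pM2l.
  have : (l * y) ^+ 2 <= 8 * 64 by rewrite exprMn; nra.
  by rewrite /bowl; lra.
have Y9 : 8 * (1 - l) < (1 - l ^+ 2) * y ^+ 2 / 64.
  have : 0 <= (l - l ^+ 2) * y ^+ 2 by rewrite mulr_ge0//; lra.
  have : 0 < (1 - l) * (y ^+ 2 - 8 * 64) by rewrite mulr_gt0//; lra.
  by rewrite ltr_pdivlMr//; lra.
have sD : - (4 * (1 - l)) <= d * (sig (x ^+ 2) - sig ((l * x) ^+ 2)).
  have [X4|X4] := leP (x ^+ 2) 4; last first.
    have := sig_far X'4 (ltW X4) => H.
    have : 0 <= d * (sig (x ^+ 2) - sig ((l * x) ^+ 2)) by rewrite mulr_ge0 ?subr_ge0// ltW.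
    lra.
  have X44 : 0 <= x ^+ 2 <= 4 by rewrite X0.
  have := sig_lip X44 X'4; rewrite (ger0_norm (_ : 0 <= x ^+ 2 - (l * x) ^+ 2)) ?subr_ge0//.
  rewrite ler_norml => /andP[H _].
  have C0 : 0 <= C by apply: le_trans (normr_ge0 _) (sig_le X'4).
  have H8 : x ^+ 2 - (l * x) ^+ 2 <= 8 * (1 - l) by rewrite X'E; nra.
  have H9 : C * (x ^+ 2 - (l * x) ^+ 2) <= C * (8 * (1 - l)) by rewrite ler_wpM2l.
  have : d * - (C * (8 * (1 - l))) <= d * (sig (x ^+ 2) - sig ((l * x) ^+ 2)) by rewrite ler_pM2l//; lra.
  have : d * C * (8 * (1 - l)) <= 1 / 2 * (8 * (1 - l)) by rewrite ler_wpM2r//; lra.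
  lra.
rewrite diff; lra.
Qed.

(** On the vertical sides [d * sig (S ^+ 2)] is at least 17, which is the purpose of [17 / d] in the
    bound on [S]. On the horizontal sides [S >= 40] makes the square term at least 25. *)
Lemma bowl_border x y : 40 <= S -> 17 / d + 3 + C <= S -> `|x| <= S -> `|y| <= S ->
  `|x| = S \/ `|y| = S -> bowl x y < 0.
Proof.
move=> S40 Sd hx hy hS; have [[[d0' dC''] kap0'] kapL'] := (d0, dC, kap0, kapL).
have := E_le hx hy; rewrite ler_norml => /andP[e1 _].
have kE : - (1 / 2) <= kap * E x y by have : kap * - L <= kap * E x y by [rewrite ler_pM2l]; lra.
have dC' X : 0 <= X -> - (1 / 2) <= d * sig X.
  move=> X0; have : d * - C <= d * sig X; last by lra.
  rewrite ler_pM2l//; have [X4|X4] := leP X 4.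
    by have := sig_le (introT andP (conj X0 X4)); rewrite ler_norml => /andP[].
  have z4 : 0 <= (0 : R) <= 4 by rewrite lexx ler0n.
  have := sig_far z4 (ltW X4); have := sig_le z4; rewrite ler_norml => /andP[? _]; lra.
case: hS => hS.
  have X2 : x ^+ 2 = S ^+ 2 by rewrite -hS real_normK// num_real.
  have S3 : 3 <= S ^+ 2 by nra.
  have h34 : 0 <= (3 : R) <= 4 by lra.
  have := sig_slope (lexx 3) S3; have := sig_le h34; rewrite ler_norml => /andP[s3 _] sS.
  have SS : S <= S ^+ 2 by nra.
  have : d * (17 / d) <= d * sig (S ^+ 2) by rewrite ler_pM2l//; lra.
  rewrite mulrCA divff ?gt_eqF// mulr1 => H.
  by have := sqr_ge0 y; rewrite /bowl X2; lra.
have Y2 : y ^+ 2 = S ^+ 2 by rewrite -hS real_normK// num_real.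
have SS : 1600 <= S ^+ 2 by nra.
by have := dC' _ (sqr_ge0 x); rewrite /bowl Y2; lra.
Qed.

End Star.

(** * The curve as a graph near the origin *)

Section Graph.
Context {R : realType} (H : R -> R -> R) (eps : R) (e0 : 0 <= eps) (e1 : eps <= 1).
Context (H_y : forall x y y', `|x| <= 8 -> -8 <= y -> y <= y' -> y' <= 8 ->
  (y' - y) / 2 <= H x y' - H x y <= 3 / 2 * (y' - y)).
Context (H_x : forall x x' y, `|x| <= 8 -> `|x'| <= 8 -> `|y| <= 8 -> `|H x y - H x' y| <= eps / 2 * `|x - x'|).
Context (H_0 : forall x, `|x| <= 8 -> `|H x 0| <= eps / 2).

Definition graph_fun x := xget 0 [set y | `|y| <= eps /\ H x y = 0].

Lemma graph_funP x : `|x| <= 8 -> `|graph_fun x| <= eps /\ H x (graph_fun x) = 0.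
Proof.
move=> hx; have [e0' e1'] := (e0, e1); have := H_0 hx; rewrite ler_norml => /andP[h1 h2].
have D y y' : - eps <= y <= eps -> - eps <= y' <= eps -> `|H x y - H x y'| <= 3 / 2 * `|y - y'|.
  wlog yy : y y' / y <= y' => [HH hy hy'|].
    have [yy|yy] := leP y y'; first exact: HH.
    by rewrite distrC [ `|y - y'|]distrC; apply: HH => //; exact: ltW.
  move=> /andP[a1 a2] /andP[b1 b2].
  have /andP[k1 k2] : (y' - y) / 2 <= H x y' - H x y <= 3 / 2 * (y' - y) by apply: H_y; lra.
  by rewrite distrC [ `|y - y'|]distrC !ger0_norm//; lra.
have /andP[k1 _] : (0 - - eps) / 2 <= H x 0 - H x (- eps) <= 3 / 2 * (0 - - eps) by apply: H_y; lra.
have /andP[k2 _] : (eps - 0) / 2 <= H x eps - H x 0 <= 3 / 2 * (eps - 0) by apply: H_y; lra.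
have ee : - eps <= eps by lra.
have [|y] := @IVT _ (H x) (- eps) eps 0 ee (lip_within_continuous D).
  by rewrite ge_min le_max; apply/andP; split; apply/orP; [left|right]; lra.
rewrite in_itv/= -ler_norml => hy Hy.
have P : [set y | `|y| <= eps /\ H x y = 0] y by split.
exact: (xgetI 0 P).
Qed.

(** A mean value form obtained from difference quotients: it yields the sign of [H] on both sides of
    the graph as well as quantitative distances to it. *)
Lemma graph_fun_slope x y : `|x| <= 8 -> `|y| <= 8 ->
  exists2 m, 1 / 2 <= m <= 3 / 2 & H x y = m * (y - graph_fun x).
Proof.
have [e0' e1'] := (e0, e1).
move=> hx; rewrite ler_norml => /andP[y1 y2]; have [ge g0] := graph_funP hx.
move: ge; rewrite ler_norml => /andP[g1 g2]; set g := graph_fun x in g0 g1 g2 *.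
case: (ltgtP y g) => yg.
- have /andP[k1 k2] : (g - y) / 2 <= H x g - H x y <= 3 / 2 * (g - y) by apply: H_y; lra.
  exists (H x y / (y - g)); last by rewrite divfK// subr_eq0 lt_eqF.
  by rewrite ler_ndivlMr ?ler_ndivrMr ?subr_lt0//; lra.
- have /andP[k1 k2] : (y - g) / 2 <= H x y - H x g <= 3 / 2 * (y - g) by apply: H_y; lra.
  exists (H x y / (y - g)); last by rewrite divfK// subr_eq0 gt_eqF.
  by rewrite ler_pdivlMr ?ler_pdivrMr ?subr_gt0//; lra.
- by exists 1; [lra | rewrite yg g0 subrr mulr0].
Qed.

Lemma graph_fun_above x y : `|x| <= 8 -> `|y| <= 8 -> (0 < H x y) = (graph_fun x < y).
Proof.
by move=> hx hy; have [m hm ->] := graph_fun_slope hx hy; rewrite pmulr_rgt0 ?subr_gt0//; lra.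
Qed.

Lemma graph_fun_below x y : `|x| <= 8 -> `|y| <= 8 -> (H x y < 0) = (y < graph_fun x).
Proof.
by move=> hx hy; have [m hm ->] := graph_fun_slope hx hy; rewrite pmulr_rlt0 ?subr_lt0//; lra.
Qed.

Lemma graph_fun_lip x x' : `|x| <= 8 -> `|x'| <= 8 -> `|graph_fun x - graph_fun x'| <= eps * `|x - x'|.
Proof.
move=> hx hx'; have [e0' e1'] := (e0, e1); have [ge' g0'] := graph_funP hx'.
have g8 : `|graph_fun x'| <= 8 by lra.
have [m hm E] := graph_fun_slope hx g8; have := H_x hx hx' g8; rewrite g0' subr0 E normrM.
rewrite (distrC (graph_fun x')) (ger0_norm (_ : 0 <= m)); last by lra.
have : 0 <= (m - 1 / 2) * `|graph_fun x - graph_fun x'| by rewrite mulr_ge0//; lra.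
lra.
Qed.

End Graph.

(** Meets a finite list of upper constraints [d * a <= b] at once; all the small parameters are
    chosen in this way. *)
Lemma exists_small (R : realFieldType) (s : seq (R * R)) : all (fun p => 0 < p.2) s ->
  exists2 d : R, 0 < d & all (fun p => d * p.1 <= p.2) s.
Proof.
elim: s => [_|[a b] s IH /= /andP[b0 hs]]; first by exists 1.
have [d d0 hd] := IH hs.
have a1 : 0 < `|a| + 1 by rewrite ltr_wpDl.
exists (Num.min d (b / (`|a| + 1))); first by rewrite lt_min d0 divr_gt0.
set m := Num.min _ _; have m0 : 0 < m by rewrite lt_min d0 divr_gt0.
apply/andP; split.
  apply: le_trans (_ : m * (`|a| + 1) <= _); first by rewrite ler_pM2l//; have := ler_norm a; lra.
  by rewrite -ler_pdivlMr// ge_min lexx orbT.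
apply/allP => -[x y] xy; have /allP/(_ _ xy)/= := hd => H.
have y0 : 0 < y by have /allP/(_ _ xy) := hs.
have [x0|x0] := leP 0 x.
  by apply: le_trans H; apply: ler_wpM2r => //; rewrite ge_min lexx.
by apply: le_trans (ltW y0); rewrite pmulr_rle0// ltW.
Qed.

(** * Heights on a parabola through a given base point *)

Section Shift.
Context {R : realType} {f : R -> R} {c M eps la lb : R}.
Context (FG : flat_graph f c M eps la lb).

(** The point [(s * x, p)] lies on the parabola. Passing from the abscissa [s * x] to that of the
    intersection changes [f] by at most a 32nd of the shift, so the shift is the vertical gap at
    [s * x] up to a factor near 1. *)
Lemma height_shift s x p : s = 1 \/ s = -1 -> 0 <= x -> x < M -> `|p| <= eps -> la <= x ^+ 2 + 2 * p <= lb ->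
  exists2 m, 7 / 8 <= m <= 9 / 8 & height (f := f) (eps := eps) s (x ^+ 2 + 2 * p) - p = m * (f (s * x) - p).
Proof.
move=> sE x0 xM pe hl; set l := x ^+ 2 + 2 * p in hl *.
have [ue uf] := heightP FG sE hl; set u := height s l in ue uf *.
have /andP[lal llb] := hl.
have c0 := fg_c FG; have e0 := fg_eps0 FG; have e32 := fg_eps FG.
have xE : x = Num.sqrt (l - 2 * p) by rewrite /l addrK sqrtr_sqr ger0_norm.
have L := sqrt_lip c0 (label_sub_ge FG lal ue) (label_sub_ge FG lal pe).
rewrite -xE in L.
have B a : `|s * Num.sqrt a| = Num.sqrt a by rewrite normrM (norm_sign sE) mul1r ger0_norm// sqrtr_ge0.
have N1 : `|s * Num.sqrt (l - 2 * u)| < M by rewrite B; apply: (sqrt_label_lt FG llb ue).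
have N2 : `|s * x| < M by rewrite xE B -xE.
have := fg_lip FG N1 N2; rewrite -uf -mulrBr normrM (norm_sign sE) mul1r => F1.
have D : `|(u - p) - (f (s * x) - p)| <= `|u - p| / 32.
  have -> : u - p - (f (s * x) - p) = u - f (s * x) by ring.
  apply: le_trans F1 _; apply: le_trans (ler_wpM2l e0 L) _.
  have -> : l - 2 * u - (l - 2 * p) = - (2 * (u - p)) by ring.
  rewrite normrN normrM (ger0_norm (_ : 0 <= 2 :> R))// mulrA ler_pdivrMr; last by lra.
  by have := normr_ge0 (u - p); nra.
set g := f (s * x) - p in D *; set w := u - p in D *.
have [g0|g0] := eqVneq g 0.
  exists 1; first by lra.
  move: D; rewrite g0 subr0 mulr0 => D; apply/eqP; rewrite -normr_le0; have := normr_ge0 w; lra.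
exists (w / g); last by rewrite divfK.
have gw : `|w| <= `|g| * (32 / 31).
  have := ler_normD (w - g) g; rewrite subrK; lra.
have : `|w / g - 1| <= 1 / 8.
  have -> : w / g - 1 = (w - g) / g by field.
  have g1 : 0 < `|g| by rewrite normr_gt0.
  rewrite normrM normfV ler_pdivrMr//; lra.
by rewrite ler_norml; lra.
Qed.

End Shift.

Section Test.
Context {R : realType} {H : R -> R -> R} {c eps la lb : R}.
Context (e0 : 0 <= eps) (e1 : eps <= 1).
Context (H_y : forall x y y', `|x| <= 8 -> -8 <= y -> y <= y' -> y' <= 8 ->
  (y' - y) / 2 <= H x y' - H x y <= 3 / 2 * (y' - y)).
Context (H_0 : forall x, `|x| <= 8 -> `|H x 0| <= eps / 2).
Local Notation f := (graph_fun H eps).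
Context (FG : flat_graph f c 8 eps la lb).
Local Notation hgt := (@height R f eps).

(** With opposite values of [H] at the two symmetric points, the heights are [p + t1 * a] and
    [p - t2 * a], and their squares are subtracted. The factors are quotients of one in [[7/8, 9/8]]
    by one in [[1/2, 3/2]]. *)
Lemma test_diff x p a : 0 <= x -> x < 8 -> `|p| <= eps -> la <= x ^+ 2 + 2 * p <= lb ->
  H x p = - a -> H (- x) p = a ->
  exists t1 t2, [/\ 1 / 2 <= t1 <= 5 / 2, 1 / 2 <= t2 <= 5 / 2 &
   hgt 1 (x ^+ 2 + 2 * p) ^+ 2 - hgt (-1) (x ^+ 2 + 2 * p) ^+ 2 =
    2 * p * a * (t1 + t2) + a ^+ 2 * (t1 ^+ 2 - t2 ^+ 2)].
Proof.
move=> x0 x8 pe hl Hp Hm; have [e0' e1'] := (e0, e1).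
have p8 : `|p| <= 8 by lra.
have theta s b : s = 1 \/ s = -1 -> H (s * x) p = - b ->
    exists2 t, 1 / 2 <= t <= 5 / 2 & hgt s (x ^+ 2 + 2 * p) - p = t * b.
  move=> sE Hb; have [m /andP[m1 m2] ->] := height_shift FG sE x0 x8 pe hl.
  have sx : `|s * x| <= 8 by rewrite normrM (norm_sign sE) mul1r ger0_norm// ltW.
  have [m' /andP[m1' m2'] E] := graph_fun_slope e0 e1 H_y H_0 sx p8.
  exists (m / m'); first by rewrite ler_pdivlMr ?ler_pdivrMr; lra.
  have m0' : m' != 0 by rewrite gt_eqF//; lra.
  have -> : b = m' * (f (s * x) - p) by move: E; rewrite Hb => E; rewrite -[b]opprK E; ring.
  by field.
have [t1 h1 E1] := theta 1 a (or_introl erefl) (etrans (congr1 (H ^~ p) (mul1r x)) Hp).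
have [t2 h2 E2] : exists2 t, 1 / 2 <= t <= 5 / 2 & hgt (-1) (x ^+ 2 + 2 * p) - p = t * - a.
  by apply: theta; [right | rewrite mulN1r opprK].
exists t1, t2; split => //.
have -> : hgt 1 (x ^+ 2 + 2 * p) = p + t1 * a by rewrite -E1; ring.
have -> : hgt (-1) (x ^+ 2 + 2 * p) = p - t2 * a by move: E2; rewrite mulrN => E2; rewrite -E2; ring.
by ring.
Qed.

End Test.

(** The least possible value of [t1 ^+ 2 - t2 ^+ 2] is [-6], so the bound on [A] limits the loss to
    half of [b]. *)
Lemma theta_pos (R : realFieldType) (P A b t1 t2 : R) : 1 / 2 <= t1 <= 5 / 2 -> 1 / 2 <= t2 <= 5 / 2 ->
  0 <= b -> b <= P -> 0 <= A -> 12 * A <= b -> b / 2 <= P * (t1 + t2) + A * (t1 ^+ 2 - t2 ^+ 2).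
Proof.
move=> h1 h2 b0 bP A0 Ab.
have : P <= P * (t1 + t2) by rewrite ler_peMr; lra.
have : - 6 <= t1 ^+ 2 - t2 ^+ 2 by nra.
move: (t1 ^+ 2 - t2 ^+ 2) => d hd; have : A * - 6 <= A * d by rewrite ler_wpM2l.
lra.
Qed.

Lemma theta_neg (R : realFieldType) (P A b t1 t2 : R) : 1 / 2 <= t1 <= 5 / 2 -> 1 / 2 <= t2 <= 5 / 2 ->
  0 <= b -> P <= - b -> 0 <= A -> 12 * A <= b -> P * (t1 + t2) + A * (t1 ^+ 2 - t2 ^+ 2) <= 0.
Proof.
move=> h1 h2 b0 bP A0 Ab; have P' : b <= - P by lra.
by have := theta_pos h2 h1 b0 P' A0 Ab; lra.
Qed.

Lemma theta_abs (R : realFieldType) (P A b t1 t2 : R) : 1 / 2 <= t1 <= 5 / 2 -> 1 / 2 <= t2 <= 5 / 2 ->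
  P <= b -> 0 <= b -> 0 <= A -> P * (t1 + t2) + A * (t1 ^+ 2 - t2 ^+ 2) <= 5 * b + 6 * A.
Proof.
move=> h1 h2 Pb b0 A0.
have : P * (t1 + t2) <= b * (t1 + t2) by rewrite ler_wpM2r//; lra.
have : b * (t1 + t2) <= b * 5 by rewrite ler_wpM2l//; lra.
have : t1 ^+ 2 - t2 ^+ 2 <= 6 by nra.
move: (t1 ^+ 2 - t2 ^+ 2) => d hd; have : A * d <= A * 6 by rewrite ler_wpM2l.
lra.
Qed.

(** * The piecewise linear system on the oval *)

Lemma norm_lt (R : realType) (z : 'cV[R]_2) (S : R) : `|xc z| < S -> `|yc z| < S -> `|z| < S.
Proof.
move=> hx hy; have S0 : 0 < S by apply: le_lt_trans hx.
rewrite [ltLHS]/Num.Def.normr/= mx_normrE; apply/bigmax_ltP; split => //.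
move=> [i j] _ /=; rewrite ord1.
have [->|->] : i = ord0 \/ i = ord_max.
  by case: i => [[|[|//]] i2]; [left|right]; apply: val_inj.
  exact: hx.
exact: hy.
Qed.

Definition mat2 (R : realType) (a b c d : R) : 'M[R]_2 :=
  \matrix_(i, j) (if i == ord0 then if j == ord0 then a else b else if j == ord0 then c else d).

Lemma mat2_mul (R : realType) (a b c d : R) (z : 'cV[R]_2) :
  mat2 a b c d *m z = vec2 (a * xc z + b * yc z) (c * xc z + d * yc z).
Proof.
have o1 : lift ord0 ord0 = ord_max :> 'I_2 by apply: val_inj.
by apply: vec2P; rewrite ?xc_vec2 ?yc_vec2 /xc /yc mxE big_ord_recl big_ord1 !mxE o1.
Qed.

Section System.
Context {R : realType} (n : nat) (sg d kap C L S eps : R) (tau : R -> R) (P Q : {poly R}).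
Context (sgE : sg = 1 \/ sg = -1) (HP : forall X, P.[X] = d * tau X).
Context (n2 : (2 < n)%N) (sizeP : (2 * (size P).-1 <= n)%N) (sizeQ : size Q = n).
Local Notation sig := (fun X => sg * tau X).
Local Notation E := (fun x y => sg * (x * Q.[y + 32 * sg])).
Context (sig_slope : forall X' X, 3 <= X' -> X' <= X -> X - X' <= sig X - sig X').
Context (sig_le : forall X, 0 <= X <= 4 -> `|sig X| <= C).
Context (sig_lip : forall X X', 0 <= X <= 4 -> 0 <= X' <= 4 -> `|sig X - sig X'| <= C * `|X - X'|).
Context (sig_far : forall X' X, 0 <= X' <= 4 -> 4 <= X -> sig X' <= sig X).
Context (E_le : forall x y, `|x| <= S -> `|y| <= S -> `|E x y| <= L).
Context (E_lip : forall x y x' y', `|x| <= S -> `|y| <= S -> `|x'| <= S -> `|y'| <= S ->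
  `|E x y - E x' y'| <= L * (`|x - x'| + `|y - y'|)).
Context (d0 : 0 < d) (dC : d * C <= 1 / 2) (kap0 : 0 < kap) (kapL : kap * L <= 1 / 2).
Context (kapLS : kap * L * (2 * S) <= 1) (kapLd : kap * L * (2 * S) <= d).
Context (S40 : 40 <= S) (Sd : 17 / d + 3 + C <= S).
Context (e0 : 0 <= eps) (e1 : eps <= 1).

(** The curve function multiplied by [sg]: positive above the graph for either sign, whereas the
    curve function is positive inside the oval. *)
Definition profile x y : R := y - sg * y ^+ 2 / 64 - P.[x ^+ 2] - kap * (x * Q.[y]).

Context (H_y : forall x y y', `|x| <= 8 -> -8 <= y -> y <= y' -> y' <= 8 ->
  (y' - y) / 2 <= profile x y' - profile x y <= 3 / 2 * (y' - y)).
Context (H_x : forall x x' y, `|x| <= 8 -> `|x'| <= 8 -> `|y| <= 8 ->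
  `|profile x y - profile x' y| <= eps / 2 * `|x - x'|).
Context (H_0 : forall x, `|x| <= 8 -> `|profile x 0| <= eps / 2).

Local Notation cpoly := (curve_poly sg kap (1 / 64) P Q).
Definition curve_fun (z : 'cV[R]_2) : R := meval (fun i => z i ord0) cpoly.
Local Notation F := curve_fun.
Local Notation c0 := (vec2 0 (32 * sg) : 'cV[R]_2).

Let sg2 : sg * sg = 1. Proof. by case: sgE => ->; rewrite ?mulrNN mulr1. Qed.

Let F_profile z : F z = sg * profile (xc z) (yc z).
Proof.
rewrite /curve_fun meval_curve /profile.
have -> : sg * (yc z - sg * yc z ^+ 2 / 64 - P.[xc z ^+ 2] - kap * (xc z * Q.[yc z])) =
  sg * (yc z - P.[xc z ^+ 2] - kap * (xc z * Q.[yc z])) - (sg * sg) / 64 * yc z ^+ 2 by field.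
by rewrite sg2.
Qed.

Let F_bowl z : F z = bowl sig E d kap (xc z) (yc z - 32 * sg).
Proof.
rewrite /curve_fun meval_curve /bowl /= subrK HP.
have -> : (yc z - 32 * sg) ^+ 2 = yc z ^+ 2 - 64 * (sg * yc z) + 1024 * (sg * sg) by ring.
by rewrite sg2; field.
Qed.

Let F_continuous : continuous F.
Proof.
rewrite (_ : F = fun z => sg * (yc z - P.[xc z ^+ 2] - kap * (xc z * Q.[yc z])) - 1 / 64 * (yc z * yc z)); last first.
  by apply/funext => z; rewrite /curve_fun meval_curve expr2.
have cx := @xc_continuous R; have cy := @yc_continuous R.
have cst (a : R) : continuous (fun _ : 'cV[R]_2 => a) by exact: cst_continuous.
move=> z; apply: (@continuousB _ _ _ (fun z => sg * (yc z - P.[xc z ^+ 2] - kap * (xc z * Q.[yc z]))) (fun z => 1 / 64 * (yc z * yc z))); last first.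
  apply: (@continuousM _ _ (fun=> 1 / 64) (fun z => yc z * yc z)); first exact: cst.
  by apply: continuousM; exact: cy.
apply: (@continuousM _ _ (fun=> sg) (fun z => yc z - P.[xc z ^+ 2] - kap * (xc z * Q.[yc z]))); first exact: cst.
apply: (@continuousB _ _ _ (fun z => yc z - P.[xc z ^+ 2]) (fun z => kap * (xc z * Q.[yc z]))).
  apply: (@continuousB _ _ _ yc (fun z => P.[xc z ^+ 2])); first exact: cy.
  apply: (@continuous_comp _ _ _ (fun z => xc z ^+ 2) (fun x => P.[x])); last exact: continuous_horner.
  by rewrite (_ : (fun z => _) = fun z => xc z * xc z); [apply: continuousM; exact: cx | apply/funext => w; rewrite expr2].
apply: (@continuousM _ _ (fun=> kap) (fun z => xc z * Q.[yc z])); first exact: cst.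
apply: (@continuousM _ _ xc (fun z => Q.[yc z])); first exact: cx.
by apply: (@continuous_comp _ _ _ yc (fun x => Q.[x])); [exact: cy | exact: continuous_horner].
Qed.

Let xc_c0 z : xc (z - c0) = xc z. Proof. by rewrite xcD xcN xc_vec2 subr0. Qed.
Let yc_c0 z : yc (z - c0) = yc z - 32 * sg. Proof. by rewrite ycD ycN yc_vec2. Qed.

Let F_star z l : `|z - c0| <= S -> 0 <= F z -> 0 <= l < 1 -> 0 < F (c0 + l *: (z - c0)).
Proof.
move=> zS Fz hl.
have hx : `|xc z| <= S by rewrite -xc_c0; apply: le_trans (xc_norm _) zS.
have hy : `|yc z - 32 * sg| <= S by rewrite -yc_c0; apply: le_trans (yc_norm _) zS.
rewrite F_bowl in Fz; rewrite F_bowl.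
have -> : xc (c0 + l *: (z - c0)) = l * xc z by rewrite xcD xcZ xc_c0 xc_vec2 add0r.
have -> : yc (c0 + l *: (z - c0)) - 32 * sg = l * (yc z - 32 * sg) by rewrite ycD ycZ yc_c0 yc_vec2; ring.
exact: (bowl_star sig_slope sig_le sig_lip sig_far E_le E_lip).
Qed.

Let F_border z : `|z - c0| = S -> F z < 0.
Proof.
move=> zS; rewrite F_bowl.
have hx : `|xc z| <= S by rewrite -xc_c0 -zS; exact: xc_norm.
have hy : `|yc z - 32 * sg| <= S by rewrite -yc_c0 -zS; exact: yc_norm.
apply: (bowl_border sig_slope sig_le sig_far E_le d0 dC kap0 kapL S40 Sd hx hy).
move: hx hy; rewrite !le_eqVlt => /predU1P[->|hx]; first by left.
move=> /predU1P[->|hy]; first by right.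
by have := @norm_lt R (z - c0) S; rewrite xc_c0 yc_c0 zS ltxx => /(_ hx hy).
Qed.

Let S_gt0 : 0 < S. Proof. by have := S40; lra. Qed.

Let F_center : 0 < F c0.
Proof.
rewrite F_bowl xc_vec2 yc_vec2 subrr /bowl.
have z4 : 0 <= (0 : R) ^+ 2 <= 4 by rewrite expr0n/= lexx ler0n.
have S0 : `|0 : R| <= S by rewrite normr0 ltW.
have [[[d0' dC'] kap0'] kapL'] := (d0, dC, kap0, kapL).
have := sig_le z4; rewrite ler_norml => /andP[_ s2].
have := E_le S0 S0; rewrite ler_norml => /andP[_ e2].
have : d * (sg * tau (0 ^+ 2)) <= d * C by rewrite ler_pM2l.
have : kap * (sg * (0 * Q.[0 + 32 * sg])) <= kap * L by rewrite ler_pM2l.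
by rewrite expr0n/=; lra.
Qed.

(** For [sg = 1] the oval lies above the origin and its inside is the upper zone; for [sg = -1] it
    hangs below and the two zones exchange roles. *)
Lemma system_exists (mu c : R) : 0 < c -> c <= 1 -> 32 * eps <= c -> 0 < mu -> 4 * mu <= c -> mu * 8 <= 1 ->
  exists Z : pwl_system R n, graph_system Z (graph_fun profile eps) mu c 8 eps.
Proof.
move=> c0' c1 ec mu0 muc mu8.
have sg0 : sg != 0 by case: sgE => ->; rewrite ?oppr_eq0 oner_eq0.
have sz := size_curve_poly (1 / 64) n2 sizeP sizeQ sg0 (lt0r_neq0 kap0).
have [cB cI cO IO cov] := oval_components F_continuous S_gt0 F_center F_star F_border.
have oI : open (inside F c0 S) by exact: open_inside F_continuous.
have oO : open (outside F c0 S) by exact: open_outside F_continuous F_border.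
have ball z : `|xc z| < 8 -> `|yc z| < 8 -> `|z - c0| < S.
  move=> hx hy; have S40' := S40; apply: norm_lt; rewrite ?xc_c0 ?yc_c0; first by lra.
  by move: hy; rewrite !ltr_norml; case: sgE => ->; lra.
have insE z : `|xc z| < 8 -> `|yc z| < 8 -> inside F c0 S z <-> 0 < F z.
  by move=> hx hy; split=> [[]//|Fz]; split => //; exact: ball.
have outE z : `|xc z| < 8 -> `|yc z| < 8 -> outside F c0 S z <-> F z < 0.
  move=> hx hy; split=> [[|//]|Fz]; last by right.
  by rewrite leNgt ball.
have up z : `|xc z| < 8 -> `|yc z| < 8 -> (0 < profile (xc z) (yc z)) = (graph_fun profile eps (xc z) < yc z).
  by move=> hx hy; apply: graph_fun_above => //; exact: ltW.
have dn z : `|xc z| < 8 -> `|yc z| < 8 -> (profile (xc z) (yc z) < 0) = (yc z < graph_fun profile eps (xc z)).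
  by move=> hx hy; apply: graph_fun_below => //; exact: ltW.
have dIO z : inside F c0 S z -> outside F c0 S z -> False.
  by move=> [zS Fz] [|]; [rewrite leNgt zS | move/(lt_trans Fz); rewrite ltxx].
have fX z : mat2 0 0 1 0 *m z + vec2 (-1) 0 = vec2 (-1) (xc z) :> 'cV[R]_2.
  by rewrite mat2_mul; apply: vec2P; rewrite ?xcD ?ycD ?xc_vec2 ?yc_vec2; ring.
have fY z : mat2 mu (-1) 1 mu *m z + vec2 (-1) mu = vec2 (mu * xc z - (yc z + 1)) (xc z + mu * (yc z + 1)) :> 'cV[R]_2.
  by rewrite mat2_mul; apply: vec2P; rewrite ?xcD ?ycD ?xc_vec2 ?yc_vec2; ring.
have flip x x' : `|x| < 8 -> `|x'| < 8 -> `|graph_fun profile eps x - graph_fun profile eps x'| <= eps * `|x - x'|.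
  by move=> hx hx'; apply: graph_fun_lip => //; exact: ltW.
have fle x : `|x| < 8 -> `|graph_fun profile eps x| <= eps.
  by move=> hx; have [] := graph_funP e0 e1 H_y H_0 (ltW hx).
have e4 : 4 <= 8 :> R by lra.
case: (sgE) => sE.
  exists (@PwlSystem R n cpoly (oval F c0 S) (inside F c0 S) (outside F c0 S) (mat2 0 0 1 0) (vec2 (-1) 0)
    (mat2 mu (-1) 1 mu) (vec2 (-1) mu) sz cB cI cO IO cov).
  split => //= z hx hy.
    by rewrite -up//; have Fz := F_profile z; rewrite sE mul1r in Fz; rewrite -Fz; exact: (insE z hx hy).
  by rewrite -dn//; have Fz := F_profile z; rewrite sE mul1r in Fz; rewrite -Fz; exact: (outE z hx hy).
have cov' : outside F c0 S `|` inside F c0 S = ~` oval F c0 S by rewrite setUC.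
have OI : outside F c0 S <> inside F c0 S by move=> h; apply: IO.
exists (@PwlSystem R n cpoly (oval F c0 S) (outside F c0 S) (inside F c0 S) (mat2 0 0 1 0) (vec2 (-1) 0)
    (mat2 mu (-1) 1 mu) (vec2 (-1) mu) sz cB cO cI OI cov').
split => //=; first by move=> z h1 h2; exact: (dIO z).
  move=> z hx hy; rewrite -up//; have Fz := F_profile z; rewrite sE mulN1r in Fz.
  by rewrite -oppr_lt0 -Fz; exact: (outE z hx hy).
move=> z hx hy; rewrite -dn//; have Fz := F_profile z; rewrite sE mulN1r in Fz.
by rewrite -oppr_gt0 -Fz; exact: (insE z hx hy).
Qed.

End System.

(** * Sign changes of the level function *)

Lemma ex_gap (R : realType) (h : nat -> R) (m : nat) : (forall j, (j < m)%N -> 0 < h j) ->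
  exists2 g : R, 0 < g & forall j, (j < m)%N -> g <= h j.
Proof.
elim: m => [_|m IH H]; first by exists 1.
have [g g0 hg] : exists2 g : R, 0 < g & forall j, (j < m)%N -> g <= h j.
  by apply: IH => j jm; apply: H; exact: ltnW.
exists (Num.min g (h m)) => [|j]; first by rewrite lt_min g0 H.
rewrite ltnS leq_eqVlt => /predU1P[->|/hg hj]; first by rewrite ge_min lexx orbT.
by rewrite ge_min hj.
Qed.

Lemma cos_natpi (R : realType) (j : nat) : cos (j%:R * pi) = (-1) ^+ j :> R.
Proof.
elim: j => [|j IH]; first by rewrite mul0r cos0 expr0.
by rewrite -natr1 mulrDl mul1r cosDpi IH exprS mulN1r.
Qed.

Section Nodes.
Context {R : realType} (k n : nat) (k0 : (0 < k)%N) (n0 : (0 < n)%N).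

(** Values of [X = x^2] for which [2 - X] is an extremal point of [T_(k n)]; the shift by 2 places
    them in [[1, 3]], away from 0. *)
Definition node (j : nat) : R := 2 - cos (j%:R * (pi / (k * n)%:R)).

Lemma node_itv j : 1 <= node j <= 3.
Proof. by rewrite /node; have := cos_geN1 (j%:R * (pi / (k * n)%:R) : R); have := cos_le1 (j%:R * (pi / (k * n)%:R) : R); lra. Qed.

Let kn0 : 0 < (k * n)%:R :> R. Proof. by rewrite ltr0n muln_gt0 k0. Qed.


Lemma node_lt j : (j < k * n)%N -> node j < node j.+1.
Proof.
move=> jkn; rewrite /node ltrD2l ltrN2; have p0 := pi_gt0 R.
have st : 0 < pi / (k * n)%:R :> R by rewrite divr_gt0.
have inI i : (i <= k * n)%N -> i%:R * (pi / (k * n)%:R) \in `[0 : R, pi].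
  move=> ikn; rewrite in_itv/= mulr_ge0 ?(ltW st)//=.
  by rewrite mulrA ler_pdivrMr// mulrC ler_pM2l// ler_nat.
by rewrite ltr_cos ?inI//; [rewrite ltr_pM2r// ltr_nat | exact: ltnW].
Qed.

Lemma cheb_node j : (cheb k).[2 - node j] = cos (j%:R * (pi / n%:R)) :> R.
Proof.
rewrite /node opprB addrC subrK cheb_cos; congr cos.
have kR : k%:R != 0 :> R by rewrite pnatr_eq0 -lt0n.
have nR : n%:R != 0 :> R by rewrite pnatr_eq0 -lt0n.
by rewrite natrM; field; rewrite kR nR.
Qed.

Lemma cheb_node_alt j : (cheb n).[cos (j%:R * (pi / n%:R))] = (-1) ^+ j :> R.
Proof.
rewrite cheb_cos -cos_natpi; congr cos.
have nR : n%:R != 0 :> R by rewrite pnatr_eq0 -lt0n.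
by field.
Qed.

(** Only the quotient [q] enters the curve. The missing factor [w - w0] is supplied by the base
    height, through the factor [u + v] of [u^2 - v^2]. The root taken is [cos (pi / (2 n))]. *)
Lemma cheb_factor : exists w0 : R, exists q : {poly R},
  [/\ `|w0| <= 1, size q = n & forall w, (cheb n).[w] = q.[w] * (w - w0)].
Proof.
pose w0 : R := cos (pi / 2 / n%:R).
have rt : root (cheb n) w0.
  rewrite rootE cheb_cos mulrC divfK ?pnatr_eq0 -?lt0n//; first by rewrite cos_pihalf.
have [q Eq] := factor_theorem _ _ rt; exists w0, q; split.
- by rewrite ler_norml cos_geN1 cos_le1.
- have [sz _] := @size_cheb R n.
  have q0 : q != 0 by apply/eqP => q0; move: sz; rewrite Eq q0 mul0r size_poly0.
  by move: sz; rewrite Eq size_Mmonic ?monicXsubC// size_XsubC addn2 /= => -[].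
- by move=> w; rewrite Eq hornerM !hornerE.
Qed.

End Nodes.

Section Profile.
Context {R : realType} (sg d kap C KQ eps : R) (tau : R -> R) (P Q : {poly R}).
Context (sgE : sg = 1 \/ sg = -1) (HP : forall X, P.[X] = d * tau X).
Context (tau_le : forall X, 0 <= X <= 64 -> `|tau X| <= C).
Context (tau_lip : forall X X', 0 <= X <= 64 -> 0 <= X' <= 64 -> `|tau X - tau X'| <= C * `|X - X'|).
Context (Q_le : forall y, `|y| <= 8 -> `|Q.[y]| <= KQ).
Context (Q_lip : forall y y', `|y| <= 8 -> `|y'| <= 8 -> `|Q.[y] - Q.[y']| <= KQ * `|y - y'|).
Context (d0 : 0 < d) (kap0 : 0 < kap) (dC : d * (64 * C) <= eps).
Context (kQ : kap * (8 * KQ) <= 1 / 8) (kQe : kap * (8 * KQ) <= eps / 4).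

Local Notation prof := (profile sg kap P Q).

Let sqr64 (x : R) : `|x| <= 8 -> 0 <= x ^+ 2 <= 64.
Proof. by rewrite ler_norml => /andP[h1 h2]; rewrite sqr_ge0 /=; nra. Qed.

(** For [|y| <= 8] the quadratic term changes the slope 1 by at most [1 / 4], and the odd
    perturbation by at most [1 / 8]. *)
Lemma profile_y x y y' : `|x| <= 8 -> -8 <= y -> y <= y' -> y' <= 8 ->
  (y' - y) / 2 <= prof x y' - prof x y <= 3 / 2 * (y' - y).
Proof.
move=> hx y8 yy y8'.
have hy : `|y| <= 8 by rewrite ler_norml; lra.
have hy' : `|y'| <= 8 by rewrite ler_norml; lra.
have -> : prof x y' - prof x y = (y' - y) - sg * (y + y') * (y' - y) / 64 - kap * (x * (Q.[y'] - Q.[y])).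
  by rewrite /profile; field.
have D0 : 0 <= y' - y by lra.
have B1 : `|kap * (x * (Q.[y'] - Q.[y]))| <= 1 / 8 * (y' - y).
  rewrite normrM (gtr0_norm kap0) normrM.
  have := Q_lip hy' hy; rewrite (ger0_norm D0) => HQ.
  apply: le_trans (_ : kap * (8 * (KQ * (y' - y))) <= _).
    by rewrite ler_pM2l//; apply: ler_pM.
  have -> : kap * (8 * (KQ * (y' - y))) = kap * (8 * KQ) * (y' - y) by ring.
  exact: ler_wpM2r.
have B2 : `|sg * (y + y') * (y' - y) / 64| <= 1 / 4 * (y' - y).
  rewrite !normrM (norm_sign sgE) mul1r (ger0_norm D0) (ger0_norm (_ : 0 <= 64^-1 :> R)) ?invr_ge0//.
  have : `|y + y'| <= 16 by apply: le_trans (ler_normD _ _) _; lra.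
  have := normr_ge0 (y + y'); nra.
by move: B1 B2; rewrite ler_norml => /andP[h1 h2]; rewrite ler_norml; lra.
Qed.

Lemma profile_x x x' y : `|x| <= 8 -> `|x'| <= 8 -> `|y| <= 8 ->
  `|prof x y - prof x' y| <= eps / 2 * `|x - x'|.
Proof.
move=> hx hx' hy; have [[[d0' kap0'] dC'] kQe'] := (d0, kap0, dC, kQe).
have -> : prof x y - prof x' y = - (d * (tau (x ^+ 2) - tau (x' ^+ 2))) - kap * ((x - x') * Q.[y]).
  by rewrite /profile !HP; ring.
apply: le_trans (ler_normB _ _) _; rewrite normrN !normrM (gtr0_norm d0) (gtr0_norm kap0).
have T := tau_lip (sqr64 hx) (sqr64 hx'); rewrite subr_sqr normrM in T.
have C0 : 0 <= C.
  by have := tau_le (sqr64 hx); apply: le_trans.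
have x16 : `|x + x'| <= 16 by apply: le_trans (ler_normD _ _) _; lra.
have D0 := normr_ge0 (x - x').
have T1 : `|tau (x ^+ 2) - tau (x' ^+ 2)| <= C * (`|x - x'| * 16).
  by apply: le_trans T _; rewrite ler_wpM2l// ler_wpM2l.
have T2 : d * `|tau (x ^+ 2) - tau (x' ^+ 2)| <= d * (C * (`|x - x'| * 16)) by rewrite ler_pM2l.
have T3 : kap * (`|x - x'| * `|Q.[y]|) <= kap * (`|x - x'| * KQ) by rewrite ler_pM2l// ler_wpM2l// Q_le.
have T4 : d * (64 * C) * `|x - x'| <= eps * `|x - x'| by rewrite ler_wpM2r.
have KQ0 : 0 <= KQ by apply: le_trans (Q_le hy).
have T5 : kap * (8 * KQ) * `|x - x'| <= eps / 4 * `|x - x'| by rewrite ler_wpM2r.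
have T6 : 0 <= kap * KQ * `|x - x'| by rewrite mulr_ge0// mulr_ge0// ltW.
lra.
Qed.

Lemma profile_0 x : `|x| <= 8 -> `|prof x 0| <= eps / 2.
Proof.
move=> hx; have [[[d0' kap0'] dC'] kQe'] := (d0, kap0, dC, kQe).
have -> : prof x 0 = - (d * tau (x ^+ 2)) - kap * (x * Q.[0]) by rewrite /profile HP expr0n/=; ring.
apply: le_trans (ler_normB _ _) _; rewrite normrN !normrM (gtr0_norm d0) (gtr0_norm kap0).
have z8 : `|0 : R| <= 8 by rewrite normr0.
have T1 : d * `|tau (x ^+ 2)| <= d * C by rewrite ler_pM2l// tau_le// sqr64.
have T2 : kap * (`|x| * `|Q.[0]|) <= kap * (8 * KQ) by rewrite ler_pM2l//; apply: ler_pM => //; exact: Q_le.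
have C0 : 0 <= d * C by apply: mulr_ge0; [exact: ltW | apply: le_trans (tau_le (sqr64 hx))].
lra.
Qed.

(** At this height the even part of the profile vanishes at both abscissas of square [X], and only
    the odd term remains, with opposite values. *)
Lemma base_point X : 0 <= X <= 64 -> d * (2 * C) <= 1 ->
  exists p, `|p| <= d * (2 * C) /\ p - sg * p ^+ 2 / 64 = d * tau X.
Proof.
move=> hX dC1; have C0 : 0 <= C by apply: le_trans (tau_le hX).
set B := d * (2 * C) in dC1 *; have B0 : 0 <= B by rewrite mulr_ge0 ?(ltW d0)// mulr_ge0.
have dt : - (B / 2) <= d * tau X <= B / 2.
  have := tau_le hX; rewrite ler_norml => /andP[h1 h2].
  have : d * tau X <= d * C by rewrite ler_pM2l.
  have : d * - C <= d * tau X by rewrite ler_pM2l.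
  by rewrite /B; lra.
pose g y : R := y - sg * y ^+ 2 / 64.
have gL s t : - B <= s <= B -> - B <= t <= B -> `|g s - g t| <= 2 * `|s - t|.
  move=> hs ht; have -> : g s - g t = (s - t) * (1 - sg * (s + t) / 64) by rewrite /g; field.
  rewrite normrM mulrC ler_wpM2r// ler_norml.
  by case: sgE => ->; lra.
have BB : - B <= B by lra.
have B2 : B ^+ 2 <= B by nra.
have B20 := sqr_ge0 B.
have [|p] := @IVT _ g (- B) B (d * tau X) BB (lip_within_continuous gL).
  rewrite ge_min le_max /g sqrrN.
  by apply/andP; split; apply/orP; [left|right]; case: sgE => ->; lra.
by rewrite in_itv/= -ler_norml => hp E; exists p.
Qed.

End Profile.

Section TestLevels.
Context {R : realType} (n : nat) (sg d kap C KQ eps w0 x0 Kn Kq : R) (tau : R -> R) (P Q q : {poly R}).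
Context (sgE : sg = 1 \/ sg = -1) (HP : forall X, P.[X] = d * tau X).
Context (HQ : forall y, Q.[y] = d * q.[y / d + w0]).
Context (Hq : forall w, (cheb n).[w] = q.[w] * (w - w0)).
Context (tau_le : forall X, 0 <= X <= 64 -> `|tau X| <= C).
Context (tau_lip : forall X X', 0 <= X <= 64 -> 0 <= X' <= 64 -> `|tau X - tau X'| <= C * `|X - X'|).
Context (Q_le : forall y, `|y| <= 8 -> `|Q.[y]| <= KQ).
Context (Q_lip : forall y y', `|y| <= 8 -> `|y'| <= 8 -> `|Q.[y] - Q.[y']| <= KQ * `|y - y'|).
Context (d0 : 0 < d) (kap0 : 0 < kap) (dC : d * (64 * C) <= eps).
Context (kQ : kap * (8 * KQ) <= 1 / 8) (kQe : kap * (8 * KQ) <= eps / 4).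
Context (Kn_le : forall w w', `|w| <= 2 * C + 1 -> `|w'| <= 2 * C + 1 ->
  `|(cheb n).[w]| <= Kn /\ `|(cheb n).[w] - (cheb n).[w']| <= Kn * `|w - w'|).
Context (Kq_le : forall w, `|w| <= 2 * C + 1 -> `|q.[w]| <= Kq).
Context (dKn : d * (Kn * C ^+ 2) <= 1 / 2) (kKq : kap * (36 * Kq ^+ 2) <= 1) (w01 : `|w0| <= 1).
Context (x00 : 0 < x0) (x01 : x0 <= 1 / 2) (epsE : eps = x0 ^+ 2 / 100).

Local Notation prof := (profile sg kap P Q).
Local Notation f := (graph_fun prof eps).
Local Notation la := (x0 ^+ 2 - 4 * eps).
Local Notation lvl := (level (f := f) (eps := eps)).
Local Notation hgt := (@height R f eps).

Let eps_itv : 0 <= eps /\ eps <= 1 / 400.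
Proof. by have [x0' x1'] := (x00, x01); rewrite epsE; split; [have := sqr_ge0 x0; lra | nra]. Qed.

Let pr_y x y y' : `|x| <= 8 -> -8 <= y -> y <= y' -> y' <= 8 ->
  (y' - y) / 2 <= prof x y' - prof x y <= 3 / 2 * (y' - y).
Proof. exact: (profile_y _ sgE Q_lip kap0 kQ). Qed.
Let pr_x x x' y : `|x| <= 8 -> `|x'| <= 8 -> `|y| <= 8 -> `|prof x y - prof x' y| <= eps / 2 * `|x - x'|.
Proof. exact: (profile_x _ HP tau_le tau_lip Q_le d0 kap0 dC kQe). Qed.
Let pr_0 x : `|x| <= 8 -> `|prof x 0| <= eps / 2.
Proof. exact: (profile_0 _ HP tau_le Q_le d0 kap0 dC kQe). Qed.
Let e0 : 0 <= eps. Proof. by case: eps_itv. Qed.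
Let e1 : eps <= 1. Proof. by case: eps_itv; lra. Qed.

Lemma profile_flat : flat_graph f (x0 / 2) 8 eps la 4.
Proof.
have [x0' x1'] := (x00, x01); have [he0 he1] := eps_itv; have eE := epsE.
have x2 : x0 ^+ 2 <= x0 / 2 by nra.
have x20 := sqr_ge0 x0.
split => //; try lra.
- by move=> x x' hx hx'; apply: (graph_fun_lip e0 e1 pr_y pr_x pr_0); exact: ltW.
- by move=> x hx; have [] := graph_funP e0 e1 pr_y pr_0 (ltW hx).
Qed.

Let C0 : 0 <= C.
Proof. by have h : 0 <= (0 : R) <= 64 by [rewrite lexx ler0n]; apply: le_trans (tau_le h). Qed.

(** The odd term gives [a = kap * x * Q(p)] in [test_diff]. With [p = d (w - w0)] and
    [Q(p) = d q(w)], the product [2 p a] becomes [2 x T_n(w) kap d^2]. The quadratic term of the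
    curve displaces [w] from [tau (x ^+ 2) + w0] by [p^2 / (64 d)] in absolute value. *)
Lemma test_level x p : 0 <= x -> x ^+ 2 <= 3 -> `|p| <= d * (2 * C) ->
  p - sg * p ^+ 2 / 64 = d * tau (x ^+ 2) -> x0 ^+ 2 <= x ^+ 2 ->
  let w := p / d + w0 in let l := x ^+ 2 + 2 * p in
  [/\ la + eps ^+ 2 < l < 4 - eps ^+ 2, `|w| <= 2 * C + 1, `|w - (tau (x ^+ 2) + w0)| <= d * C ^+ 2 &
   exists t1 t2, [/\ 1 / 2 <= t1 <= 5 / 2, 1 / 2 <= t2 <= 5 / 2 & hgt 1 l ^+ 2 - hgt (-1) l ^+ 2 =
     2 * x * (cheb n).[w] * (kap * d ^+ 2) * (t1 + t2) + kap ^+ 2 * d ^+ 2 * x ^+ 2 * q.[w] ^+ 2 * (t1 ^+ 2 - t2 ^+ 2)]].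
Proof.
move=> hx0 hx3 hp E hxx w l.
have [d0' dC'] := (d0, dC); have C0' := C0; have [he0 he1] := eps_itv; have eE := epsE; have x0' := x00.
have x020 : 0 < x0 ^+ 2 by rewrite exprn_gt0.
have dC0 : 0 <= d * C by rewrite mulr_ge0// ltW.
have pe : `|p| <= eps by apply: le_trans hp _; lra.
have ee : eps ^+ 2 <= eps by nra.
have hl : la + eps ^+ 2 < l < 4 - eps ^+ 2.
  by move: pe; rewrite ler_norml /l; lra.
have hlw : la <= l <= 4 by have := sqr_ge0 eps; move: hl; lra.
have dn0 : d != 0 by rewrite gt_eqF.
have wd : `|p / d| <= 2 * C by rewrite normrM normfV (gtr0_norm d0') ler_pdivrMr// mulrC.
have hw : `|w| <= 2 * C + 1 by apply: le_trans (ler_normD _ _) _; apply: lerD.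
have hwt : `|w - (tau (x ^+ 2) + w0)| <= d * C ^+ 2.
  have -> : w - (tau (x ^+ 2) + w0) = sg * p ^+ 2 / 64 / d.
    have -> : tau (x ^+ 2) = (p - sg * p ^+ 2 / 64) / d by rewrite E; field.
    by rewrite /w; field.
  rewrite !normrM !normfV (norm_sign sgE) mul1r (gtr0_norm d0') (ger0_norm (_ : 0 <= 64 :> R))// ler_pdivrMr//.
  have : `|p| * `|p| <= d * (2 * C) * (d * (2 * C)) by apply: ler_pM.
  by have := sqr_ge0 (d * C); lra.
split => //.
have x8 : x < 8 by nra.
have QE : Q.[p] = d * q.[w] by rewrite HQ.
have Hp : prof x p = - (kap * x * Q.[p]).
  by rewrite /profile HP -E; ring.
have Hm : prof (- x) p = kap * x * Q.[p].
  by rewrite /profile HP sqrrN -E; ring.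
have [t1 [t2 [h1 h2 E2]]] := test_diff e0 e1 pr_y pr_0 profile_flat hx0 x8 pe hlw Hp Hm.
exists t1, t2; split => //; rewrite E2 QE; congr (_ * _ + _ * _); last by ring.
have pd : p = d * (w - w0) by rewrite /w addrK mulrC divfK.
by rewrite [(cheb n).[w]]Hq {1}pd; ring.
Qed.

(** The sign of [T_n] at [x0] is not controlled; the bound rests on the factor [x0], which also
    appears in the quadratic error. Thus this point serves as a low level in front of the first
    node. *)
Lemma level_inner p : `|p| <= d * (2 * C) -> p - sg * p ^+ 2 / 64 = d * tau (x0 ^+ 2) ->
  lvl (x0 ^+ 2 + 2 * p) <= kap * d ^+ 2 * (x0 * (10 * Kn + 1)).
Proof.
move=> hp E; have [[x0' x1'] kKq'] := (x00, x01, kKq); have [kap0' d0'] := (kap0, d0).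
have x3 : x0 ^+ 2 <= 3 by nra.
have [hl hw _ [t1 [t2 [h1 h2 D]]]] := test_level (ltW x0') x3 hp E (lexx _).
have [Tn _] := Kn_le hw hw; have q2 := Kq_le hw.
have ee := sqr_ge0 eps.
have Kn0 : 0 <= Kn by apply: le_trans Tn.
have K0 : 0 < kap * d ^+ 2 by rewrite mulr_gt0// exprn_gt0.
apply: (level_le profile_flat); first by move: hl; lra.
  by rewrite mulr_ge0 ?(ltW K0)// mulr_ge0 ?(ltW x0')//; lra.
rewrite D; set w := p / d + w0 in Tn q2 *.
have q2' : q.[w] ^+ 2 <= Kq ^+ 2.
  by rewrite -[leLHS]real_normK ?num_real//; apply: lerXn2r; rewrite ?nnegrE//; apply: le_trans q2.
have Pb : 2 * x0 * (cheb n).[w] * (kap * d ^+ 2) <= 2 * x0 * Kn * (kap * d ^+ 2).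
  apply: ler_wpM2r; first exact: ltW.
  by apply: ler_wpM2l; [lra | apply: le_trans Tn; exact: ler_norm].
have b0 : 0 <= 2 * x0 * Kn * (kap * d ^+ 2).
  by apply: mulr_ge0; [apply: mulr_ge0 => //; lra | exact: ltW].
have A0 : 0 <= kap ^+ 2 * d ^+ 2 * x0 ^+ 2 * q.[w] ^+ 2 by rewrite -!exprMn sqr_ge0.
apply: le_trans (theta_abs h1 h2 Pb b0 A0) _.
have A1 : kap ^+ 2 * d ^+ 2 * x0 ^+ 2 * q.[w] ^+ 2 <= kap * d ^+ 2 * (x0 * (1 / 36)).
  have -> : kap ^+ 2 * d ^+ 2 * x0 ^+ 2 * q.[w] ^+ 2 = kap * d ^+ 2 * (x0 * (x0 * (kap * q.[w] ^+ 2))) by ring.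
  rewrite ler_pM2l// ler_pM2l//.
  have : kap * q.[w] ^+ 2 <= kap * Kq ^+ 2 by rewrite ler_pM2l.
  have : 0 <= kap * q.[w] ^+ 2 by rewrite mulr_ge0 ?sqr_ge0// ltW.
  nra.
have : 0 <= kap * d ^+ 2 * x0 by apply: mulr_ge0; exact: ltW.
by move: A1; set A := _ * q.[w] ^+ 2; lra.
Qed.

(** At a node [T_n] is 1 or -1, and by its Lipschitz bound stays within [1 / 2] of that value at
    [w]. As [x >= 1], the main term is at least [kap * d ^+ 2] in absolute value, and the quadratic
    error at most a twelfth of this. *)
Lemma level_test x p (b : bool) : 1 <= x -> x ^+ 2 <= 3 -> `|p| <= d * (2 * C) ->
  p - sg * p ^+ 2 / 64 = d * tau (x ^+ 2) -> `|tau (x ^+ 2) + w0| <= 1 ->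
  (cheb n).[tau (x ^+ 2) + w0] = (-1) ^+ b ->
  if b then lvl (x ^+ 2 + 2 * p) <= 0 else kap * d ^+ 2 / 384 <= lvl (x ^+ 2 + 2 * p).
Proof.
move=> hx1 hx3 hp E ht Tt; have [[x0' x1'] kKq'] := (x00, x01, kKq); have [[kap0' d0'] dKn'] := (kap0, d0, dKn).
have hx0 : 0 <= x by lra.
have xx : x0 ^+ 2 <= x ^+ 2 by nra.
have [hl hw hwt [t1 [t2 [h1 h2 D]]]] := test_level hx0 hx3 hp E xx.
have C0' := C0; have ht' : `|tau (x ^+ 2) + w0| <= 2 * C + 1 by lra.
have [_ Tn] := Kn_le hw ht'; have q2 := Kq_le hw.
have [Tn0 _] := Kn_le hw hw.
have Kn0 : 0 <= Kn by apply: le_trans Tn0.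
set w := p / d + w0 in Tn q2 hw hwt D Tn0.
have K0 : 0 < kap * d ^+ 2 by rewrite mulr_gt0// exprn_gt0.
have Tw : `|(cheb n).[w] - (-1) ^+ b| <= 1 / 2.
  rewrite -Tt; apply: le_trans Tn _; apply: le_trans (ler_wpM2l Kn0 hwt) _; lra.
have q2' : q.[w] ^+ 2 <= Kq ^+ 2.
  by rewrite -[leLHS]real_normK ?num_real//; apply: lerXn2r; rewrite ?nnegrE//; apply: le_trans q2.
have A0 : 0 <= kap ^+ 2 * d ^+ 2 * x ^+ 2 * q.[w] ^+ 2 by rewrite -!exprMn sqr_ge0.
have A1 : 12 * (kap ^+ 2 * d ^+ 2 * x ^+ 2 * q.[w] ^+ 2) <= kap * d ^+ 2.
  have -> : 12 * (kap ^+ 2 * d ^+ 2 * x ^+ 2 * q.[w] ^+ 2) = kap * d ^+ 2 * (12 * (x ^+ 2 * (kap * q.[w] ^+ 2))) by ring.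
  rewrite ger_pMr//.
  have : kap * q.[w] ^+ 2 <= kap * Kq ^+ 2 by rewrite ler_pM2l.
  have : 0 <= kap * q.[w] ^+ 2 by rewrite mulr_ge0 ?sqr_ge0// ltW.
  nra.
have ee := sqr_ge0 eps.
have hlw : la <= x ^+ 2 + 2 * p <= 4 by move: hl; lra.
set T := (cheb n).[w] in Tw D.
case: b Tw {Tt} => /=; rewrite ?expr1 ?expr0 ler_norml => /andP[Ta Tb].
  apply: (level_le profile_flat hlw) => //; rewrite D.
  apply: (theta_neg h1 h2 (ltW K0) _ A0 A1).
  have : 2 * x * T <= - 1 by nra.
  by move/(ler_wpM2r (ltW K0)); rewrite mulN1r.
(* The constant combines the half kept by [theta_pos] with the factor [32 * (lb + 2)] of [level_ge]
   for [lb = 4]. *)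
have -> : kap * d ^+ 2 / 384 = kap * d ^+ 2 / 2 / (32 * (4 + 2)) by field.
apply: (level_ge profile_flat hlw); first by rewrite divr_ge0// ltW.
rewrite D; apply: (theta_pos h1 h2 (ltW K0) _ A0 A1).
have : 1 <= 2 * x * T by nra.
by move/(ler_wpM2r (ltW K0)); rewrite mul1r.
Qed.

End TestLevels.

(** The constants depend on one another in the order [x0], [d], [S], [kap]: the size of the oval
    grows like [1 / d], and [kap] must be small with respect to it. The test points are the
    [k n + 1] nodes preceded by the inner point, which makes [k n + 1] gaps. *)
Theorem cycles_system (R : realType) (k n : nat) : (1 < k)%N -> (2 * k <= n)%N ->
  exists Z : pwl_system R n, ((k * n).+1%:R%:E <= counting (@limit_cycle R n Z) :> \bar R)%E.
Proof.
move=> k1 kn.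
have k0 : (0 < k)%N by exact: ltnW.
have n2 : (2 < n)%N by apply: leq_trans kn; lia.
have n0 : (0 < n)%N by apply: leq_trans n2.
have [w0 [q [w01 szq Hq]]] := @cheb_factor R n n0.
pose tau X : R := (cheb k).[2 - X] - w0.
pose sg : R := (-1) ^+ k.
have sgE : sg = 1 \/ sg = -1.
  by rewrite /sg -signr_odd; case: (odd k); [right; rewrite expr1 | left; rewrite expr0].
have sg2 : sg * sg = 1 by case: sgE => ->; rewrite ?mulrNN mulr1.
have sgN x : `|sg * x| = `|x| by rewrite normrM (norm_sign sgE) mul1r.
have sgtau X : sg * tau X = (cheb k).[X - 2] - sg * w0.
  rewrite /tau -[2 - X]opprB chebN mulrBr mulrA -/sg sg2 mul1r //.
(* The bound 62 covers [2 - x^2] for all abscissas of the box [|x| <= 8]. *)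
have [K K0 HK] := poly_lip (@cheb R k) 62.
pose C := K + 1.
have C0 : 0 < C by rewrite /C; lra.
have X62 (X : R) : 0 <= X <= 64 -> `|2 - X| <= 62 by move=> hX; rewrite ler_norml; lra.
have tau_le (X : R) : 0 <= X <= 64 -> `|tau X| <= C.
  move=> /X62 hX; have [h _] := HK _ _ hX hX; rewrite /tau /C.
  by apply: le_trans (ler_normB _ _) _; apply: lerD.
have tau_lip (X X' : R) : 0 <= X <= 64 -> 0 <= X' <= 64 -> `|tau X - tau X'| <= C * `|X - X'|.
  move=> /X62 hX /X62 hX'; have [_ h] := HK _ _ hX hX'; rewrite /tau.
  have -> : (cheb k).[2 - X] - w0 - ((cheb k).[2 - X'] - w0) = (cheb k).[2 - X] - (cheb k).[2 - X'] by ring.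
  apply: le_trans h _; have -> : 2 - X - (2 - X') = - (X - X') by ring.
  by rewrite normrN ler_wpM2r// /C; lra.
have I64 (X : R) : 0 <= X <= 4 -> 0 <= X <= 64 by lra.
have sig_le (X : R) : 0 <= X <= 4 -> `|sg * tau X| <= C by move=> /I64 h; rewrite sgN tau_le.
have sig_lip (X X' : R) : 0 <= X <= 4 -> 0 <= X' <= 4 -> `|sg * tau X - sg * tau X'| <= C * `|X - X'|.
  by move=> /I64 h /I64 h'; rewrite -mulrBr sgN tau_lip.
have sig_slope (X' X : R) : 3 <= X' -> X' <= X -> X - X' <= sg * tau X - sg * tau X'.
  move=> h1 h2; rewrite !sgtau.
  have a1 : 1 <= X' - 2 by lra.
  have a2 : X' - 2 <= X - 2 by lra.
  have := @cheb_slope1 R k.-1 _ _ a1 a2; rewrite (prednK k0); lra.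
have sig_far (X' X : R) : 0 <= X' <= 4 -> 4 <= X -> sg * tau X' <= sg * tau X.
  move=> h1 h2; rewrite !sgtau lerD2r.
  have a1 : `|X' - 2| <= 2 by rewrite ler_norml; lra.
  have := le_trans (ler_norm _) (cheb_le2 k a1).
  have b1 : 1 <= 2 :> R by lra.
  have b2 : 2 <= X - 2 by lra.
  by have [_ _ + _] := cheb_slope k b1 b2; lra.
have [Kn Kn0 HKn] := poly_lip (@cheb R n) (2 * C + 1).
have [Kq Kq0 HKq] := poly_lip q (2 * C + 1).
have Kq_le (w : R) : `|w| <= 2 * C + 1 -> `|q.[w]| <= Kq by move=> hw; have [] := HKq _ _ hw hw.
have [g0 g00 Hg] : exists2 g : R, 0 < g & forall j, (j < k * n)%N -> g <= node k n j.+1 - node k n j.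
  by apply: ex_gap => j hj; rewrite subr_gt0 node_lt.
(* In turn: the inner point stays left of the nodes, the height corrections do not disturb the order
   of the nodes, and the inner level falls below the high ones, since [1 / 400 < 1 / 384]. *)
have [x0 x00] : exists2 x0 : R, 0 < x0 & all (fun p => x0 * p.1 <= p.2) [:: (2, 1); (1, g0); (10 * Kn + 1, 1 / 400)].
  have h400 : 0 < 1 / 400 :> R by clear; lra.
  by apply: exists_small; rewrite /= ltr01 g00 h400.
rewrite /= andbT mulr1 => /and3P[x02 x0g x0K].
have x01 : x0 <= 1 / 2 by clear -x02; lra.
pose eps := x0 ^+ 2 / 100.
have x020 : 0 < x0 ^+ 2 by rewrite exprn_gt0.
have x0sq : x0 ^+ 2 <= x0 by clear -x01 x00; nra.
have eps0 : 0 < eps by rewrite divr_gt0.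
have epsx : eps <= x0 / 100 by rewrite /eps ler_pM2r// invr_gt0.
(* In turn: base points exist, the graph is [eps]-flat, and [T_n] keeps its sign when [w] moves away
   from its node value. *)
have [d d0] : exists2 d : R, 0 < d & all (fun p => d * p.1 <= p.2) [:: (2 * C, 1); (64 * C, eps); (Kn * C ^+ 2, 1 / 2)].
  have h2 : 0 < 1 / 2 :> R by clear; lra.
  by apply: exists_small; rewrite /= eps0 ltr01 h2.
rewrite /= andbT => /and3P[dC1 dC dKn].
pose P : {poly R} := d *: ((cheb k \Po (2%:P - 'X)) - w0%:P).
pose Q : {poly R} := d *: (q \Po (d^-1 *: 'X + w0%:P)).
have HP X : P.[X] = d * tau X by rewrite /P /tau !(hornerE, horner_comp).
have HQ y : Q.[y] = d * q.[y / d + w0].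
  by rewrite /Q hornerZ horner_comp !hornerE [d^-1 * y]mulrC.
have dn0 : d != 0 by rewrite gt_eqF.
have sizeQ : size Q = n.
  rewrite /Q size_scale// size_comp_poly2// size_polyDl size_scale ?invr_eq0// size_polyX//.
  by apply: leq_ltn_trans (size_polyC_leq1 _) _.
have sizeP : (2 * (size P).-1 <= n)%N.
  apply: leq_trans kn; rewrite leq_mul2l /=.
  have : (size P <= k.+1)%N.
    apply: leq_trans (size_scale_leq _ _) _; apply: leq_trans (size_polyD _ _) _.
    rewrite geq_max size_polyN (leq_trans (size_polyC_leq1 _))// andbT.
    apply: leq_trans (size_comp_poly_leq _ _) _.
    have [-> _] := @size_cheb R k; rewrite ltnS /= -[leqRHS]muln1 leq_mul2l orbC.
    have : (size (2%:P - 'X : {poly R})%R <= 2)%N.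
      apply: leq_trans (size_polyD _ _) _.
      by rewrite geq_max size_polyN size_polyX (leq_trans (size_polyC_leq1 _)).
    by case: (size _) => [|[|[|]]].
  by case: (size P).
pose S : R := 40 + 17 / d + 3 + C.
have d17 : 0 < 17 / d by rewrite divr_gt0.
have S40 : 40 <= S by rewrite /S; clear -d17 C0; lra.
have Sd : 17 / d + 3 + C <= S by rewrite /S; clear; clearbody C; move: (17 / d) => z; lra.
have [KQ KQ0 HKQ] := poly_lip Q (S + 32).
have S32 (y : R) : `|y| <= S -> `|y + 32 * sg| <= S + 32.
  by move=> hy; apply: le_trans (ler_normD _ _) _; rewrite normrM (norm_sign sgE) mulr1 [ `|32|]ger0_norm// lerD2r.
have E8 (y : R) : `|y| <= 8 -> `|y| <= S + 32 by clear -S40; clearbody S; lra.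
have Q_le (y : R) : `|y| <= 8 -> `|Q.[y]| <= KQ by move=> /E8 h; have [] := HKQ _ _ h h.
have Q_lip (y y' : R) : `|y| <= 8 -> `|y'| <= 8 -> `|Q.[y] - Q.[y']| <= KQ * `|y - y'|.
  by move=> /E8 h /E8 h'; have [] := HKQ _ _ h h'.
pose L := (S + 1) * KQ.
have S0 : 0 < S by apply: lt_le_trans S40.
have SKQ : S * KQ <= L by apply: ler_wpM2r; [exact: ltW | rewrite lerDl].
have KQL : KQ <= L by rewrite -[KQ]mul1r; apply: ler_wpM2r; [exact: ltW | rewrite lerDr ltW].
have E_le (x y : R) : `|x| <= S -> `|y| <= S -> `|sg * (x * Q.[y + 32 * sg])| <= L.
  move=> hx /S32 hy; have [h _] := HKQ _ _ hy hy; rewrite sgN normrM.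
  by apply: le_trans SKQ; apply: ler_pM.
have E_lip (x y x' y' : R) : `|x| <= S -> `|y| <= S -> `|x'| <= S -> `|y'| <= S ->
    `|sg * (x * Q.[y + 32 * sg]) - sg * (x' * Q.[y' + 32 * sg])| <= L * (`|x - x'| + `|y - y'|).
  move=> hx /S32 hy hx' /S32 hy'; have [h1 _] := HKQ _ _ hy hy; have [_ h2] := HKQ _ _ hy hy'.
  rewrite -mulrBr sgN.
  have -> : x * Q.[y + 32 * sg] - x' * Q.[y' + 32 * sg] = (x - x') * Q.[y + 32 * sg] + x' * (Q.[y + 32 * sg] - Q.[y' + 32 * sg]) by ring.
  apply: le_trans (ler_normD _ _) _; rewrite !normrM mulrDr; apply: lerD.
    by rewrite mulrC; apply: ler_wpM2r => //; apply: le_trans KQL.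
  have e : y + 32 * sg - (y' + 32 * sg) = y - y' by ring.
  rewrite e in h2; apply: le_trans (_ : S * (KQ * `|y - y'|) <= _); first by apply: ler_pM.
  by rewrite mulrA; apply: ler_wpM2r.
pose m := d ^+ 2 / 384; pose c := x0 / 2.
have c0 : 0 < c by rewrite divr_gt0.
(* The first three constraints preserve the star shape, the next two the flat graph, and the sixth
   bounds the quadratic error. The last three make every admissible [mu], being below [kap * m],
   small with respect to [c], [M = 8] and [lb = 4]. *)
have [kap kap0] : exists2 kap : R, 0 < kap & all (fun p => kap * p.1 <= p.2)
    [:: (L, 1 / 2); (L * (2 * S), 1); (L * (2 * S), d); (8 * KQ, 1 / 8); (8 * KQ, eps / 4);
        (36 * Kq ^+ 2, 1); (4 * m, c); (m * 8, 1); (m * (2 / c + 8) * (4 * (4 + 2)), 1)].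
  have h2 : 0 < 1 / 2 :> R by clear; lra.
  have h8 : 0 < 1 / 8 :> R by clear; lra.
  have e4 : 0 < eps / 4 by rewrite divr_gt0.
  by apply: exists_small; rewrite /= d0 c0 ltr01 h2 h8 e4.
rewrite /= andbT => /and5P[kapL kapLS kapLd kQ /and5P[kQe kKq km1 km2 km3]].
rewrite mulrA in kapLS; rewrite mulrA in kapLd.
have dC2 : d * C <= 1 / 2 by clear -dC1; clearbody C; lra.
have [e0 e1] : 0 <= eps /\ eps <= 1 by clear -eps0 epsx x01; clearbody eps; split; lra.
have Pts (X : R) : 0 <= X <= 64 -> exists p, `|p| <= d * (2 * C) /\ p - sg * p ^+ 2 / 64 = d * tau X.
  by move=> hX; exact: (base_point sgE tau_le d0 hX dC1).
pose base X := xget 0 [set p : R | `|p| <= d * (2 * C) /\ p - sg * p ^+ 2 / 64 = d * tau X].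
have baseP (X : R) : 0 <= X <= 64 -> `|base X| <= d * (2 * C) /\ base X - sg * base X ^+ 2 / 64 = d * tau X.
  by move=> /Pts[p hp]; have H : [set p : R | `|p| <= d * (2 * C) /\ p - sg * p ^+ 2 / 64 = d * tau X] p by []; exact: (xgetI 0 H).
(* Index 0 is the inner point and node [j] has index [j.+1], so the high levels, at even nodes,
   occur at odd indices. *)
pose X_ (i : nat) : R := if i is j.+1 then node k n j else x0 ^+ 2.
pose lam i : R := X_ i + 2 * base (X_ i).
have X_itv i : x0 ^+ 2 <= X_ i <= 3.
  case: i => [|j]; rewrite /X_ ?lexx /=; first by clear -x0sq x01; lra.
  by have := @node_itv R k n j; set y := node k n j; clearbody y; clear -x0sq x01; lra.
have X_64 i : 0 <= X_ i <= 64.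
  by have := X_itv i; move: (X_ i) => y; clear -x020; lra.
have X_sqr i : Num.sqrt (X_ i) ^+ 2 = X_ i by rewrite sqr_sqrtr//; case/andP: (X_64 i).
have dC00 : 0 < d * C by rewrite mulr_gt0.
have dCe : d * (2 * C) <= eps by clear -dC dC00; clearbody C eps; lra.
have bse i : `|base (X_ i)| <= eps by have [h _] := baseP _ (X_64 i); exact: le_trans dCe.
have FG := profile_flat sgE HP tau_le tau_lip Q_le Q_lip d0 kap0 dC kQ kQe x00 x01 (erefl eps).
have K1 : 0 < kap * d ^+ 2 by rewrite mulr_gt0// exprn_gt0.
have m01 : kap * d ^+ 2 * (x0 * (10 * Kn + 1)) < kap * d ^+ 2 / 384.
  by rewrite ltr_pM2l//; clear -x0K; lra.
have K10 : 0 <= 10 * Kn + 1 by clear -Kn0; lra.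
have mE : kap * d ^+ 2 / 384 = kap * m by rewrite /m mulrA.
apply: (many_cycles (N := (k * n).+1) (lam := lam) FG _ m01).
- by rewrite mulr_ge0 ?(ltW K1)// mulr_ge0 ?(ltW x00).
- by rewrite mE mulrCA.
- by rewrite mE -mulrA.
- by rewrite mE -!mulrA; move: km3; rewrite -!mulrA.
- move=> i _; have [h1 h2] := baseP _ (X_64 i).
  have sq0 : 0 <= Num.sqrt (X_ i) by exact: sqrtr_ge0.
  have x3 : Num.sqrt (X_ i) ^+ 2 <= 3 by rewrite X_sqr; case/andP: (X_itv i).
  have xx : x0 ^+ 2 <= Num.sqrt (X_ i) ^+ 2 by rewrite X_sqr; case/andP: (X_itv i).
  have h2' : base (X_ i) - sg * base (X_ i) ^+ 2 / 64 = d * tau (Num.sqrt (X_ i) ^+ 2) by rewrite X_sqr.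
  have [+ _ _ _] := test_level sgE HP HQ Hq tau_le tau_lip Q_le Q_lip d0 kap0 dC kQ kQe w01 x00 x01 (erefl eps) sq0 x3 h1 h2' xx.
  by rewrite X_sqr.
- move=> i hi; have := bse i; have := bse i.+1; rewrite /lam !ler_norml => b1 b2.
  have gp : X_ i + 4 * eps < X_ i.+1.
    case: i hi {b1 b2} => [|j] hj; rewrite /X_.
      have := @node_itv R k n 0; set y := node k n 0; clearbody y; clear -epsx x0sq x01 x00.
      by clearbody eps; lra.
    have := Hg j hj; set y := node k n j; set y' := node k n j.+1; clearbody y y'.
    by clear -x0g x00 epsx; clearbody eps; lra.
  by move: gp b1 b2; move: (X_ i) (X_ i.+1) (base _) (base _); clear -eps0; clearbody eps => *; lra.
- move=> [//|j] hj; rewrite /= => oj; have [h1 h2] := baseP _ (X_64 j.+1).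
  have x3 : Num.sqrt (X_ j.+1) ^+ 2 <= 3 by rewrite X_sqr; case/andP: (X_itv j.+1).
  have x1 : 1 <= Num.sqrt (X_ j.+1).
    by rewrite -sqrtr1 ler_wsqrtr// /X_; have /andP[] := @node_itv R k n j.
  have tw : tau (X_ j.+1) + w0 = cos (j%:R * (pi / n%:R)) by rewrite /tau subrK cheb_node.
  have tw1 : `|tau (X_ j.+1) + w0| <= 1 by rewrite tw ler_norml cos_geN1 cos_le1.
  have Tt : (cheb n).[tau (X_ j.+1) + w0] = (-1) ^+ false by rewrite tw cheb_node_alt// -signr_odd (negPf oj).
  have h2' : base (X_ j.+1) - sg * base (X_ j.+1) ^+ 2 / 64 = d * tau (Num.sqrt (X_ j.+1) ^+ 2) by rewrite X_sqr.
  rewrite -(X_sqr j.+1) in tw1 Tt.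
  have := level_test sgE HP HQ Hq tau_le tau_lip Q_le Q_lip d0 kap0 dC kQ kQe HKn Kq_le dKn kKq w01 x00 x01 (erefl eps) x1 x3 h1 h2' tw1 Tt.
  by rewrite X_sqr.
- move=> [_ _|j hj oj].
    have [h1 h2] := baseP _ (X_64 0%N).
    exact: (level_inner sgE HP HQ Hq tau_le tau_lip Q_le Q_lip d0 kap0 dC kQ kQe HKn Kq_le kKq w01 x00 x01 (erefl eps) h1 h2).
  have [h1 h2] := baseP _ (X_64 j.+1).
  have x3 : Num.sqrt (X_ j.+1) ^+ 2 <= 3 by rewrite X_sqr; case/andP: (X_itv j.+1).
  have x1 : 1 <= Num.sqrt (X_ j.+1).
    by rewrite -sqrtr1 ler_wsqrtr// /X_; have /andP[] := @node_itv R k n j.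
  have tw : tau (X_ j.+1) + w0 = cos (j%:R * (pi / n%:R)) by rewrite /tau subrK cheb_node.
  have tw1 : `|tau (X_ j.+1) + w0| <= 1 by rewrite tw ler_norml cos_geN1 cos_le1.
  have oj' : odd j by move: oj; rewrite /= negbK.
  have Tt : (cheb n).[tau (X_ j.+1) + w0] = (-1) ^+ true by rewrite tw cheb_node_alt// -signr_odd oj'.
  have h2' : base (X_ j.+1) - sg * base (X_ j.+1) ^+ 2 / 64 = d * tau (Num.sqrt (X_ j.+1) ^+ 2) by rewrite X_sqr.
  rewrite -(X_sqr j.+1) in tw1 Tt.
  have := level_test sgE HP HQ Hq tau_le tau_lip Q_le Q_lip d0 kap0 dC kQ kQe HKn Kq_le dKn kKq w01 x00 x01 (erefl eps) x1 x3 h1 h2' tw1 Tt.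
  rewrite X_sqr => /le_trans; apply.
  by rewrite mulr_ge0 ?(ltW K1)// mulr_ge0 ?(ltW x00).
- move=> mu mu0 mum.
  rewrite mE in mum.
  apply: (system_exists sgE HP n2 sizeP sizeQ sig_slope sig_le sig_lip sig_far E_le E_lip d0 dC2 kap0 kapL kapLS kapLd S40 Sd e0 e1) => //.
  + exact: (profile_y _ sgE Q_lip kap0 kQ).
  + exact: (profile_x _ HP tau_le tau_lip Q_le d0 kap0 dC kQe).
  + exact: (profile_0 _ HP tau_le Q_le d0 kap0 dC kQe).
  + by clear -x01 x00; lra.
  + by clear -epsx x00; clearbody eps; lra.
  + by apply: le_trans km1; rewrite [leRHS]mulrCA ler_pM2l// ltW.
  + by apply: le_trans km2; rewrite mulrA ler_pM2r// ltW.
Qed.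

Theorem theorem1 (R : realType) (k : nat) (hk : (1 < k)%N) :
  ((k ^ 2 + 2 * k + 1)%N%:R%:E <= calL R (2 * k)%N)%E /\
  ((k ^ 2 + 2 * k + 3)%N%:R%:E <= calL R (2 * k + 1)%N)%E.
Proof.
have lower n : (2 * k <= n)%N -> ((k * n).+1%:R%:E <= calL R n)%E.
  move=> kn; have [Z HZ] := @cycles_system R k n hk kn.
  by apply: le_trans HZ _; apply: ereal_sup_ubound; exists Z.
(* The counts obtained are [2 k^2 + 1] and [2 k^2 + k + 1]; both comparisons are equalities at
   [k = 2]. *)
split; [apply: le_trans (lower _ (leqnn _)) | apply: le_trans (lower _ (leq_addr _ _))];
  rewrite lee_fin ler_nat; nia.
Qed.
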